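(* Let $\mathcal{G}\rightrightarrows M$ be a Lie groupoid with connected target fibres, with Lie algebroid $A\Rightarrow M$ and anchor $\rho$, and let $p:V\to M$ be a representation of $\mathcal{G}$. Denote by $\nabla^A$ the corresponding flat $A$-connection on $V$. A linear connection $\nabla$ on $V$ is $\mathcal{G}$-invariant if and only if $$\nabla^A_a=\nabla_{\rho(a)}\qquad\text{and}\qquad R^\nabla(\rho(a),v)=0,$$ for all $x\in M$, $a\in A_x$ and $v\in T_xM$, where $R^\nabla$ is the curvature of $\nabla$.
   Context: Source $s$, target $t$, multiplication on pairs $(g,h)$ with $s(g)=t(h)$; $A=\ker(dt)|_M$ with bracket of left-invariant vector fields and anchor $\rho=ds|_A$. The flat $A$-connection $\nabla^A:\Gamma(A)\times\Gamma(V)\to\Gamma(V)$ is the infinitesimal action: for $a\in A_x$ and a curve $g(\epsilon)$ in $t^{-1}(x)$ with $g(0)=1_x$, $g'(0)=a$, $(\nabla^A_a\sigma)(x)=\frac{d}{d\epsilon}|_{\epsilon=0}\,g(\epsilon)\cdot\sigma(s(g(\epsilon)))$. A linear connection $\nabla$ on $V$ is $\mathcal{G}$-invariant if the vector bundle isomorphism $s^*V\to t^*V$, $(g,v)\mapsto(g,g\cdot v)$, maps the pullback connection $s^*\nabla$ to $t^*\nabla$. *)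

(* Defs.v *)
From HB Require Import structures.
From mathcomp Require Import all_boot all_order all_algebra.
From mathcomp Require Import all_classical all_reals all_analysis.
Set Implicit Arguments.
Unset Strict Implicit.
Unset Printing Implicit Defensive.
Import Order.TTheory GRing.Theory Num.Theory.
Import numFieldNormedType.Exports.
Local Open Scope classical_set_scope.
Local Open Scope ring_scope.

(** * Smooth maps between open subsets of normed spaces *)

Section Smooth.
Context {R : realType}.

(* In finite dimension, requiring each x |-> df_x(v) to be C^k amounts to
   requiring x |-> df_x to be C^k.  Values of f outside U are irrelevant as
   soon as U is open, which is always the case below. *)
Fixpoint Ck (k : nat) (E F : normedModType R) (U : set E) (f : E -> F) : Prop :=
  match k with
  | 0 => forall x, U x -> {for x, continuous f}
  | k'.+1 => (forall x, U x -> differentiable f x) /\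
             forall v, Ck k' U (fun x => 'd f x v)
  end.

Definition Cinf (E F : normedModType R) (U : set E) (f : E -> F) : Prop :=
  forall k, Ck k U f.

Lemma Ck_cst k (E F : normedModType R) (U : set E) (a : F) :
  Ck k U (fun _ : E => a).
Proof.
elim: k a => [|k IH] a /=; first by move=> x _; exact: cvg_cst.
split=> [x _|v]; first exact: differentiable_cst.
rewrite (_ : (fun x => _) = fun=> 0); first exact: IH.
by apply/funext => x; rewrite (_ : (fun=> a) = cst a)// diff_cst.
Qed.

Lemma Cinf_id (E : normedModType R) (U : set E) : Cinf U (@idfun E).
Proof.
case=> [|k] /=; first by move=> x _; exact: cvg_id.
split=> [x _|v]; first exact: ex_diff.
rewrite (_ : (fun x => _) = fun=> v); first exact: Ck_cst.
by apply/funext => x; rewrite diff_val.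
Qed.

Lemma Ck_sub k (E F : normedModType R) (U U' : set E) (f : E -> F) :
  U `<=` U' -> Ck k U' f -> Ck k U f.
Proof.
move=> UU'; elim: k f => [|k IH] f /= Hf; first by move=> x /UU'; exact: Hf.
by case: Hf => df Hf; split=> [x /UU'|v]; [exact: df | exact: IH (Hf v)].
Qed.

Lemma is_diff_near (E F : normedModType R) (f g : E -> F) x :
  (\forall y \near x, f y = g y) -> differentiable f x ->
  is_diff x g ('d f x).
Proof.
move=> fg df; have fgx := nbhs_singleton fg.
have [cf] := (diff_locallyP x f).1 df => /eqaddoP ef.
have eg : g \o shift x = cst (g x) + 'd f x +o_ (0 : E) id.
  apply/eqaddoP => e e0; have := ef e e0; rewrite -fgx => efe.
  have : \forall h \near (0 : E), f (h + x) = g (h + x).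
    have sh : (fun h => h + x) @ (0 : E) --> x.
      rewrite -[X in _ --> X]add0r; apply: cvgD; [exact: cvg_id|exact: cvg_cst].
    exact: sh fg.
  by apply: filterS2 efe => h; rewrite /= !fctE /= => + fgh; rewrite fgh.
have dE := diff_unique cf eg.
apply: DiffDef => //; apply/diff_locallyP; split; first by rewrite dE.
by rewrite dE.
Qed.

Lemma Ck_eq k (E F : normedModType R) (U : set E) (f g : E -> F) :
  open U -> (forall x, U x -> f x = g x) -> Ck k U f -> Ck k U g.
Proof.
move=> oU; elim: k f g => [|k IH] f g fg.
  move=> Hf x Ux; have fgn : \forall y \near x, f y = g y.
    by apply: filterS (open_nbhs_nbhs (conj oU Ux)) => y; exact: fg.
  rewrite /prop_for /continuous_at -(fg _ Ux).
  by apply: cvg_trans (Hf x Ux); apply: near_eq_cvg.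
case=> df Hf; have key x : U x -> is_diff x g ('d f x).
  move=> Ux; apply: is_diff_near (df _ Ux).
  by apply: filterS (open_nbhs_nbhs (conj oU Ux)) => y; exact: fg.
split=> [x /key ?|v]; first exact: ex_diff.
by apply: IH (Hf v) => x /key ?; rewrite (diff_val (f := g)).
Qed.

Lemma openX (T1 T2 : topologicalType) (A : set T1) (B : set T2) :
  open A -> open B -> open (A `*` B).
Proof.
move=> oA oB; rewrite openE => -[x y] [/= Ax By].
by exists (A, B) => //=; split; exact: open_nbhs_nbhs.
Qed.

Lemma Ck_prod k (E1 E2 F1 F2 : normedModType R) (U : set E1) (U' : set E2)
    (f : E1 -> F1) (g : E2 -> F2) : open U -> open U' ->
  Ck k U f -> Ck k U' g ->
  Ck k (U `*` U') (fun u : E1 * E2 => (f u.1, g u.2)).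
Proof.
move=> oU oU'; elim: k f g => [|k IH] f g.
  move=> /= Hf Hg [x y] /= [Ux Uy].
  apply: cvg_pair; apply: cvg_comp.
  - exact: cvg_fst.
  - exact: Hf Ux.
  - exact: cvg_snd.
  - exact: Hg Uy.
case=> df Hf [dg Hg].
pose p1 : {linear (E1 * E2)%type -> E1} := fst.
pose p2 : {linear (E1 * E2)%type -> E2} := snd.
have c1 : continuous p1 by move=> z; exact: cvg_fst.
have c2 : continuous p2 by move=> z; exact: cvg_snd.
have key z : (U `*` U') z -> is_diff z (fun u : E1 * E2 => (f u.1, g u.2))
    (fun u => ('d f (z.1) u.1, 'd g (z.2) u.2)).
  case=> /df dfz /dg dgz.
  have d1 : is_diff z p1 p1.
    by apply: DiffDef; [exact: linear_differentiable|rewrite diff_lin].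
  have d2 : is_diff z p2 p2.
    by apply: DiffDef; [exact: linear_differentiable|rewrite diff_lin].
  have h1 : is_diff z (f \o p1) ('d f (z.1) \o p1).
    by apply: is_diff_comp => //; exact: differentiableP.
  have h2 : is_diff z (g \o p2) ('d g (z.2) \o p2).
    by apply: is_diff_comp => //; exact: differentiableP.
  exact: (is_diff_pair h1 h2).
split=> [z /key ?|v]; first exact: ex_diff.
apply: Ck_eq (IH _ _ (Hf v.1) (Hg v.2)); first exact: openX.
by move=> z /key dz; rewrite (diff_val (f := fun u : E1 * E2 => (f u.1, g u.2))).
Qed.

End Smooth.

(** * Manifolds *)

(* A chart of T modelled on E: a homeomorphism from the open set cdom onto the
   open set cimg, both maps being extended by junk values. *)
Record chart (R : realType) (E : normedModType R) (T : topologicalType) :=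
  Chart {
  cdom : set T;
  cimg : set E;
  cmap : T -> E;
  cinv : E -> T;
  cdom_open : open cdom;
  cimg_open : open cimg;
  cmap_img : forall p, cdom p -> cimg (cmap p);
  cinv_dom : forall u, cimg u -> cdom (cinv u);
  cmapK : forall p, cdom p -> cinv (cmap p) = p;
  cinvK : forall u, cimg u -> cmap (cinv u) = u;
  cmap_continuous : forall p, cdom p -> {for p, continuous cmap};
  cinv_continuous : forall u, cimg u -> {for u, continuous cinv} }.

(* A space with a smooth atlas modelled on E, given as a family of charts in
   which chart_at x is a chosen chart around x.  Separation and countability
   conditions are not part of the structure. *)
Record mfd (R : realType) (E : normedModType R) := Mfd {
  mfd_carrier :> topologicalType;
  chart_at : mfd_carrier -> chart E mfd_carrier;
  chart_at_dom : forall x, cdom (chart_at x) x;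
  chart_at_compat : forall x y,
    Cinf (cimg (chart_at x) `&` cinv (chart_at x) @^-1` cdom (chart_at y))
         (cmap (chart_at y) \o cinv (chart_at x)) }.

Arguments chart_at {R E m} x.

Section Euclid.
Context {R : realType} (E : normedModType R).

Definition id_chart : chart E E :=
  @Chart R E E setT setT idfun idfun openT openT
    (fun p Hp => Hp) (fun p Hp => Hp) (fun p _ => erefl) (fun p _ => erefl)
    (fun p _ => @cvg_id _ (nbhs p)) (fun p _ => @cvg_id _ (nbhs p)).

Definition euclid : mfd E :=
  @Mfd R E E (fun=> id_chart) (fun=> I) (fun _ _ => Cinf_id _).

End Euclid.

Section ProductManifold.
Context {R : realType} (E F : normedModType R) (M : mfd E) (N : mfd F).

Section ProductChart.
Variables (a : chart E M) (b : chart F N).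

Let pmap (p : M * N) : E * F := (cmap a p.1, cmap b p.2).
Let pinv (u : E * F) : M * N := (cinv a u.1, cinv b u.2).

Definition prod_chart : chart (E * F)%type (M * N)%type.
Proof.
apply: (@Chart R (E * F)%type (M * N)%type (cdom a `*` cdom b)
  (cimg a `*` cimg b) pmap pinv).
- exact: openX (cdom_open a) (cdom_open b).
- exact: openX (cimg_open a) (cimg_open b).
- by move=> p [? ?]; split; exact: cmap_img.
- by move=> u [? ?]; split; exact: cinv_dom.
- by move=> [p q] [? ?]; rewrite /pinv /pmap /= !cmapK.
- by move=> [p q] [? ?]; rewrite /pinv /pmap /= !cinvK.
- move=> [p q] [/= Hp Hq]; apply: cvg_pair; apply: cvg_comp.
  + exact: cvg_fst.
  + exact: cmap_continuous Hp.
  + exact: cvg_snd.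
  + exact: cmap_continuous Hq.
- move=> [p q] [/= Hp Hq]; apply: cvg_pair; apply: cvg_comp.
  + exact: cvg_fst.
  + exact: cinv_continuous Hp.
  + exact: cvg_snd.
  + exact: cinv_continuous Hq.
Defined.

End ProductChart.

Lemma cimg_cdom_open (T : topologicalType) (H : normedModType R)
    (a : chart H T) (A : set T) : open A -> open (cimg a `&` cinv a @^-1` A).
Proof.
move=> oA; rewrite openE => u [au Au].
apply: filterI; first exact: open_nbhs_nbhs (conj (cimg_open a) au).
exact: (cinv_continuous au) (open_nbhs_nbhs (conj oA Au)).
Qed.

Definition prod_mfd : mfd (E * F)%type.
Proof.
apply: (@Mfd R (E * F)%type (M * N)%type
  (fun p => prod_chart (chart_at p.1) (chart_at p.2))) => [p|p q k].
  by split; exact: chart_at_dom.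
apply: (@Ck_sub R k _ _ _ ((cimg (chart_at p.1) `&`
     cinv (chart_at p.1) @^-1` cdom (chart_at q.1)) `*`
   (cimg (chart_at p.2) `&` cinv (chart_at p.2) @^-1` cdom (chart_at q.2)))).
  by move=> u [[? ?] [? ?]].
apply: (@Ck_prod R k E F E F _ _
  (cmap (chart_at q.1) \o cinv (chart_at p.1))
  (cmap (chart_at q.2) \o cinv (chart_at p.2))).
- exact: cimg_cdom_open (cdom_open _).
- exact: cimg_cdom_open (cdom_open _).
- exact: chart_at_compat.
- exact: chart_at_compat.
Defined.

End ProductManifold.

Section SmoothMaps.
Context {R : realType}.

(* Used with U open. *)
Definition smooth_on (E F : normedModType R) (M : mfd E) (N : mfd F)
    (U : set M) (f : M -> N) : Prop :=
  (forall p, U p -> {for p, continuous f}) /\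
  forall (x : M) (y : N),
    Cinf (cimg (chart_at x) `&`
          cinv (chart_at x) @^-1` (U `&` f @^-1` cdom (chart_at y)))
         (cmap (chart_at y) \o f \o cinv (chart_at x)).

(* Smoothness of a map on an arbitrary subset A: local smooth extendability.
   When A is an embedded submanifold this is smoothness on A. *)
Definition smooth_on_subset (E F : normedModType R) (M : mfd E) (N : mfd F)
    (A : set M) (f : M -> N) : Prop :=
  forall p, A p -> exists (U : set M) (h : M -> N),
    [/\ open U, U p, smooth_on U h & forall q, U q -> A q -> h q = f q].

(* T_x M is represented by the model space E through the chart chart_at x, for
   every M : mfd E.  Under this identification tmap f x is the tangent map
   T_x M -> T_(f x) N. *)
Definition tmap (E F : normedModType R) (M : mfd E) (N : mfd F)
    (f : M -> N) (x : M) (v : E) : F :=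
  'd (cmap (chart_at (f x)) \o f \o cinv (chart_at x)) (cmap (chart_at x) x) v.

(* The value at x of the section corresponding to a vector field in the
   coordinates of chart c. *)
Definition coord_vf (E : normedModType R) (M : mfd E) (c : chart E M)
    (X : M -> E) (u : E) : E :=
  tmap (cmap c : M -> euclid E) (cinv c u) (X (cinv c u)).

Definition smooth_vf (E : normedModType R) (M : mfd E) (U : set M)
    (X : M -> E) : Prop :=
  forall c : M, Cinf (cimg (chart_at c) `&` cinv (chart_at c) @^-1` U)
                     (coord_vf (chart_at c) X).

(* [X, Y] = XY - YX, i.e. DY(X) - DX(Y) in coordinates. *)
Definition lie_bracket (E : normedModType R) (M : mfd E) (X Y : M -> E)
    (x : M) : E :=
  'd (coord_vf (chart_at x) Y) (cmap (chart_at x) x) (X x) -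
  'd (coord_vf (chart_at x) X) (cmap (chart_at x) x) (Y x).

End SmoothMaps.

Definition near_pt (T : topologicalType) (P : set T -> Prop) (x : T) : Prop :=
  exists U : set T, [/\ open U, U x & P U].

(** * Vector bundles and linear connections *)

(* A rank k vector bundle given by its fibres and local trivialisations
   triv c over tdom c (an open neighbourhood of c) with smooth transition
   functions; tinv c y is the inverse of triv c y : V_y -> R^k. *)
Record vbundle (R : realType) (E : normedModType R) (M : mfd E) (k : nat) :=
  VBundle {
  fib :> M -> lmodType R;
  tdom : M -> set M;
  triv : forall c y : M, {linear fib y -> 'rV[R]_k};
  tinv : forall c y : M, 'rV[R]_k -> fib y;
  tdom_open : forall c, open (tdom c);
  tdom_mem : forall c, tdom c c;
  trivK : forall c y, tdom c y -> cancel (triv c y) (tinv c y);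
  tinvK : forall c y, tdom c y -> cancel (tinv c y) (triv c y);
  trans_smooth : forall (c c' : M) (w : 'rV[R]_k),
    smooth_on (tdom c `&` tdom c')
      (fun y => triv c' y (tinv c y w) : euclid 'rV[R]_k) }.

Section Connections.
Context {R : realType} (E : normedModType R) (M : mfd E) (k : nat).

(* Sections of f^* V are sections of V along f. *)
Definition smooth_along (V : vbundle M k) (F : normedModType R) (N : mfd F)
    (f : N -> M) (U : set N) (tau : forall q, V (f q)) : Prop :=
  forall c : M, smooth_on (U `&` f @^-1` tdom V c)
    (fun q => triv V c (f q) (tau q) : euclid 'rV[R]_k).

Definition smooth_section (V : vbundle M k) (U : set M)
    (sigma : forall x, V x) : Prop :=
  @smooth_along V E M idfun U sigma.

(* A linear connection as an operator on local sections (a morphism of sheaves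
   V -> T^*M (x) V satisfying the Leibniz rule): nab sigma x v is the covariant
   derivative of sigma at x along v in T_x M, which is only meaningful for
   sigma smooth near x. *)
Record connection (V : vbundle M k) := Connection {
  nab :> (forall x, V x) -> forall x : M, E -> V x;
  nab_linear : forall sigma x,
    near_pt (fun U => smooth_section U sigma) x ->
    forall a v w, nab sigma x (a *: v + w) = a *: nab sigma x v + nab sigma x w;
  nab_add : forall sigma sigma' x v,
    near_pt (fun U => smooth_section U sigma) x ->
    near_pt (fun U => smooth_section U sigma') x ->
    nab (fun y => sigma y + sigma' y) x v = nab sigma x v + nab sigma' x v;
  nab_leibniz : forall (f : M -> R) sigma x v,
    near_pt (fun U => smooth_on U (f : M -> euclid R^o)) x ->
    near_pt (fun U => smooth_section U sigma) x ->
    nab (fun y => f y *: sigma y) x v =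
      tmap (f : M -> euclid R^o) x v *: sigma x + f x *: nab sigma x v;
  nab_smooth : forall (U : set M) (X : M -> E) sigma, open U ->
    smooth_vf U X -> smooth_section U sigma ->
    smooth_section U (fun y => nab sigma y (X y)) }.

Definition curvature (V : vbundle M k) (D : connection V) (X Y : M -> E)
    (sigma : forall x, V x) (x : M) : V x :=
  D (fun y => D sigma y (Y y)) x (X x) -
  D (fun y => D sigma y (X y)) x (Y x) -
  D sigma x (lie_bracket X Y x).

(* R^D_x(u, v) = 0 in End(V_x).  R^D is tensorial, so R^D_x(u, v) w is
   R^D(X, Y) sigma at x for arbitrary local extensions X, Y, sigma of u, v, w. *)
Definition curvature_vanishes (V : vbundle M k) (D : connection V) (x : M)
    (u v : E) : Prop :=
  forall (X Y : M -> E) (sigma : forall y, V y),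
    near_pt (fun U => smooth_vf U X) x -> near_pt (fun U => smooth_vf U Y) x ->
    near_pt (fun U => smooth_section U sigma) x ->
    X x = u -> Y x = v -> curvature D X Y sigma x = 0.

Definition frame (V : vbundle M k) (c : M) (i : 'I_k) : forall y, V y :=
  fun y => tinv V c y (delta_mx 0 i).

(* The pullback connection f^* D.  With e_i the local frame of V around
   c = f q and tau = \sum_i tau^i e_i(f), it is given by
   (f^*D)_v tau = \sum_i d tau^i(v) e_i(f q) + tau^i(q) D_(df v) e_i. *)
Definition pullback_connection (V : vbundle M k) (D : connection V)
    (F : normedModType R) (N : mfd F) (f : N -> M) (tau : forall q, V (f q))
    (q : N) (v : F) : V (f q) :=
  let c := f q in
  let coord := fun p => triv V c (f p) (tau p) : euclid 'rV[R]_k in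
  tinv V c c (tmap coord q v) +
  \sum_(i < k) (coord q : 'rV[R]_k) 0 i *: D (frame V c i) c (tmap f q v).

End Connections.

(** * Lie groupoids and their representations *)

(* gmul g h is the product g h, meaningful when src g = tgt h.  The total space
   is not required to be Hausdorff or second countable. *)
Record lie_groupoid (R : realType) (n : nat) (M : mfd 'rV[R]_n) (d : nat) :=
  LieGroupoid {
  arrows :> mfd 'rV[R]_d;
  src : arrows -> M;
  tgt : arrows -> M;
  gunit : M -> arrows;
  ginv : arrows -> arrows;
  gmul : arrows -> arrows -> arrows;
  src_smooth : smooth_on setT src;
  tgt_smooth : smooth_on setT tgt;
  unit_smooth : smooth_on setT gunit;
  inv_smooth : smooth_on setT ginv;
  mul_smooth : smooth_on_subset
    ([set p | src p.1 = tgt p.2] : set (prod_mfd arrows arrows))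
    (fun p : prod_mfd arrows arrows => gmul p.1 p.2);
  src_submersion : forall g w, exists v, tmap src g v = w;
  tgt_submersion : forall g w, exists v, tmap tgt g v = w;
  src_unit : forall x, src (gunit x) = x;
  tgt_unit : forall x, tgt (gunit x) = x;
  src_inv : forall g, src (ginv g) = tgt g;
  tgt_inv : forall g, tgt (ginv g) = src g;
  src_mul : forall g h, src g = tgt h -> src (gmul g h) = src h;
  tgt_mul : forall g h, src g = tgt h -> tgt (gmul g h) = tgt g;
  gmulA : forall g h l, src g = tgt h -> src h = tgt l ->
    gmul g (gmul h l) = gmul (gmul g h) l;
  mul_unitl : forall g, gmul (gunit (tgt g)) g = g;
  mul_unitr : forall g, gmul g (gunit (src g)) = g;
  mul_invl : forall g, gmul (ginv g) g = gunit (src g);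
  mul_invr : forall g, gmul g (ginv g) = gunit (tgt g) }.

Arguments src {R n M d G} : rename.
Arguments tgt {R n M d G} : rename.

Section Representations.
Context {R : realType} (n d k : nat) (M : mfd 'rV[R]_n).
Variables (G : lie_groupoid M d) (V : vbundle M k).

Definition transport (x y : M) (e : x = y) (v : V x) : V y :=
  eq_rect x (fun z : M => V z : Type) v y e.

(* act_smooth: s^*V -> t^*V is smooth, read in local trivialisations. *)
Record representation := Representation {
  act :> forall g : G, {linear V (src g) -> V (tgt g)};
  act_unit : forall (x : M) (v : V x),
    act (gunit G x) (transport (esym (src_unit G x)) v) =
    transport (esym (tgt_unit G x)) v;
  act_mul : forall (g h : G) (e : src g = tgt h) (v : V (src h)),
    act (gmul g h) (transport (esym (src_mul e)) v) =
    transport (esym (tgt_mul e)) (act g (transport (esym e) (act h v)));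
  act_smooth : forall (c c' : M) (w : 'rV[R]_k),
    smooth_on (@src _ _ _ _ G @^-1` tdom V c `&` @tgt _ _ _ _ G @^-1` tdom V c')
      (fun g => triv V c' (tgt g) (act g (tinv V c (src g) w))
                : euclid 'rV[R]_k) }.

(* A_x = ker (dt) at 1_x, and the anchor rho = ds|_A. *)
Definition algebroid (x : M) : set 'rV[R]_d :=
  [set a | tmap (@tgt _ _ _ _ G) (gunit G x) a = 0].

Definition anchor (x : M) (a : 'rV[R]_d) : 'rV[R]_n :=
  tmap (@src _ _ _ _ G) (gunit G x) a.

(* w = (nabla^A_a sigma)(x), for sigma smooth near x.  For e near 0,
   g(e) . sigma(s(g(e))) is a curve in the fixed fibre V_x, because
   t(g(e)) = x; its derivative is computed through the linear isomorphism
   triv V x x : V_x -> R^k. *)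
Definition nablaA (rho : representation) (x : M) (a : 'rV[R]_d)
    (sigma : forall y, V y) (w : V x) : Prop :=
  exists g : euclid R^o -> G,
    [/\ near_pt (fun U => smooth_on U g /\ (forall e, U e -> tgt (g e) = x))
          (0 : R),
        g 0 = gunit G x,
        tmap g 0 1 = a &
        is_derive (0 : R) 1
          (fun e : R =>
             triv V x (tgt (g e)) (rho (g e) (sigma (src (g e)))))
          (triv V x x w)].

(* The isomorphism s^*V -> t^*V maps s^*D to t^*D. *)
Definition invariant_connection (rho : representation) (D : connection V) :
  Prop :=
  forall (g : G) (v : 'rV[R]_d) (tau : forall q : G, V (src q)),
    near_pt (fun U => smooth_along (f := @src _ _ _ _ G) U tau) g ->
    pullback_connection D (f := @tgt _ _ _ _ G)
      (fun q => rho q (tau q)) g v =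
    rho g (pullback_connection D (f := @src _ _ _ _ G) tau g v).

End Representations.

(* Main.v *)
(* Call g good if the isomorphism s^*V -> t^*V respects the connections at g.
   Locally the action is a matrix-valued function A on G, the connection forms
   pull back to th1 and th2, and the defect is the 1-form
   Om = dA + A th2 - th1 A, which has to vanish.

   If Om = 0, evaluating it at a unit on ker dt gives nabla^A = nabla_rho, and
   differentiating it once more gives A F(dt q, dt p) = F(ds q, ds p) A, hence
   R(rho a, -) = 0 at the units, where A = 1 and s is a submersion.

   Conversely, nabla^A = nabla_rho makes Om vanish on T_1 G, which is spanned by
   ker dt and the tangent space of the units.  Left translation propagates this
   to ker dt at every g, with ds (ker dt) the image of the anchor, so the
   curvature identity for q in ker dt reduces to d Om(p)(q) = th1(q) Om(p).  As A
   satisfies the same linear equation, A^-1 Om(p) is constant along the target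
   fibres: being good is a locally constant condition there, it holds at the
   units, and the fibres are connected. *)

Require Import Defs.
From HB Require Import structures.
From mathcomp Require Import all_boot all_order all_algebra.
From mathcomp Require Import all_classical all_reals all_analysis.
From mathcomp Require Import ring lra.
Set Implicit Arguments.
Unset Strict Implicit.
Unset Printing Implicit Defensive.
Import Order.TTheory GRing.Theory Num.Theory.
Import numFieldNormedType.Exports.
Local Open Scope classical_set_scope.
Local Open Scope ring_scope.

(** * Calculus in normed modules *)

Section Diff.
Context {R : realType}.

(** Everything is computed in charts along constant directions p and q, so no bracket enters and the
    curvature identity for Om comes down to the symmetry of second derivatives. A tangent space is
    the model space read in the chosen chart at its own point, whereas a local expression of Om
    lives in one fixed chart; much of the bookkeeping converts between the two. Propagation along a
    target fibre requires that two nearby arrows with the same target be joined inside the fibre. A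
    submersion normal form achieves this: over a ball the target becomes a linear map, its fibres
    become convex and the path is a segment. The same normal form produces the curves in target
    fibres that [nablaA] asks for, and it rests on an inverse function theorem obtained from
    contractions. Left translation is applied to such curves only, through a smooth local extension
    of the multiplication, so the set of composable pairs never has to be treated as a manifold. *)

Lemma is_diff_ex (E F : normedModType R) (f df : E -> F) x :
  is_diff x f df -> differentiable f x.
Proof. by case. Qed.

Lemma is_diff_valE (E F : normedModType R) (f df : E -> F) x :
  is_diff x f df -> 'd f x = df :> (E -> F).
Proof. by case. Qed.

Lemma is_diff_le (E F : normedModType R) (f : E -> F) x (df : E -> F) (e : R) :
  is_diff x f df -> 0 < e ->
  \forall h \near (0 : E), `|f (h + x) - f x - df h| <= e * `|h|.
Proof.
move=> dfx e0; have [_ /eqaddoP /(_ e e0)] := (diff_locallyP x f).1 (ex_diff).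
apply: filterS => h; rewrite /= !fctE /= diff_val.
by rewrite opprD addrA.
Qed.

Lemma is_diff_intro (E F : normedModType R) (f : E -> F) x (df : {linear E -> F}) :
  continuous df ->
  (forall e : R, 0 < e ->
     \forall h \near (0 : E), `|f (h + x) - f x - df h| <= e * `|h|) ->
  is_diff x f df.
Proof.
move=> cdf Hf.
have ef : f \o shift x = cst (f x) + df +o_ (0 : E) id.
  apply/eqaddoP => e e0; apply: filterS (Hf e e0) => h.
  by rewrite /= !fctE /= opprD addrA.
have dE := diff_unique cdf ef.
by apply: DiffDef => //; apply/diff_locallyP; rewrite dE.
Qed.

Lemma is_diff_ext (E F : normedModType R) (f f' g g' : E -> F) x :
  is_diff x f f' -> (forall y, f y = g y) -> (forall v, f' v = g' v) ->
  is_diff x g g'.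
Proof. by move=> H /funext <- /funext <-. Qed.

Lemma mx_norm_leP m n (A : 'M[R]_(m, n)) (e : R) : 0 <= e ->
  (`|A| <= e) <-> (forall i j, `|A i j| <= e).
Proof.
move=> e0; rewrite [`|A|]/Num.Def.normr/= mx_normrE; split=> [|H].
  move=> H i j; apply: le_trans H; exact: (le_bigmax _ (fun ij => `|A ij.1 ij.2|) (i,
      j)).
by apply/bigmax_leP; split=> // -[i j] _ /=.
Qed.

Lemma mx_norm_entry m n (A : 'M[R]_(m, n)) i j : `|A i j| <= `|A|.
Proof. exact: ((mx_norm_leP A (normr_ge0 A)).1 (lexx _)). Qed.

Lemma is_diff_entry (E : normedModType R) m n (f : E -> 'M[R]_(m, n)) x df i j :
  is_diff x f df -> is_diff x (fun y => f y i j : R) (fun v => df v i j).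
Proof.
move=> dfx.
have @c : {linear 'M[R]_(m, n) -> R}.
  by exists (fun N : 'M[R]_(_, _) => N i j); do 2![eexists]; do ?[constructor];
     rewrite ?mxE// => ? *; rewrite ?mxE//; move=> ?; rewrite !mxE.
have cc : continuous c by exact: coord_continuous.
have dc : is_diff (f x) c c.
  by apply: DiffDef; [exact: linear_differentiable|rewrite diff_lin].
exact: (is_diff_comp dfx dc).
Qed.


(** The norm is the maximum of the entries, so the finitely many entrywise estimates hold on a
    common neighbourhood. Linearity of [df] is inherited from its entries, so any function with the
    right entries may be supplied. *)
Lemma is_diff_mx (E : normedModType R) m n (f df : E -> 'M[R]_(m, n)) x :
  (forall i j, is_diff x (fun y => f y i j : R) (fun v => df v i j)) ->
  is_diff x f df.
Proof.
move=> H.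
have lin : linear df.
  move=> a u v; apply/matrixP => i j; rewrite !mxE.
  by have := linearP ('d (fun y => f y i j : R) x) a u v; rewrite diff_val.
pose dM := GRing.isLinear.Build _ _ _ _ _ lin.
pose dL : {linear _ -> _} := HB.pack df dM.
rewrite -/df -[df]/(dL : _ -> _); apply: is_diff_intro.
  move=> v; apply/cvgrPdist_le => e e0.
  have : \forall t \near v, forall ij : 'I_m * 'I_n,
      `|df v ij.1 ij.2 - df t ij.1 ij.2| <= e.
    apply: filter_forall => -[i j] /=.
    have /(_ v) := @diff_continuous _ _ _ _ (fun y => f y i j : R) (is_diff_ex (H i j)).
    by rewrite diff_val => /cvgrPdist_le /(_ e e0).
  apply: filterS => t Ht; apply/(mx_norm_leP _ (ltW e0)) => i j.
  by rewrite !mxE; exact: (Ht (i, j)).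
move=> e e0.
have : \forall h \near (0 : E), forall ij : 'I_m * 'I_n,
      `|f (h + x) ij.1 ij.2 - f x ij.1 ij.2 - df h ij.1 ij.2| <= e * `|h|.
  by apply: filter_forall => -[i j] /=; exact: is_diff_le (H i j) e0.
apply: filterS => t Ht; apply/mx_norm_leP; first by rewrite mulr_ge0// ltW.
by move=> i j; rewrite !mxE; exact: (Ht (i, j)).
Qed.

Lemma diff_entry (E : normedModType R) m n (f : E -> 'M[R]_(m, n)) x i j v :
  differentiable f x -> 'd (fun y => f y i j : R) x v = 'd f x v i j.
Proof.
move=> /differentiableP /is_diff_entry H.
by have /(congr1 (fun g => g v)) := is_diff_valE (H i j).
Qed.

Lemma differentiable_mx (E : normedModType R) m n (f : E -> 'M[R]_(m, n)) x :
  (forall i j, differentiable (fun y => f y i j : R) x) -> differentiable f x.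
Proof.
move=> H; suff : is_diff x f (fun v => \matrix_(i, j) 'd (fun y => f y i j : R) x v).
  by move=> ?; exact: ex_diff.
apply: is_diff_mx => i j.
by apply: DiffDef; [exact: H|apply/funext => v; rewrite mxE].
Qed.

Lemma is_diff_mulmx (E : normedModType R) m n p (f : E -> 'M[R]_(m, n))
    (g : E -> 'M[R]_(n, p)) x df dg :
  is_diff x f df -> is_diff x g dg ->
  is_diff x (fun y => f y *m g y) (fun v => df v *m g x + f x *m dg v).
Proof.
move=> Hf Hg; apply: is_diff_mx => i j.
have H (k : 'I_n) : is_diff x (fun y => f y i k * g y k j : R)
    (fun v => df v i k * g x k j + f x i k * dg v k j).
  apply: (is_diff_ext (is_diffM (is_diff_entry i k Hf) (is_diff_entry k j Hg))) => // v.
  by rewrite !fctE /= /GRing.scale /= addrC [g x k j * _]mulrC.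
have HS (s : seq 'I_n) : is_diff x (fun y => \sum_(k <- s) f y i k * g y k j : R)
    (fun v => \sum_(k <- s) (df v i k * g x k j + f x i k * dg v k j)).
  elim: s => [|k s IH].
    by apply: (is_diff_ext (is_diff_cst (0 : R) x)) => v; rewrite big_nil.
  by apply: (is_diff_ext (is_diffD (H k) IH)) => v; rewrite big_cons.
apply: (is_diff_ext (HS (index_enum _))) => v; rewrite !mxE //.
by rewrite -big_split.
Qed.

Lemma Ck_S k (E F : normedModType R) (U : set E) (f : E -> F) :
  Ck k.+1 U f -> Ck k U f.
Proof.
elim: k f => [|k IH] f.
  by case=> df _ x /df; exact: differentiable_continuous.
by case=> df Hf; split=> // v; exact: IH (Hf v).
Qed.

Lemma Ck_entry k (E : normedModType R) m n (U : set E) (f : E -> 'M[R]_(m, n)) i j :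
  open U -> Ck k U f -> Ck k U (fun x => f x i j : R).
Proof.
move=> oU; elim: k f => [|k IH] f.
  by move=> Hf x Ux; apply: (@continuous_comp _ _ _ f (fun M : 'M[R]_(m,n) => M i j));
      [exact: Hf|exact: coord_continuous].
case=> df Hf; split=> [x Ux|v].
  by have [] := is_diff_entry i j (differentiableP (df x Ux)).
by apply: Ck_eq (IH _ (Hf v)) => // x Ux; rewrite diff_entry //; exact: df.
Qed.

Lemma Ck_mx k (E : normedModType R) m n (U : set E) (f : E -> 'M[R]_(m, n)) :
  open U -> (forall i j, Ck k U (fun x => f x i j : R)) -> Ck k U f.
Proof.
move=> oU; elim: k f => [|k IH] f Hf.
  move=> x Ux; apply/cvgrPdist_le => e e0.
  have : \forall t \near x, forall ij : 'I_m * 'I_n,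
      `|f x ij.1 ij.2 - f t ij.1 ij.2| <= e.
    apply: filter_forall => -[i j] /=.
    by have /cvgrPdist_le /(_ e e0) := Hf i j x Ux.
  apply: filterS => t Ht; apply/(mx_norm_leP _ (ltW e0)) => i j.
  by rewrite !mxE; exact: (Ht (i, j)).
have df x : U x -> differentiable f x.
  by move=> Ux; apply: differentiable_mx => i j; have [+ _] := Hf i j; exact.
split=> // v; apply: IH => i j; have [_ /(_ v)] := Hf i j.
by apply: Ck_eq => // x /df dfx; rewrite diff_entry.
Qed.

Lemma CkD k (E F : normedModType R) (U : set E) (f g : E -> F) :
  open U -> Ck k U f -> Ck k U g -> Ck k U (fun x => f x + g x).
Proof.
move=> oU; elim: k f g => [|k IH] f g.
  by move=> Hf Hg x Ux; apply: continuousD; [exact: Hf|exact: Hg].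
move=> [df Hf] [dg Hg].
have key x : U x -> is_diff x (fun x => f x + g x) (fun v => 'd f x v + 'd g x v).
  move=> Ux; have h1 := differentiableP (df x Ux); have h2 := differentiableP (dg x Ux).
  exact: (is_diff_ext (is_diffD h1 h2)).
split=> [x /key[]//|v]; apply: Ck_eq (IH _ _ (Hf v) (Hg v)) => // x Ux.
exact: esym (congr1 (fun h => h v) (is_diff_valE (key x Ux))).
Qed.

(** The derivative f dg + g df contains f and g themselves, so the induction also needs them at the
    lower order, through [Ck_S]. *)
Lemma CkM k (E : normedModType R) (U : set E) (f g : E -> R) :
  open U -> Ck k U f -> Ck k U g -> Ck k U (fun x => f x * g x).
Proof.
move=> oU; elim: k f g => [|k IH] f g.
  by move=> Hf Hg x Ux; apply: continuousM; [exact: Hf|exact: Hg].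
move=> Kf Kg; have [df Hf] := Kf; have [dg Hg] := Kg.
have key x : U x -> is_diff x (fun x => f x * g x)
    (fun v => f x * 'd g x v + g x * 'd f x v).
  move=> Ux; have h1 := differentiableP (df x Ux); have h2 := differentiableP (dg x Ux).
  exact: (is_diff_ext (is_diffM h1 h2)).
split=> [x /key[]//|v].
apply: (@Ck_eq _ _ _ _ _ (fun x => f x * 'd g x v + g x * 'd f x v)) => //.
  by move=> x Ux; exact: esym (congr1 (fun h => h v) (is_diff_valE (key x Ux))).
by apply: CkD => //; apply: IH => //; first [exact: Ck_S Kf|exact: Ck_S Kg|exact:
    Hf|exact: Hg].
Qed.

Lemma Ck_sum k (E F : normedModType R) (U : set E) I (s : seq I) (f : I -> E -> F) :
  open U -> (forall i, Ck k U (f i)) -> Ck k U (fun x => \sum_(i <- s) f i x).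
Proof.
move=> oU Hf; elim: s => [|i s IH].
  apply: (@Ck_eq _ _ _ _ _ (fun=> 0)) => //; last exact: Ck_cst.
  by move=> x _; rewrite big_nil.
by apply: Ck_eq (CkD oU (Hf i) IH) => // x _; rewrite big_cons.
Qed.

Lemma Ck_prodr k (E : normedModType R) (U : set E) I (s : seq I) (f : I -> E -> R) :
  open U -> (forall i, Ck k U (f i)) -> Ck k U (fun x => \prod_(i <- s) f i x).
Proof.
move=> oU Hf; elim: s => [|i s IH].
  apply: (@Ck_eq _ _ _ _ _ (fun=> 1 : R)) => //; last exact: Ck_cst.
  by move=> x _; rewrite big_nil.
apply: (@Ck_eq _ _ _ _ _ _ _ oU _ (CkM oU (Hf i) IH)).
by move=> x _; rewrite big_cons.
Qed.

Lemma Ck_mulmx k (E : normedModType R) m n p (U : set E) (f : E -> 'M[R]_(m, n))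
    (g : E -> 'M[R]_(n, p)) :
  open U -> Ck k U f -> Ck k U g -> Ck k U (fun x => f x *m g x).
Proof.
move=> oU Hf Hg; apply: Ck_mx => // i j.
have H : Ck k U (fun x => \sum_l f x i l * g x l j : R).
  by apply: Ck_sum => // l; apply: CkM => //; exact: Ck_entry.
by apply: Ck_eq H => // x _; rewrite mxE.
Qed.

(** [Ck] only sees derivatives in fixed directions, whereas the chain rule differentiates g in the
    moving direction ['d f x v]. Expanding that direction in the standard basis leaves a finite sum
    of products to which the induction hypothesis applies. *)
Lemma Ck_comp_scalar k (E : normedModType R) n (U : set E) (V : set 'rV[R]_n)
    (f : E -> 'rV[R]_n) (g : 'rV[R]_n -> R) :
  open U -> open V -> (forall x, U x -> V (f x)) ->
  Ck k U f -> Ck k V g -> Ck k U (g \o f).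
Proof.
move=> oU oV UV; elim: k f g UV => [|k IH] f g UV.
  by move=> Hf Hg x Ux; apply: continuous_comp; [exact: Hf|apply/Hg/UV].
move=> Kf Kg; have [df Hf] := Kf; have [dg Hg] := Kg.
have key x : U x -> is_diff x (g \o f)
    (fun v => \sum_j 'd f x v 0 j * 'd g (f x) (delta_mx 0 j)).
  move=> Ux; have h1 := differentiableP (df x Ux).
  have h2 := differentiableP (dg _ (UV x Ux)).
  apply: (is_diff_ext (is_diff_comp h1 h2)) => // v /=.
  rewrite [X in 'd g _ X]row_sum_delta linear_sum.
  by apply: eq_bigr => j _; rewrite linearZ.
split=> [x /key[]//|v].
apply: (@Ck_eq _ _ _ _ _
    (fun x => \sum_j 'd f x v 0 j * 'd g (f x) (delta_mx 0 j))) => //.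
  by move=> x Ux; exact: esym (congr1 (fun h => h v) (is_diff_valE (key x Ux))).
apply: Ck_sum => // j; apply: CkM => //; first exact: Ck_entry oU (Hf v).
exact: (IH f (fun y => 'd g y (delta_mx 0 j)) UV (Ck_S Kf) (Hg _)).
Qed.

Lemma Ck_comp k (E : normedModType R) n m p (U : set E) (V : set 'rV[R]_n)
    (f : E -> 'rV[R]_n) (g : 'rV[R]_n -> 'M[R]_(m, p)) :
  open U -> open V -> (forall x, U x -> V (f x)) ->
  Ck k U f -> Ck k V g -> Ck k U (g \o f).
Proof.
move=> oU oV UV Hf Hg; apply: Ck_mx => // i j.
by apply: (Ck_comp_scalar oU oV UV Hf (g := fun y => g y i j)); exact: Ck_entry.
Qed.

Lemma CkV k (E : normedModType R) (U : set E) (f : E -> R) :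
  open U -> (forall x, U x -> f x != 0) -> Ck k U f -> Ck k U (fun x => (f x)^-1).
Proof.
move=> oU f0; elim: k => [|k IH].
  by move=> Hf x Ux; apply: (@continuous_comp _ _ _ f); [exact: Hf|apply:
      inv_continuous; exact: f0].
move=> Kf; have [df Hf] := Kf.
split=> [x Ux|v]; first exact: differentiableV (df x Ux) (f0 x Ux).
apply: (@Ck_eq _ _ _ _ _ (fun x => -1 * ((f x)^-1 * (f x)^-1 * 'd f x v))) => //.
  move=> x Ux.
  apply: etrans (esym (congr1 (fun h => h v) (diffV (df x Ux) (f0 x Ux)))).
  change (-1 * ((f x)^-1 * (f x)^-1 * 'd f x v) = (- (f x) ^- 2) * 'd f x v).
  by rewrite expr2 invfM mulN1r mulNr.
have IH' := IH (Ck_S Kf).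
exact: (CkM oU (@Ck_cst _ k E R U (-1)) (CkM oU (CkM oU IH' IH') (Hf v))).
Qed.

Lemma Ck_det k (E : normedModType R) n (U : set E) (f : E -> 'M[R]_n) :
  open U -> Ck k U f -> Ck k U (fun x => \det (f x)).
Proof.
move=> oU Hf; apply: Ck_sum => // s; apply: (CkM oU); first exact: (@Ck_cst _ k E R U).
by apply: Ck_prodr => // i; exact: Ck_entry.
Qed.

(** Cramer's rule: the entries of the inverse are cofactors divided by the determinant. *)
Lemma Ck_invmx k (E : normedModType R) n (U : set E) (f : E -> 'M[R]_n) :
  open U -> (forall x, U x -> f x \in unitmx) -> Ck k U f ->
  Ck k U (fun x => invmx (f x)).
Proof.
move=> oU fu Hf; apply: Ck_mx => // i j.
have H : Ck k U (fun x => (\det (f x))^-1 * cofactor (f x) j i).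
  apply: (CkM oU); last apply: (CkM oU).
  - apply: (CkV oU); last exact: Ck_det.
    by move=> x /fu; rewrite unitmxE unitfE.
  - exact: (@Ck_cst _ k E R U).
  - apply: Ck_det => //; apply: Ck_mx => // a b.
    apply: (@Ck_eq _ _ _ _ _ (fun x => f x (lift j a) (lift i b))) => //.
      by move=> x _; rewrite !mxE.
    exact: Ck_entry.
by apply: Ck_eq H => // x /fu fx; rewrite /invmx fx !mxE.
Qed.

Lemma CinfD (E F : normedModType R) (U : set E) (f g : E -> F) :
  open U -> Cinf U f -> Cinf U g -> Cinf U (fun x => f x + g x).
Proof. by move=> oU Hf Hg k; exact: CkD. Qed.

Lemma Cinf_mulmx (E : normedModType R) m n p (U : set E) (f : E -> 'M[R]_(m, n))
    (g : E -> 'M[R]_(n, p)) :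
  open U -> Cinf U f -> Cinf U g -> Cinf U (fun x => f x *m g x).
Proof. by move=> oU Hf Hg k; exact: Ck_mulmx. Qed.

Lemma Cinf_comp (E : normedModType R) n m p (U : set E) (V : set 'rV[R]_n)
    (f : E -> 'rV[R]_n) (g : 'rV[R]_n -> 'M[R]_(m, p)) :
  open U -> open V -> (forall x, U x -> V (f x)) ->
  Cinf U f -> Cinf V g -> Cinf U (g \o f).
Proof. by move=> oU oV UV Hf Hg k; exact: Ck_comp UV (Hf k) (Hg k). Qed.

Lemma Cinf_sub (E F : normedModType R) (U U' : set E) (f : E -> F) :
  U `<=` U' -> Cinf U' f -> Cinf U f.
Proof. by move=> UU' Hf k; exact: Ck_sub UU' (Hf k). Qed.

Lemma Cinf_eq (E F : normedModType R) (U : set E) (f g : E -> F) :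
  open U -> (forall x, U x -> f x = g x) -> Cinf U f -> Cinf U g.
Proof. by move=> oU fg Hf k; exact: Ck_eq fg (Hf k). Qed.

Lemma Cinf_diff (E F : normedModType R) (U : set E) (f : E -> F) x :
  Cinf U f -> U x -> differentiable f x.
Proof. by move=> /(_ 1%N)[+ _]; exact. Qed.

Lemma Cinf_d (E F : normedModType R) (U : set E) (f : E -> F) v :
  Cinf U f -> Cinf U (fun x => 'd f x v).
Proof. by move=> Hf k; have [_] := Hf k.+1; exact. Qed.

Lemma segment_MVT (E : normedModType R) (f : E -> R) x v :
  (forall t : R, 0 <= t <= 1 -> differentiable f (x + t *: v)) ->
  exists2 t : R, 0 <= t <= 1 & f (x + v) - f x = 'd f (x + t *: v) v.
Proof.
move=> df; pose g (t : R) := f (x + t *: v).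
have dg (t : R) : 0 <= t <= 1 -> is_diff t g (fun h => 'd f (x + t *: v) (h *: v)).
  move=> /df /differentiableP Hf.
  have Ha : is_diff t (fun t : R => x + t *: v) (fun h => h *: v).
    have K := is_diff_scalel t v.
    apply: (is_diff_ext (is_diffD (is_diff_cst x t) K)) => // h.
    by rewrite fctE add0r.
  exact: (is_diff_ext (is_diff_comp Ha Hf)).
have := @MVT R g (fun t => 'd f (x + t *: v) v) 0 1 ltr01.
case.
- move=> t; rewrite in_itv /= => /andP[t0 t1].
  have tt : 0 <= t <= 1 by rewrite !ltW.
  have dgt := dg t tt.
  apply: DeriveDef; first exact: diff_derivable.
  by rewrite deriveE // diff_val scale1r.
- apply: continuous_in_subspaceT => t; rewrite inE /= in_itv /= => tt.
  have dgt := dg t tt.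
  exact: differentiable_continuous.
- move=> t; rewrite in_itv /= => /andP[t0 t1]; rewrite subr0 mulr1 => H.
  exists t; first by rewrite !ltW.
  by rewrite -H /g scale1r scale0r addr0.
Qed.

Lemma is_diff_shift (E F : normedModType R) (f : E -> F) (c x : E) :
  differentiable f (x + c) ->
  is_diff x (fun y => f (y + c)) ('d f (x + c)).
Proof.
move=> /differentiableP df.
have Ha : is_diff x (fun y : E => y + c) id.
  apply: (is_diff_ext (is_diffD (is_diff_id x) (is_diff_cst c x))) => // v.
  by rewrite !fctE addr0.
exact: (is_diff_ext (is_diff_comp Ha df)).
Qed.

(** Two applications of the mean value theorem, to [g] along u and then to ['d f _ u] along v, turn
    the second difference into h^2 times the mixed derivative at an intermediate point, where it is
    close to its value at x by continuity. *)
Lemma second_difference (E : normedModType R) (f : E -> R) (U : set E) x u v (e : R) :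
  open U -> Cinf U f -> U x -> 0 < e ->
  exists2 d : R, 0 < d & forall h : R, 0 < h < d ->
    `|f (x + h *: u + h *: v) - f (x + h *: u) - (f (x + h *: v) - f x)
      - h * h * 'd (fun y => 'd f y u) x v| <= e * (h * h).
Proof.
move=> oU Hf Ux e0; pose D y := 'd (fun y => 'd f y u) y v.
have HD : Cinf U D by apply: Cinf_d; exact: Cinf_d.
have : \forall y \near x, U y /\ `|D x - D y| <= e.
  apply: filterI; first exact: (open_nbhs_nbhs (conj oU Ux)).
  by have /cvgrPdist_le /(_ e e0) := HD 0%N x Ux.
move=> /nbhs_ballP [r /= r0 Hr].
(* The summand 1 keeps the denominator positive when u and v both vanish. *)
have c0 : 0 < `|u| + `|v| + 1 by rewrite ltr_wpDl// addr_ge0.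
exists (r / (`|u| + `|v| + 1)); first exact: divr_gt0.
move=> h /andP[h0]; rewrite ltr_pdivlMr // => hr.
have B (s s' : R) : 0 <= s <= 1 -> 0 <= s' <= 1 ->
    U (x + (s * h) *: u + (s' * h) *: v) /\
    `|D x - D (x + (s * h) *: u + (s' * h) *: v)| <= e.
  move=> /andP[s0 s1] /andP[s'0 s'1]; apply: Hr.
  rewrite -ball_normE /= -addrA opprD addrA subrr add0r normrN.
  apply: le_lt_trans (ler_normD _ _) _; rewrite !normrZ.
  rewrite (ger0_norm s0) (gtr0_norm h0) (ger0_norm s'0).
  apply: le_lt_trans _ hr.
  rewrite !mulrDr mulr1 -[leLHS]addr0 lerD ?(ltW h0) // lerD // ler_wpM2r //;
    by rewrite -[leRHS]mul1r ler_wpM2r // ltW.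
have fd s s' : 0 <= s <= 1 -> 0 <= s' <= 1 ->
    differentiable f (x + (s * h) *: u + (s' * h) *: v).
  by move=> s01 s'01; apply: Cinf_diff Hf _; exact: (B _ _ s01 s'01).1.
have o01 : 0 <= (1 : R) <= 1 by rewrite ler01 lexx.
have z01 : 0 <= (0 : R) <= 1 by rewrite ler01 lexx.
pose g y := f (y + h *: v) - f y.
have dg t : 0 <= t <= 1 -> is_diff (x + t *: (h *: u)) g
    (fun w => 'd f (x + t *: (h *: u) + h *: v) w - 'd f (x + t *: (h *: u)) w).
  move=> t01.
  have K1 : differentiable f (x + t *: (h *: u) + h *: v).
    by have := fd t 1 t01 o01; rewrite mul1r scalerA.
  have K2 : differentiable f (x + t *: (h *: u)).
    by have := fd t 0 t01 z01; rewrite mul0r scale0r addr0 scalerA.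
  exact: (is_diff_ext (is_diffB (is_diff_shift K1) (differentiableP K2))).
have [t t01 gE] := @segment_MVT E g x (h *: u) (fun t t01 => is_diff_ex (dg t t01)).
have {}gE : g (x + h *: u) - g x = h * ('d f (x + (t * h) *: u + h *: v) u - 'd f (x +
    (t * h) *: u) u).
  rewrite gE (is_diff_valE (dg t t01)) scalerA.
  by rewrite (linearZ_LR ('d f (x + (t * h) *: u + h *: v))) (linearZ_LR ('d f (x + (t
      * h) *: u))) /= mulrBr.
have [s' s01] : exists2 s : R, 0 <= s <= 1 & 'd f (x + (t * h) *: u + h *: v) u -
    'd f (x + (t * h) *: u) u = 'd (fun y => 'd f y u) (x + (t * h) *: u + s *: (h *:
        v)) (h *: v).
  apply: (@segment_MVT E (fun y => 'd f y u)) => s s01.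
  by apply: Cinf_diff (Cinf_d u Hf) _; rewrite scalerA; exact: (B _ _ t01 s01).1.
rewrite linearZ_LR scalerA => dE.
have -> : f (x + h *: u + h *: v) - f (x + h *: u) - (f (x + h *: v) - f x) =
  h * h * D (x + (t * h) *: u + (s' * h) *: v).
  have -> : f (x + h *: u + h *: v) - f (x + h *: u) - (f (x + h *: v) - f x) =
     g (x + h *: u) - g x by [].
  by rewrite gE dE mulrA.
rewrite -mulrBr normrM ger0_norm ?mulr_ge0 ?(ltW h0) // mulrC ler_wpM2r //.
  by rewrite mulr_ge0 // ltW.
by rewrite distrC; exact: (B _ _ t01 s01).2.
Qed.

(** The second difference is symmetric in u and v, and for small h its quotient by h^2 is within e /
    2 of both mixed derivatives. *)
Lemma diff_diffC_scalar (E : normedModType R) (f : E -> R) (U : set E) x u v :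
  open U -> Cinf U f -> U x ->
  'd (fun y => 'd f y u) x v = 'd (fun y => 'd f y v) x u.
Proof.
move=> oU Hf Ux; apply/eqP; rewrite -subr_eq0 -normr_le0; apply/ler_addgt0Pl => e e0.
rewrite addr0; have e20 : 0 < e / 2 by rewrite divr_gt0.
have [d1 d10 H1] := second_difference u v oU Hf Ux e20.
have [d2 d20 H2] := second_difference v u oU Hf Ux e20.
pose h := Num.min d1 d2 / 2.
have m0 : 0 < Num.min d1 d2 by rewrite lt_min d10.
have h0 : 0 < h by rewrite divr_gt0.
have hm : h < Num.min d1 d2 by rewrite ltr_pdivrMr // ltr_pMr // ltr1n.
have {}H1 := H1 h; have {}H2 := H2 h; move: hm; rewrite lt_min => /andP[hd1 hd2].
move: H1 H2; rewrite h0 hd1 hd2 => /(_ isT) H1 /(_ isT) H2.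
have hh : 0 < h * h by rewrite mulr_gt0.
rewrite -(ler_pM2r hh) -{1}(gtr0_norm hh) -normrM.
set A := 'd _ x v in H1 *; set B := 'd _ x u in H2 *.
pose S := f (x + h *: u + h *: v) - f (x + h *: u) - (f (x + h *: v) - f x).
rewrite -/S in H1.
have SE : f (x + h *: v + h *: u) - f (x + h *: v) - (f (x + h *: u) - f x) = S.
  by rewrite /S [x + h *: v + _]addrAC; ring.
rewrite SE in H2.
have -> : (A - B) * (h * h) = (S - h * h * B) - (S - h * h * A) by ring.
apply: le_trans (ler_normB _ _) _; apply: le_trans (lerD H2 H1) _.
by rewrite -mulrDl -splitr.
Qed.

Lemma diff_diffC (E : normedModType R) m n (f : E -> 'M[R]_(m, n)) (U : set E) x u v :
  open U -> Cinf U f -> U x ->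
  'd (fun y => 'd f y u) x v = 'd (fun y => 'd f y v) x u.
Proof.
move=> oU Hf Ux; apply/matrixP => i j.
have Hij k : Ck k U (fun y => f y i j : R) by exact: Ck_entry.
have key w w' : 'd (fun y => 'd f y w) x w' i j =
    'd (fun y => 'd (fun y => f y i j : R) y w) x w'.
  rewrite -diff_entry; last exact: Cinf_diff (Cinf_d _ Hf) Ux.
  have H : is_diff x (fun y => 'd (fun y => f y i j : R) y w) ('d (fun y => 'd f y w i
      j : R) x).
    apply: is_diff_near.
      apply: filterS (open_nbhs_nbhs (conj oU Ux)) => y Uy.
      by rewrite diff_entry //; exact: Cinf_diff Hf Uy.
    exact: (is_diff_ex (is_diff_entry i j (differentiableP (Cinf_diff (Cinf_d w Hf)
        Ux)))).
  by rewrite (is_diff_valE H).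
by rewrite !key; exact: (@diff_diffC_scalar E (fun y => f y i j) U x u v oU Hij Ux).
Qed.
End Diff.

(** * Inverse functions and submersions *)

(** The Banach fixed point theorem asks for a complete space. *)
HB.instance Definition _ (R : realType) m n := Uniform_isComplete.Build (matrix R m n)
    (@mx_complete R m n).

Section InverseFunction.
Context {R : realType}.

Lemma contraction_fixed_point d (C : set 'rV[R]_d) (T : 'rV[R]_d -> 'rV[R]_d) :
  closed C -> C !=set0 -> (forall u, C u -> C (T u)) ->
  (forall u v, C u -> C v -> `|T u - T v| <= 2^-1 * `|u - v|) ->
  exists2 u, C u & T u = u.
Proof.
move=> clC C0 TC Tlip.
pose M1 := isFun.Build _ _ C C T TC.
pose f : {fun C >-> C} := HB.pack T M1.
have [|u Cu uE] := @banach_fixed_point R 'rV[R]_d C f _ clC C0; last by exists u.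
exists (2^-1)%:nng; split; first by rewrite /= invf_lt1 // ltr1n.
by move=> [u v] /= [Cu Cv]; exact: Tlip.
Qed.

Lemma near_shift0 (E : normedModType R) (w : E) (W : set E) :
  nbhs w W -> \forall h \near (0 : E), W (h + w).
Proof.
have sh : (fun h => h + w) @ (0 : E) --> w.
  rewrite -[X in _ --> X]add0r; apply: cvgD; [exact: cvg_id|exact: cvg_cst].
exact: sh.
Qed.

Lemma near_finforall (E : normedModType R) (x : E) (I : finType) (P : I -> set E) :
  (forall i, \forall y \near x, P i y) -> \forall y \near x, forall i, P i y.
Proof. exact: filter_forall. Qed.

Lemma mx_subE m n (A B : 'M[R]_(m, n)) i j : (A - B) i j = A i j - B i j.
Proof. by rewrite !mxE. Qed.

Lemma continuous_near_le (E : normedModType R) (g : E -> R) x a (c : R) :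
  {for x, continuous g} -> g x = a -> 0 < c -> \forall y \near x, `|g y - a| <= c.
Proof.
by move=> cg <- c0; move/cvgrPdist_le : cg => /(_ _ c0); apply: filterS => y; rewrite
    distrC.
Qed.

Lemma near_normP (E : normedModType R) (x : E) (P : set E) :
  (\forall y \near x, P y) <-> exists2 r : R, 0 < r & forall y, `|y - x| < r -> P y.
Proof.
split=> [/nbhs_ballP [r /= r0 H]|[r r0 H]].
  by exists r => // y Hy; apply: H; rewrite -ball_normE /= distrC.
apply/nbhs_ballP; exists r => //= y; rewrite -ball_normE /= distrC; exact: H.
Qed.

Lemma near_open (E : normedModType R) (x : E) (O P : set E) :
  open O -> O x -> (\forall y \near x, P y) -> \forall y \near x, O y /\ P y.
Proof. by move=> oO Ox; apply: filterI; exact: open_nbhs_nbhs. Qed.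

Lemma closed_norm_le (E : normedModType R) (x : E) (r : R) :
  closed [set y | `|y - x| <= r].
Proof.
apply: (@closed_comp _ _ (fun y => `|y - x|) [set t | t <= r]); last exact: closed_le.
move=> y _; apply: (@continuous_comp _ _ _ (fun u => u - x)); last exact:
    norm_continuous.
by apply: continuousB; [exact: cvg_id|exact: cvg_cst].
Qed.

Lemma Ck_succ k (E F : normedModType R) (U : set E) (f : E -> F) (df : E -> E -> F) :
  open U -> (forall x, U x -> is_diff x f (df x)) ->
  (forall v, Ck k U (fun x => df x v)) -> Ck k.+1 U f.
Proof.
move=> oU D H; split=> [x /D[]//|v]; apply: Ck_eq (H v) => // x /D Dx.
by rewrite (is_diff_valE Dx).
Qed.

Lemma is_diff_mulmxr m n (P : 'M[R]_(m, n)) (x : 'rV[R]_m) :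
  is_diff x (mulmx^~ P) (mulmx^~ P).
Proof.
apply: (is_diff_ext (is_diff_mulmx (is_diff_id x) (is_diff_cst P x))) => // v /=.
by rewrite mulmx0 addr0.
Qed.

Lemma mulmxr_lipschitz m n (P : 'M[R]_(m, n)) :
  exists2 C : R, 0 < C & forall x : 'rV[R]_m, `|x *m P| <= C * `|x|.
Proof.
have D := is_diff_mulmxr P 0.
have E := is_diff_valE D.
have [C C0 H] := linear_lipschitz (@diff_continuous _ _ _ _ _ (is_diff_ex D)).
by exists C => // x; have := H x; rewrite E.
Qed.

(** The mean value theorem is applied to each entry of f separately; the factor m counts the
    coordinates of the direction u - v. *)
Lemma mean_value_le m n (f : 'rV[R]_m -> 'rV[R]_n) (u v : 'rV[R]_m) (c : R) :
  0 <= c ->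
  (forall t : R, 0 <= t <= 1 -> differentiable f (v + t *: (u - v)) /\
     forall i j, `|'d f (v + t *: (u - v)) (delta_mx 0 i) 0 j| <= c) ->
  `|f u - f v| <= m%:R * c * `|u - v|.
Proof.
move=> c0 H; apply/mx_norm_leP; first by rewrite !mulr_ge0.
move=> i j; rewrite ord1 {i}.
have [t t01 E] : exists2 t : R, 0 <= t <= 1 & f (v + (u - v)) 0 j - f v 0 j =
   'd (fun y => f y 0 j : R) (v + t *: (u - v)) (u - v).
  apply: (segment_MVT (f := fun y => f y 0 j : R)) => t t01.
  exact: (is_diff_ex (is_diff_entry 0 j (differentiableP (H t t01).1))).
have [df Hc] := H t t01.
rewrite !mxE -[in X in X - _](subrK v u) [u - v + v]addrC E diff_entry //.
rewrite [X in 'd f _ X]row_sum_delta linear_sum summxE.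
apply: le_trans (ler_norm_sum _ _ _) _.
have -> : m%:R * c * `|u - v| = \sum_(i < m) c * `|u - v|.
  by rewrite sumr_const card_ord -[RHS]mulr_natl mulrA.
apply: ler_sum => i _.
rewrite linearZ_LR mxE normrM mulrC ler_pM //.
exact: mx_norm_entry.
Qed.


Lemma diff_lin1_mx d e (F : 'rV[R]_d -> 'rV[R]_e) u v :
  'd F u v = v *m lin1_mx ('d F u).
Proof. by rewrite mul_rV_lin1. Qed.

(** With k = Phi (h + w) - Phi w, the differentiability of F says that k L = h + o(k). The Lipschitz
    bound turns o(k) into o(h), and multiplication by the inverse of L gives the claim. *)
Lemma is_diff_inverse d (F Phi : 'rV[R]_d -> 'rV[R]_d) (W : set 'rV[R]_d) w c :
  open W -> W w -> 0 < c ->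
  (forall w', W w' -> F (Phi w') = w') ->
  (forall w', W w' -> `|Phi w' - Phi w| <= c * `|w' - w|) ->
  differentiable F (Phi w) -> lin1_mx ('d F (Phi w)) \in unitmx ->
  is_diff w Phi (mulmx^~ (invmx (lin1_mx ('d F (Phi w))))).
Proof.
move=> oW Ww c0 FPhi Lip dF Lu; set L := lin1_mx _.
have DP := is_diff_mulmxr (invmx L) w.
have DE := is_diff_valE DP.
rewrite -DE; apply: is_diff_intro.
  exact: (@diff_continuous _ _ _ _ _ (is_diff_ex DP)).
move=> e e0.
have [C C0 HC] := mulmxr_lipschitz (invmx L).
(* C bounds multiplication by the inverse of L and c is the Lipschitz constant of Phi; both losses
   are compensated in advance. *)
have e10 : 0 < e / (C * c) by rewrite divr_gt0 // mulr_gt0.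
have /near_normP [r r0 Hr] := is_diff_le (differentiableP dF) e10.
have /near_normP [r' r'0 Hr'] := near_shift0 (open_nbhs_nbhs (conj oW Ww)).
apply/near_normP; exists (Num.min r' (r / c)); first by rewrite lt_min r'0 divr_gt0.
move=> h; rewrite lt_min => /andP[/Hr' Wh]; rewrite subr0 => hr; rewrite DE.
set k := Phi (h + w) - Phi w.
have kh : `|k| <= c * `|h|.
  by apply: le_trans (Lip _ Wh) _; rewrite addrK.
have := Hr k; rewrite subr0 => H.
have {}H : `|h - k *m L| <= e / (C * c) * `|k|.
  have /H : `|k| < r.
    by apply: le_lt_trans kh _; rewrite mulrC -ltr_pdivlMr.
  by rewrite /k subrK !FPhi // addrK diff_lin1_mx.
have -> : k - h *m invmx L = (k *m L - h) *m invmx L.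
  by rewrite mulmxBl mulmxK.
apply: le_trans (HC _) _; rewrite distrC.
apply: le_trans (ler_wpM2l (ltW C0) H) _.
apply: (@le_trans _ _ (C * (e / (C * c) * (c * `|h|)))).
  by rewrite ler_wpM2l ?(ltW C0) // ler_wpM2l // ltW.
rewrite le_eqVlt; apply/orP; left; apply/eqP; field.
by rewrite !gt_eqF.
Qed.

Lemma Ck_lin1_mx k d e (F : 'rV[R]_d -> 'rV[R]_e) (U : set 'rV[R]_d) :
  open U -> Cinf U F -> Ck k U (fun u => lin1_mx ('d F u)).
Proof.
move=> oU HF; apply: Ck_mx => // i j.
have H : Ck k U (fun u => 'd F u (delta_mx 0 i) 0 j : R).
  by apply: Ck_entry => //; exact: Cinf_d.
by apply: Ck_eq H => // u _; rewrite mxE.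
Qed.

(** A vector v of the kernel satisfies |v| <= |v| / 2, hence vanishes. *)
Lemma near_identity_unitmx d (L : 'M[R]_d) :
  (forall v : 'rV[R]_d, `|v *m L - v| <= 2^-1 * `|v|) -> L \in unitmx.
Proof.
move=> H; rewrite -row_free_unit; apply/row_freeP.
apply/row_freeP; rewrite -kermx_eq0; apply/rowV0P => v /sub_kermxP vL.
have := H v; rewrite vL sub0r normrN => K.
apply/eqP; rewrite -normr_le0.
have : `|v| * (1 - 2^-1) <= 0 by rewrite mulrBr mulr1 subr_le0 mulrC.
by rewrite pmulr_lle0 // subr_gt0 invf_lt1 // ltr1n.
Qed.

(** Summing d entries of size 1 / (2 (d + 1)) stays below 1/2, which is the contraction constant
    wanted; d + 1 instead of d covers d = 0. Halving the radius passes from an open to a closed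
    ball, on which fixed points can be sought. *)
Lemma near_identity_bound d (F : 'rV[R]_d -> 'rV[R]_d) (O : set 'rV[R]_d) u0 :
  open O -> O u0 -> Cinf O F -> (forall v, 'd F u0 v = v) ->
  exists2 rho : R, 0 < rho &
    (forall u, `|u - u0| <= rho -> O u) /\
    (forall u, `|u - u0| <= rho -> forall i j,
       `|'d F u (delta_mx 0 i) 0 j - delta_mx 0 i (0 : 'I_1) j| <= (2 * d.+1%:R)^-1).
Proof.
move=> oO Ou0 HF dF.
have c0 : 0 < (2 * d.+1%:R)^-1 :> R by rewrite invr_gt0 mulr_gt0.
have K : \forall u \near u0, forall ij : 'I_d * 'I_d,
    `|'d F u (delta_mx 0 ij.1) 0 ij.2 - delta_mx 0 ij.1 (0 : 'I_1) ij.2| <= (2 *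
        d.+1%:R)^-1.
  apply: near_finforall => -[i j] /=.
  apply: (continuous_near_le _ _ c0); last exact: (congr1 (fun M : 'rV[R]_d => M 0 j)
      (dF (delta_mx 0 i))).
  exact: (Ck_entry 0 j oO (Cinf_d (delta_mx 0 i) HF 0%N)) u0 Ou0.
have /near_normP [r r0 Hr] := near_open oO Ou0 K.
exists (r / 2); first exact: divr_gt0.
have H u : `|u - u0| <= r / 2 -> `|u - u0| < r.
  move=> /le_lt_trans; apply.
  by rewrite ltr_pdivrMr // ltr_pMr // ltr1n.
split=> u /H /Hr [] // _ K' i j; exact: (K' (i, j)).
Qed.

(** A solution of F u = w is a fixed point of u + (w - F u), which contracts by 1/2 because N = F -
    id does. The same estimate gives injectivity and the Lipschitz constant 2 of the inverse. *)
Lemma inverse_function d (F : 'rV[R]_d -> 'rV[R]_d) (O : set 'rV[R]_d) u0 :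
  open O -> O u0 -> Cinf O F -> (forall v, 'd F u0 v = v) ->
  exists (r : R) (Phi : 'rV[R]_d -> 'rV[R]_d) (B : set 'rV[R]_d),
    [/\ 0 < r, open B /\ B u0, B `<=` O, Cinf (ball (F u0) r) Phi &
      (forall w, ball (F u0) r w -> B (Phi w) /\ F (Phi w) = w) /\
      (forall u, B u -> ball (F u0) r (F u) -> Phi (F u) = u)].
Proof.
move=> oO Ou0 HF dF.
have [rho rho0 [HO Hd]] := near_identity_bound oO Ou0 HF dF.
pose N u := F u - u.
pose C := [set u | `|u - u0| <= rho].
have dN u : C u -> is_diff u N (fun v => 'd F u v - v).
  move=> Cu; apply: (is_diff_ext (is_diffB (differentiableP (Cinf_diff HF (HO _ Cu)))
      (is_diff_id u))) => //.
have Ccvx u v (t : R) : C u -> C v -> 0 <= t <= 1 -> C (v + t *: (u - v)).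
  move=> Cu Cv /andP[t0 t1]; rewrite /C /=.
  have -> : v + t *: (u - v) - u0 = (1 - t) *: (v - u0) + t *: (u - u0).
    by rewrite scalerBl scale1r !scalerBr; apply/matrixP => i j; rewrite !mxE; ring.
  apply: le_trans (ler_normD _ _) _; rewrite !normrZ (ger0_norm t0) ger0_norm ?subr_ge0
      //.
  rewrite [leRHS](_ : _ = (1 - t) * rho + t * rho); last by ring.
  by rewrite lerD // ler_wpM2l // subr_ge0.
have Nlip u v : C u -> C v -> `|N u - N v| <= 2^-1 * `|u - v|.
  move=> Cu Cv; apply: (@le_trans _ _ (d%:R * (2 * d.+1%:R)^-1 * `|u - v|)).
    apply: mean_value_le; first by rewrite invr_ge0 mulr_ge0.
    move=> t t01; have Ct := Ccvx u v t Cu Cv t01; have D := dN _ Ct; split=> // i j.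
    by rewrite (is_diff_valE D) mx_subE; exact: Hd.
  apply: ler_wpM2r => //; rewrite invfM mulrCA ler_piMr ?invr_ge0 //.
  by rewrite ler_pdivrMr // mul1r ler_nat.
have Flip u v : C u -> C v -> `|u - v| <= 2 * `|F u - F v|.
  move=> Cu Cv; have := Nlip u v Cu Cv.
  have : `|u - v| <= `|F u - F v| + `|N u - N v|.
    have -> : u - v = (F u - F v) - (N u - N v).
      by rewrite /N; apply/matrixP => i j; rewrite !mxE; ring.
    exact: ler_normB.
  lra.
(* Then u + (w - F u) differs from u0 by less than rho / 2, coming from w, plus at most rho / 2,
   coming from N. The strict bound places the fixed point in the open ball. *)
pose r := rho / 2; have r0 : 0 < r by rewrite divr_gt0.
have ex w : ball (F u0) r w -> exists u, `|u - u0| < rho /\ F u = w.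
  rewrite -ball_normE /= => Hw.
  have Cu0 : C u0 by rewrite /C /= subrr normr0 ltW.
  have TC u : C u -> `|(u + (w - F u)) - u0| < rho.
    move=> Cu; have -> : (u + (w - F u)) - u0 = (w - F u0) - (N u - N u0).
      by rewrite /N; apply/matrixP => i j; rewrite !mxE; ring.
    apply: le_lt_trans (ler_normB _ _) _; rewrite distrC.
    have := Nlip u u0 Cu Cu0; move: Cu Hw; rewrite /C /= /r; lra.
  have [|||u v Cu Cv|u Cu Tu] := @contraction_fixed_point d C (fun u => u + (w - F u)).
  - exact: closed_norm_le.
  - by exists u0.
  - by move=> u /TC /ltW.
  - rewrite (_ : u + (w - F u) - (v + (w - F v)) = - (N u - N v)) ?normrN; first exact:
      Nlip.
    by rewrite /N; apply/matrixP => i j; rewrite !mxE; ring.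
  - exists u; split; first by have := TC u Cu; rewrite Tu.
    by move/eqP: Tu; rewrite addrC -subr_eq0 addrK subr_eq0 => /eqP.
pose Phi w := get [set u | `|u - u0| < rho /\ F u = w].
have PhiP w : ball (F u0) r w -> `|Phi w - u0| < rho /\ F (Phi w) = w.
  by move=> /ex; exact: (@getPex _ [set u | `|u - u0| < rho /\ F u = w]).
have Philip w w' : ball (F u0) r w -> ball (F u0) r w' ->
    `|Phi w' - Phi w| <= 2 * `|w' - w|.
  move=> /PhiP[Cw Fw] /PhiP[Cw' Fw']; apply: le_trans (Flip _ _ (ltW Cw') (ltW Cw)) _.
  by rewrite Fw Fw'.
have oW : open (ball (F u0) r) by exact: ball_open.
have unit u : C u -> lin1_mx ('d F u) \in unitmx.
  move=> Cu; apply: near_identity_unitmx => v; rewrite -diff_lin1_mx.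
  apply/mx_norm_leP; first by rewrite mulr_ge0 // invr_ge0.
  move=> i j; rewrite ord1 {i}.
  have -> : ('d F u v - v) = \sum_i v 0 i *: ('d F u (delta_mx 0 i) - delta_mx 0 i).
    rewrite {1 2}[v]row_sum_delta linear_sum -sumrB; apply: eq_bigr => i _.
    by rewrite linearZ_LR scalerBr.
  rewrite summxE; apply: le_trans (ler_norm_sum _ _ _) _.
  apply: (@le_trans _ _ (\sum_(i < d) `|v| * (2 * d.+1%:R)^-1)).
    apply: ler_sum => i _; rewrite mxE normrM ler_pM //; first exact: mx_norm_entry.
    by rewrite mx_subE; exact: Hd.
  rewrite sumr_const card_ord -[leLHS]mulr_natr -mulrA mulrC ler_wpM2r // mulrC.
  by rewrite invfM mulrCA ler_piMr ?invr_ge0 // ler_pdivrMr // mul1r ler_nat.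
have dPhi w : ball (F u0) r w ->
    is_diff w Phi (mulmx^~ (invmx (lin1_mx ('d F (Phi w))))).
  move=> Ww; have [Cw Fw] := PhiP w Ww.
  apply: (@is_diff_inverse d F Phi (ball (F u0) r) w 2) => //.
  - by move=> w' /PhiP[].
  - by move=> w' Ww'; exact: Philip.
  - exact: Cinf_diff HF (HO _ (ltW Cw)).
  - exact: unit (ltW Cw).
(* Bootstrapping: the derivative of Phi at w is the inverse of that of F at Phi w, so it is as
   smooth as Phi and F' allow, and each order for Phi yields the next. *)
have CPhi k : Ck k (ball (F u0) r) Phi.
  elim: k => [|k IH].
    by move=> w /dPhi D; exact: differentiable_continuous.
  apply: (Ck_succ oW dPhi) => v.
  apply: Ck_mulmx => //; first exact: Ck_cst.
  apply: Ck_invmx => //; first by move=> w Ww; exact: unit (ltW (PhiP w Ww).1).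
  apply: (Ck_comp (f := Phi) (g := fun u => lin1_mx ('d F u)) oW oO) => //.
    by move=> w Ww; exact: HO _ (ltW (PhiP w Ww).1).
  exact: Ck_lin1_mx.
exists r, Phi, (ball u0 rho); split=> //.
- by split; [exact: ball_open|exact: ballxx].
- by move=> u; rewrite -ball_normE /= distrC => /ltW /HO.
split=> [w /PhiP[Cw Fw]|u]; first by rewrite -ball_normE /= distrC.
move=> + /PhiP[CP FP]; rewrite -ball_normE /= distrC => Cu; apply/eqP.
rewrite -subr_eq0 -normr_le0; apply: le_trans (Flip _ _ (ltW CP) (ltW Cu)) _.
by rewrite FP subrr normr0 mulr0.
Qed.

(* F := id + S (tau - T), with S a right inverse of T := d tau, has differential
   id at u0 and satisfies T F = tau, so tau is T in the coordinates F. *)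
Lemma submersion_normal_form d n (tau : 'rV[R]_d -> 'rV[R]_n) (O : set 'rV[R]_d) u0 :
  open O -> O u0 -> Cinf O tau -> (forall w, exists v, 'd tau u0 v = w) ->
  exists (r : R) (F Phi : 'rV[R]_d -> 'rV[R]_d) (B : set 'rV[R]_d) (T : 'M[R]_(d, n)),
    [/\ 0 < r, [/\ open B, B u0 & B `<=` O],
      Cinf O F /\ (forall v, 'd F u0 v = v), Cinf (ball (F u0) r) Phi &
      [/\ forall w, ball (F u0) r w -> B (Phi w) /\ F (Phi w) = w,
          forall u, B u -> ball (F u0) r (F u) -> Phi (F u) = u,
          forall v, 'd tau u0 v = v *m T &
          forall w, ball (F u0) r w -> tau (Phi w) = w *m T]].
Proof.
move=> oO Ou0 Htau surj.
pose T := lin1_mx ('d tau u0).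
have [S ST] : exists S : 'M[R]_(n, d), S *m T = 1%:M.
  have [s Hs] := choice surj.
  exists (\matrix_(i < n) s (delta_mx 0 i)).
  apply/row_matrixP => i; rewrite row_mul rowK -diff_lin1_mx Hs.
  by rewrite row1.
pose F u := u + (tau u - u *m T) *m S.
have dF u : O u -> is_diff u F (fun v => v + ('d tau u v - v *m T) *m S).
  move=> Ou; have D1 := differentiableP (Cinf_diff Htau Ou).
  have D2 := is_diff_mulmxr T u.
  have D3 := is_diff_comp (is_diffB D1 D2) (is_diff_mulmxr S _).
  exact: (is_diff_ext (is_diffD (is_diff_id u) D3)).
have CF : Cinf O F.
  apply: CinfD => //; first exact: Cinf_id.
  apply: Cinf_mulmx => //; last by move=> k; exact: Ck_cst.
  apply: (@Cinf_eq _ _ _ _ (fun u => tau u + u *m (- T))) => //.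
    by move=> u _; rewrite mulmxN.
  apply: CinfD => //; apply: Cinf_mulmx => //; first exact: Cinf_id.
  by move=> k; exact: Ck_cst.
have dF0 v : 'd F u0 v = v.
  by rewrite (is_diff_valE (dF u0 Ou0)) -diff_lin1_mx subrr mul0mx addr0.
have [r [Phi [B [r0 [oB Bu0] BO CPhi [H1 H2]]]]] := inverse_function oO Ou0 CF dF0.
exists r, F, Phi, B, T; split; [exact: r0|by split|by split|exact: CPhi|].
split=> [||v|w Ww]; [exact: H1|exact: H2|exact: diff_lin1_mx|].
have [BP FP] := H1 w Ww; rewrite -[in RHS]FP /F mulmxDl -mulmxA ST mulmx1.
by rewrite addrC subrK.
Qed.

End InverseFunction.

(** * Bundle maps and pulled back connection forms *)

Section GaugeIdentity.
Context {R : realType}.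

(* Unlike mxE, mx_addE and mx_oppE leave the matrix products folded, so that ring
   can treat their entries as atoms. *)
Lemma mx_addE m n (A B : 'M[R]_(m, n)) i j : (A + B) i j = A i j + B i j.
Proof. by rewrite mxE. Qed.

Lemma mx_oppE m n (A : 'M[R]_(m, n)) i j : (- A) i j = - A i j.
Proof. by rewrite mxE. Qed.

Lemma diffE_val (E F : normedModType R) (f df : E -> F) x v :
  is_diff x f df -> 'd f x v = df v.
Proof. by move=> D; rewrite (is_diff_valE D). Qed.

Lemma is_diff_cst0 (E F : normedModType R) (a : F) (x : E) :
  is_diff x (cst a) (fun _ => 0).
Proof. exact: (is_diff_ext (is_diff_cst a x)). Qed.

Lemma is_diff_unique (E F : normedModType R) (f df dg : E -> F) x v :
  is_diff x f df -> is_diff x f dg -> df v = dg v.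
Proof. by move=> D1 D2; rewrite -(diffE_val v D1) (diffE_val v D2). Qed.

Lemma is_diff_near_eq (E F : normedModType R) (f g df : E -> F) x :
  (\forall y \near x, f y = g y) -> is_diff x f df -> is_diff x g df.
Proof.
move=> fg D; have := is_diff_near fg (is_diff_ex D).
by rewrite (is_diff_valE D).
Qed.

Lemma is_diff_sum (E F : normedModType R) I (s : seq I) (f df : I -> E -> F) x :
  (forall i, is_diff x (f i) (df i)) ->
  is_diff x (fun y => \sum_(i <- s) f i y) (fun v => \sum_(i <- s) df i v).
Proof.
move=> H; elim: s => [|i s IH].
  by apply: (is_diff_ext (is_diff_cst (0 : F) x)) => v; rewrite big_nil.
by apply: (is_diff_ext (is_diffD (H i) IH)) => v; rewrite big_cons.
Qed.

Lemma is_diff_scale_mx (E : normedModType R) m n (f df : E -> R)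
    (g dg : E -> 'M[R]_(m, n)) x :
  is_diff x f df -> is_diff x g dg ->
  is_diff x (fun y => f y *: g y) (fun v => df v *: g x + f x *: dg v).
Proof.
move=> Df Dg; apply: is_diff_mx => i j.
apply: (is_diff_ext (is_diffM Df (is_diff_entry i j Dg))) => v; rewrite !mxE //.
by rewrite !fctE /= /GRing.scale /= addrC [g x i j * _]mulrC.
Qed.

(** A predicate and not a bundled linear map, because a connection form is known to be linear only
    at the points of its domain. *)
Definition linear_at n m p (L : 'rV[R]_n -> 'M[R]_(m, p)) :=
  forall a u v, L (a *: u + v) = a *: L u + L v.

Lemma linear_at_sum n m p (L : 'rV[R]_n -> 'M[R]_(m, p)) : linear_at L ->
  forall v, L v = \sum_j v 0 j *: L (delta_mx 0 j).
Proof.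
move=> HL v.
have L0 : L 0 = 0.
  by have := HL (-1) 0 0; rewrite scaler0 addr0 scaleN1r addNr.
rewrite [in LHS](row_sum_delta v).
elim: (index_enum _) => [|j s IH]; first by rewrite !big_nil.
by rewrite !big_cons HL IH.
Qed.

Lemma linear_at0 n m p (L : 'rV[R]_n -> 'M[R]_(m, p)) : linear_at L -> L 0 = 0.
Proof. by move=> /linear_at_sum ->; rewrite big1 // => j _; rewrite mxE scale0r. Qed.

(** A product rule for a family of linear maps applied to a moving vector. Since L is differentiated
    only along fixed v, the vector is expanded in the standard basis. *)
Lemma is_diff_apply (E : normedModType R) n m p (L : E -> 'rV[R]_n -> 'M[R]_(m, p))
    (dL : 'rV[R]_n -> E -> 'M[R]_(m, p)) (y dy : E -> 'rV[R]_n) x :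
  (\forall w \near x, linear_at (L w)) ->
  (forall v, is_diff x (L^~ v) (dL v)) -> is_diff x y dy ->
  is_diff x (fun w => L w (y w)) (fun q => dL (y x) q + L x (dy q)).
Proof.
move=> linL DL Dy.
have D (z dz : E -> 'rV[R]_n) : is_diff x z dz ->
    is_diff x (fun w => L w (z w)) (fun q => \sum_j (dz q 0 j *: L x (delta_mx 0 j)
      + z x 0 j *: dL (delta_mx 0 j) q)).
  move=> Dz.
  apply: (@is_diff_near_eq _ _ (fun w => \sum_j z w 0 j *: L w (delta_mx 0 j))).
    by apply: filterS linL => w /linear_at_sum ->.
  apply: is_diff_sum => j.
  exact: (is_diff_scale_mx (is_diff_entry 0 j Dz) (DL (delta_mx 0 j))).
apply: (is_diff_ext (D y dy Dy)) => // q.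
(* Linearity of [dL] in v is not assumed: it comes from comparing [DL] with [D] for a constant
   vector. *)
have -> : dL (y x) q = \sum_j (y x 0 j *: dL (delta_mx 0 j) q).
  rewrite (is_diff_unique q (DL (y x)) (D _ _ (is_diff_cst (y x) x))).
  by apply: eq_bigr => j _; rewrite mxE scale0r add0r.
rewrite (linear_at_sum (nbhs_singleton linL)) -big_split.
by apply: eq_bigr => j _; rewrite addrC.
Qed.

(** The matrix of the curvature R(q, p) for constant q and p, acting on row vectors from the right;
    hence the order of the factors in the quadratic terms. *)
Definition curv_form (E : normedModType R) k (th : E -> E -> 'M[R]_k) w q p : 'M[R]_k :=
  'd (th^~ p) w q - 'd (th^~ q) w p + th w p *m th w q - th w q *m th w p.

(* With connections d + th1 and d + th2 acting on row vectors, this is the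
   covariant differential of A along p as a section of the Hom bundle. *)
Definition cov_diff (E : normedModType R) k (A : E -> 'M[R]_k)
    (th1 th2 : E -> E -> 'M[R]_k) p w : 'M[R]_k :=
  'd A w p + A w *m th2 w p - th1 w p *m A w.

(** Naturality of curvature. The terms with second derivatives of s cancel because these are
    symmetric. *)
Lemma curv_form_pullback (E : normedModType R) n k (W : set E) (O : set 'rV[R]_n)
    (s : E -> 'rV[R]_n) (G : 'rV[R]_n -> 'rV[R]_n -> 'M[R]_k) w q p :
  open W -> W w -> Cinf W s -> (forall w, W w -> O (s w)) ->
  (forall u, O u -> linear_at (G u)) -> (forall v, Cinf O (G^~ v)) ->
  curv_form (fun w p => G (s w) ('d s w p)) w q p =
  curv_form G (s w) ('d s w q) ('d s w p).
Proof.
move=> oW Ww Cs sWO linG CG.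
have D p' : is_diff w (fun w => G (s w) ('d s w p'))
    (fun q => 'd (G^~ ('d s w p')) (s w) ('d s w q) + G (s w) ('d (fun w => 'd s w p')
        w q)).
  apply: (@is_diff_apply E n k k (fun w => G (s w)) (fun v q => 'd (G^~ v) (s w) ('d s
      w q))).
  - apply: filterS (open_nbhs_nbhs (conj oW Ww)) => w' Ww'; exact: linG (sWO _ Ww').
  - move=> v.
    exact: (is_diff_comp (differentiableP (Cinf_diff Cs Ww)) (differentiableP
        (Cinf_diff (CG v) (sWO _ Ww)))).
  - exact: differentiableP (Cinf_diff (Cinf_d p' Cs) Ww).
have aux (V : zmodType) (a b x y x' y' c d : V) :
    a = x + y -> b = x' + y' -> y = y' -> a - b + c - d = x - x' + c - d.
  by move=> -> -> ->; rewrite opprD addrACA subrr addr0.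
exact: (aux _ _ _ _ _ _ _ _ _ (diffE_val q (D p)) (diffE_val p (D q))
  (congr1 (G (s w)) (diff_diffC p q oW Cs Ww))).
Qed.

Lemma is_diff_cov_diff (E : normedModType R) k (W : set E) (A : E -> 'M[R]_k)
    (th1 th2 : E -> E -> 'M[R]_k) p w :
  W w -> Cinf W A ->
  (forall p, Cinf W (th1^~ p)) -> (forall p, Cinf W (th2^~ p)) ->
  is_diff w (cov_diff A th1 th2 p)
    (fun q => 'd (fun w => 'd A w p) w q + ('d A w q *m th2 w p + A w *m 'd (th2^~ p) w
        q)
     - ('d (th1^~ p) w q *m A w + th1 w p *m 'd A w q)).
Proof.
move=> Ww CA C1 C2.
have DA := differentiableP (Cinf_diff CA Ww).
have D1 := differentiableP (Cinf_diff (C1 p) Ww).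
have D2 := differentiableP (Cinf_diff (C2 p) Ww).
have DD := differentiableP (Cinf_diff (Cinf_d p CA) Ww).
exact: (is_diff_ext (is_diffB (is_diffD DD (is_diff_mulmx DA D2)) (is_diff_mulmx D1
    DA))).
Qed.

(** Here [a] is A, [a1] and [a2] are its derivatives along p and q, [H1] and [H2] the second
    derivatives; [x1], [x2] and [y1], [y2] are the derivatives of th1 and th2, and [D1], [D2] those
    of Om p along q and of Om q along p. *)
Lemma cov_diff_curvature_algebra k
    (D1 D2 H1 H2 a1 a2 x1 x2 y1 y2 a t1p t1q t2p t2q : 'M[R]_k) :
  D1 = H1 + (a2 *m t2p + a *m y1) - (x1 *m a + t1p *m a2) ->
  D2 = H2 + (a1 *m t2q + a *m y2) - (x2 *m a + t1q *m a1) ->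
  H1 = H2 ->
  D1 - D2 = (a2 + a *m t2q - t1q *m a) *m t2p - (a1 + a *m t2p - t1p *m a) *m t2q
    - t1p *m (a2 + a *m t2q - t1q *m a) + t1q *m (a1 + a *m t2p - t1p *m a)
    + a *m (y1 - y2 + t2p *m t2q - t2q *m t2p)
    - (x1 - x2 + t1p *m t1q - t1q *m t1p) *m a.
Proof.
move=> -> -> ->; rewrite !(mulmxDl, mulmxDr, mulmxN, mulNmx, mulmxA).
by apply/matrixP => i j; rewrite !(mx_addE, mx_oppE); ring.
Qed.

(** The Ricci identity for A as a section of the Hom bundle: its second exterior covariant
    derivative is the curvature acting on A. *)
Lemma cov_diff_curvature (E : normedModType R) k (W : set E) (A : E -> 'M[R]_k)
    (th1 th2 : E -> E -> 'M[R]_k) p q w (Om := cov_diff A th1 th2) :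
  open W -> W w -> Cinf W A ->
  (forall p, Cinf W (th1^~ p)) -> (forall p, Cinf W (th2^~ p)) ->
  'd (Om p) w q - 'd (Om q) w p =
  Om q w *m th2 w p - Om p w *m th2 w q - th1 w p *m Om q w + th1 w q *m Om p w
  + A w *m curv_form th2 w q p - curv_form th1 w q p *m A w.
Proof.
move=> oW Ww CA C1 C2.
exact: (cov_diff_curvature_algebra
  (diffE_val q (is_diff_cov_diff p Ww CA C1 C2))
  (diffE_val p (is_diff_cov_diff q Ww CA C1 C2))
  (diff_diffC p q oW CA Ww)).
Qed.

(* Along q the covariant differential y = Om p satisfies the same equation
   dy(q) = th1(q) y as A itself, hence A^-1 y is constant. *)
Lemma cov_diff_const_along (E : normedModType R) k (W : set E) (A : E -> 'M[R]_k)
    (th1 th2 : E -> E -> 'M[R]_k) p w q (Om := cov_diff A th1 th2) :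
  open W -> (forall t : R, 0 <= t <= 1 -> W (w + t *: q)) -> Cinf W A ->
  (forall p, Cinf W (th1^~ p)) -> (forall p, Cinf W (th2^~ p)) ->
  (forall w, W w -> A w \in unitmx) ->
  (forall w, W w -> [/\ Om q w = 0, th2 w q = 0, curv_form th1 w q p = 0 & curv_form
      th2 w q p = 0]) ->
  Om p w = 0 -> Om p (w + q) = 0.
Proof.
move=> oW Wseg CA C1 C2 uA Hq Op.
pose Z y := invmx (A y) *m Om p y.
have DZ y : W y -> exists2 dZ, is_diff y Z dZ & dZ q = 0.
  move=> Wy; have [Oq t2q F1 F2] := Hq y Wy.
  have CI : Cinf W (fun y => invmx (A y)) by move=> l; exact: Ck_invmx.
  have DI := differentiableP (Cinf_diff CI Wy).
  have DA := differentiableP (Cinf_diff CA Wy).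
  have DO : is_diff y (Om p) ('d (Om p) y).
    exact: differentiableP (is_diff_ex (is_diff_cov_diff p Wy CA C1 C2)).
  exists (fun v => 'd (fun y => invmx (A y)) y v *m Om p y + invmx (A y) *m 'd (Om p) y
      v).
    exact: (is_diff_mulmx DI DO).
  (* In the Ricci identity everything multiplied by [Om q], [th2 q] or a curvature drops out, and
     [Om q] has zero derivative along p since it vanishes on all of W. *)
  have dOm : 'd (Om p) y q = th1 y q *m Om p y.
    have := cov_diff_curvature p q oW Wy CA C1 C2.
    rewrite -/Om Oq t2q F1 F2 !(mulmx0, mul0mx, subr0, oppr0, add0r, addr0).
    move=> dOmE; apply: etrans (esym (subrK ('d (Om q) y p) _)) _; rewrite {}dOmE.
    have dq : 'd (Om q) y p = 0.
      have D0 : is_diff y (Om q) (fun _ => 0).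
        apply: (@is_diff_near_eq _ _ (cst (0 : 'M[R]_k))).
        apply: filterS (open_nbhs_nbhs (conj oW Wy)) => z Wz.
        by have [-> _ _ _] := Hq z Wz.
      exact: diffE_val D0.
    by rewrite dq addr0.
  have dAq : 'd A y q = th1 y q *m A y.
    by move: Oq; rewrite /Om /cov_diff t2q mulmx0 addr0 => /eqP; rewrite subr_eq0 =>
        /eqP.
  have D1 : is_diff y (fun y => invmx (A y) *m A y) (fun _ => 0).
    apply: (@is_diff_near_eq _ _ (cst (1%:M : 'M[R]_k))).
    apply: filterS (open_nbhs_nbhs (conj oW Wy)) => z Wz.
    by rewrite mulVmx //; exact: uA.
  (* Differentiating A^-1 A = 1 with dA = th1 A gives d(A^-1) = - A^-1 th1, which cancels the
     contribution of dOm = th1 Om. *)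
  have aux (dI dA dO a i t o : 'M[R]_k) : a \in unitmx -> 0 = dI *m a + i *m dA ->
      dA = t *m a -> dO = t *m o -> dI *m o + i *m dO = 0.
    move=> ua e1 e2 ->; move: e1; rewrite e2 mulmxA -mulmxDl => /(congr1 (mulmx^~
        (invmx a))).
    by rewrite mul0mx mulmxK // mulmxA -mulmxDl => <-; rewrite mul0mx.
  exact: aux (uA y Wy) (is_diff_unique q D1 (is_diff_mulmx DI DA)) dAq dOm.
have ZE : Z (w + q) = Z w.
  apply/matrixP => i j; apply/eqP; rewrite -subr_eq0.
  have [|t t01 ->] := @segment_MVT R E (fun y => Z y i j) w q.
    move=> t t01; have [dZ D _] := DZ _ (Wseg t t01).
    exact: (is_diff_ex (is_diff_entry i j D)).
  have [dZ D dZ0] := DZ _ (Wseg t t01).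
  by rewrite (diffE_val q (is_diff_entry i j D)) dZ0 mxE.
have Wq : W (w + q) by have := Wseg 1; rewrite scale1r; apply; rewrite ler01 lexx.
by rewrite -[LHS](mulKVmx (uA _ Wq)) -/(Z (w + q)) ZE /Z Op !mulmx0.
Qed.

End GaugeIdentity.

(** * Charts and tangent maps *)

Section Charts.
Context {R : realType}.

Lemma Ck_local k (E F : normedModType R) (U : set E) (f : E -> F) :
  (forall x, U x -> exists V : set E, [/\ open V, V x & Ck k V f]) -> Ck k U f.
Proof.
elim: k f => [|k IH] f H; first by move=> x /H [V [_ Vx Vf]]; exact: Vf.
split=> [x /H [V [_ Vx [Vf _]]]|v]; first exact: Vf.
by apply: IH => x /H [V [oV Vx [_ Hf]]]; exists V; split=> //; exact: Hf.
Qed.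

Lemma near_cinv (E : normedModType R) (T : topologicalType) (a : chart E T) p (P : set
    T) :
  cdom a p -> nbhs p P -> \forall u \near cmap a p, P (cinv a u).
Proof.
move=> ap; rewrite -{1}(cmapK ap); exact: (cinv_continuous (cmap_img ap)).
Qed.

(** The chain rule in charts; the middle chart cancels only near the point. The charts are arbitrary
    so that [id_chart] can be used for maps from or into a vector space. *)
Lemma is_diff_rep_comp (E F H : normedModType R) (T1 T2 T3 : topologicalType)
    (a : chart E T1) (b : chart F T2) (c : chart H T3) (f : T1 -> T2)
    (g : T2 -> T3) p L1 L2 :
  cdom a p -> cdom b (f p) -> {for p, continuous f} ->
  is_diff (cmap a p) (cmap b \o f \o cinv a) L1 ->
  is_diff (cmap b (f p)) (cmap c \o g \o cinv b) L2 ->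
  is_diff (cmap a p) (cmap c \o (g \o f) \o cinv a) (L2 \o L1).
Proof.
move=> ap bfp cf D1 D2.
have {}D2 : is_diff ((cmap b \o f \o cinv a) (cmap a p)) (cmap c \o g \o cinv b) L2.
  by rewrite /= (cmapK ap).
apply: is_diff_near_eq (is_diff_comp D1 D2).
have := near_cinv ap (cf _ (open_nbhs_nbhs (conj (cdom_open b) bfp))).
by apply: filterS => u /= bu; rewrite (cmapK bu).
Qed.

Section Transition.
Context (E : normedModType R) (M : mfd E).
Implicit Types (x y z : M).

(* The change of coordinates at y from the chart at z1 to the chart at z2.  As
   T_y M is read in the chart at y, tr y z y v is v read in the chart at z. *)
Definition tr (z1 z2 y : M) (v : E) : E :=
  'd (cmap (chart_at z2) \o cinv (chart_at z1)) (cmap (chart_at z1) y) v.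

Lemma is_diff_tr z1 z2 y : cdom (chart_at z1) y -> cdom (chart_at z2) y ->
  is_diff (cmap (chart_at z1) y)
    (cmap (chart_at z2) \o idfun \o cinv (chart_at z1)) (tr z1 z2 y).
Proof.
move=> y1 y2; apply: (@differentiableP _ _ _ (cmap (chart_at z2) \o cinv (chart_at
    z1))).
apply: Cinf_diff (chart_at_compat z1 z2) _.
by split; [exact: cmap_img|rewrite /preimage /= cmapK].
Qed.

Lemma tr_comp z1 z2 z3 y v : cdom (chart_at z1) y -> cdom (chart_at z2) y ->
  cdom (chart_at z3) y -> tr z2 z3 y (tr z1 z2 y v) = tr z1 z3 y v.
Proof.
move=> y1 y2 y3.
have D := is_diff_rep_comp y1 y2 (@cvg_id _ (nbhs y)) (is_diff_tr y1 y2) (is_diff_tr y2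
    y3).
exact: is_diff_unique D (is_diff_tr y1 y3).
Qed.

Lemma tr_id z y v : cdom (chart_at z) y -> tr z z y v = v.
Proof.
move=> yz; apply: (is_diff_unique (dg := id) v (is_diff_tr yz yz)).
apply: is_diff_near_eq (is_diff_id _).
by apply: filterS (open_nbhs_nbhs (conj (cimg_open _) (cmap_img yz))) => u iu; rewrite
    /= cinvK.
Qed.

Lemma trK z1 z2 y : cdom (chart_at z1) y -> cdom (chart_at z2) y ->
  cancel (tr z1 z2 y) (tr z2 z1 y).
Proof. by move=> y1 y2 v; rewrite tr_comp // tr_id. Qed.

End Transition.

Section Maps.
Context (E F : normedModType R) (M : mfd E) (N : mfd F).

Definition rdom (x : M) (y : N) (U : set M) (f : M -> N) : set E :=
  cimg (chart_at x) `&` cinv (chart_at x) @^-1` (U `&` f @^-1` cdom (chart_at y)).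

Lemma open_preimageI (U : set M) (f : M -> N) (O : set N) :
  open U -> (forall p, U p -> {for p, continuous f}) -> open O ->
  open (U `&` f @^-1` O).
Proof.
move=> oU cf oO; rewrite openE => p [Up Op].
apply: filterI; first exact: open_nbhs_nbhs.
by apply: (cf p Up); exact: open_nbhs_nbhs.
Qed.

Lemma open_rdom x y U (f : M -> N) : open U -> smooth_on U f -> open (rdom x y U f).
Proof.
move=> oU [cf _]; apply: cimg_cdom_open; apply: open_preimageI => //.
exact: cdom_open.
Qed.

Lemma rdom_cmap x y (U : set M) (f : M -> N) p : U p -> cdom (chart_at x) p ->
  cdom (chart_at y) (f p) -> rdom x y U f (cmap (chart_at x) p).
Proof. by move=> Up xp yp; split; [exact: cmap_img|rewrite /preimage /= cmapK]. Qed.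

(** [tmap] read in arbitrary charts around p and f p instead of the chosen ones at these points. *)
Definition drep (x : M) (y : N) (f : M -> N) (p : M) (v : E) : F :=
  'd (cmap (chart_at y) \o f \o cinv (chart_at x)) (cmap (chart_at x) p) v.

Lemma is_diff_rep x y (U : set M) (f : M -> N) p : smooth_on U f -> U p ->
  cdom (chart_at x) p -> cdom (chart_at y) (f p) ->
  is_diff (cmap (chart_at x) p) (cmap (chart_at y) \o f \o cinv (chart_at x)) (drep x y
      f p).
Proof.
move=> [_ sf] Up xp yp.
apply: (@differentiableP _ _ _ (cmap (chart_at y) \o f \o cinv (chart_at x))).
by apply: Cinf_diff (sf x y) _; exact: rdom_cmap.
Qed.

End Maps.

Lemma drep_tr (E F : normedModType R) (M : mfd E) (N : mfd F)
    x x' y y' (U : set M) (f : M -> N) p v : smooth_on U f -> U p ->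
  cdom (chart_at x) p -> cdom (chart_at x') p ->
  cdom (chart_at y) (f p) -> cdom (chart_at y') (f p) ->
  drep x' y' f p (tr x x' p v) = tr y y' (f p) (drep x y f p v).
Proof.
move=> sf Up xp x'p yp y'p.
have cf := sf.1 p Up.
have D1 := is_diff_rep_comp xp x'p (@cvg_id _ (nbhs p)) (is_diff_tr xp x'p)
  (is_diff_rep sf Up x'p y'p).
have D2 := is_diff_rep_comp xp yp cf (is_diff_rep sf Up xp yp) (is_diff_tr yp y'p).
exact: is_diff_unique D1 D2.
Qed.

Lemma drep_tmap (E F : normedModType R) (M : mfd E) (N : mfd F) (f : M -> N)
    x y (U : set M) p v : smooth_on U f -> U p ->
  cdom (chart_at x) p -> cdom (chart_at y) (f p) ->
  drep x y f p (tr p x p v) = tr (f p) y (f p) (tmap f p v).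
Proof.
move=> sf Up xp yp.
exact: (drep_tr v sf Up (chart_at_dom p) xp (chart_at_dom (f p)) yp).
Qed.

Lemma tmap_comp (E F H : normedModType R) (M : mfd E) (N : mfd F) (P : mfd H)
    (f : M -> N) (g : N -> P) (U : set M) (V : set N) p v :
  smooth_on U f -> U p -> smooth_on V g -> V (f p) ->
  tmap (g \o f) p v = tmap g (f p) (tmap f p v).
Proof.
move=> sf Up sg Vp; have xp := chart_at_dom p; have yp := chart_at_dom (f p).
have zp := chart_at_dom (g (f p)).
exact: diffE_val v (is_diff_rep_comp xp yp (sf.1 p Up) (is_diff_rep sf Up xp yp)
    (is_diff_rep sg Vp yp zp)).
Qed.

Lemma smooth_on_sub (E F : normedModType R) (M : mfd E) (N : mfd F) (f : M -> N)
    (U V : set M) : U `<=` V -> smooth_on V f -> smooth_on U f.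
Proof.
move=> UV [cf sf]; split=> [p /UV|x y]; first exact: cf.
by apply: Cinf_sub (sf x y) => u [iu [Vu fu]]; split=> //; split=> //; exact: UV.
Qed.

Lemma smooth_on_euclidP (E F : normedModType R) (M : mfd E) (f : M -> euclid F)
    (U : set M) : open U ->
  (forall x : M, Cinf (cimg (chart_at x) `&` cinv (chart_at x) @^-1` U)
     (f \o cinv (chart_at x) : E -> F)) ->
  smooth_on U f.
Proof.
move=> oU H; split=> [p Up|x y].
  have xp := chart_at_dom p.
  have up : (cimg (chart_at p) `&` cinv (chart_at p) @^-1` U) (cmap (chart_at p) p).
    by split; [exact: cmap_img|rewrite /preimage /= cmapK].
  have c1 := H p 0%N _ up.
  have c2 := continuous_comp (cmap_continuous xp) c1.
  move: c2; rewrite /prop_for /continuous_at /= cmapK // => c2.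
  apply: cvg_trans c2; apply: near_eq_cvg.
  by apply: filterS (open_nbhs_nbhs (conj (cdom_open _) xp)) => q xq /=; rewrite cmapK.
by apply: Cinf_sub (H x) => u [iu [Uu _]].
Qed.

Lemma smooth_on_euclid_rep (E F : normedModType R) (M : mfd E) (f : M -> euclid F)
    (U : set M) x : smooth_on U f ->
  Cinf (cimg (chart_at x) `&` cinv (chart_at x) @^-1` U) (f \o cinv (chart_at x) : E ->
      F).
Proof.
by move=> [_ /(_ x (0 : F))]; apply: Cinf_sub => u [iu Uu]; split.
Qed.

(** No single chart of N need contain the image, so the representative of the composite is factored
    near each point u through the chart at the image of u. *)
Lemma smooth_on_comp (E : normedModType R) n m (M : mfd E) (N : mfd 'rV[R]_n)
    (P : mfd 'rV[R]_m) (f : M -> N) (g : N -> P) (U : set M) (V : set N) :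
  open U -> open V -> (forall p, U p -> V (f p)) -> smooth_on U f -> smooth_on V g ->
  smooth_on U (g \o f).
Proof.
move=> oU oV UV sf sg; split=> [p Up|x y k].
  by apply: continuous_comp; [exact: sf.1|apply: sg.1; exact: UV].
apply: Ck_local => u [iu [Uu yu]].
set q := f (cinv (chart_at x) u).
pose W1 := rdom x q U f; pose W2 := rdom q y V g.
have oW1 : open W1 by exact: open_rdom.
have oW2 : open W2 by exact: open_rdom.
have Vq : V q by exact: UV.
have W1u : W1 u by split=> //; split=> //; exact: chart_at_dom.
pose W := W1 `&` (cmap (chart_at q) \o f \o cinv (chart_at x)) @^-1` W2.
have oW : open W.
  rewrite openE => v [W1v W2v]; apply: filterI; first exact: open_nbhs_nbhs.
  by apply: (sf.2 x q 0%N _ W1v); exact: open_nbhs_nbhs.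
exists W; split=> //.
  split=> //; rewrite /preimage /=.
  by apply: rdom_cmap => //; exact: chart_at_dom.
apply: (@Ck_eq _ _ _ _ _ ((cmap (chart_at y) \o g \o cinv (chart_at q)) \o
     (cmap (chart_at q) \o f \o cinv (chart_at x)))) => //.
  by move=> v [[iv [Uv fv]] _] /=; rewrite cmapK.
apply: (Ck_comp oW oW2); first by move=> v [].
  by apply: Ck_sub (sf.2 x q k) => v [].
exact: sg.2.
Qed.

End Charts.

(** * Linear connections in charts and frames *)

Section SmoothFunctions.
Context {R : realType} (E : normedModType R) (M : mfd E).
Implicit Types (U : set M).

Lemma smooth_on_eq (F : normedModType R) (f g : M -> euclid F) U : open U ->
  (forall p, U p -> f p = g p) -> smooth_on U f -> smooth_on U g.
Proof.
move=> oU fg sf; apply: smooth_on_euclidP => // x.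
apply: (@Cinf_eq _ E F _ (f \o cinv (chart_at x)) _ (cimg_cdom_open _ oU)) => [u [_
    Uu]|].
  by rewrite /= fg.
exact: smooth_on_euclid_rep x sf.
Qed.

Lemma smooth_on_cst (F : normedModType R) (a : F) U : open U ->
  smooth_on U (fun _ : M => a : euclid F).
Proof. by move=> oU; apply: smooth_on_euclidP => // x k; exact: Ck_cst. Qed.

Lemma smooth_onD (F : normedModType R) (f g : M -> F) U : open U ->
  smooth_on U (f : M -> euclid F) -> smooth_on U (g : M -> euclid F) ->
  smooth_on U (fun p => f p + g p : euclid F).
Proof.
move=> oU sf sg; apply: smooth_on_euclidP => // x.
exact: (CinfD (cimg_cdom_open _ oU) (smooth_on_euclid_rep x sf) (smooth_on_euclid_rep x
    sg)).
Qed.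

Lemma smooth_on_entry m n (f : M -> 'M[R]_(m, n)) U i j : open U ->
  smooth_on U (f : M -> euclid 'M[R]_(m, n)) -> smooth_on U (fun p => f p i j : euclid
      R^o).
Proof.
move=> oU sf; apply: smooth_on_euclidP => // x k.
exact: (Ck_entry i j (cimg_cdom_open _ oU) (smooth_on_euclid_rep x sf k)).
Qed.

Lemma smooth_on_mx m n (f : M -> 'M[R]_(m, n)) U : open U ->
  (forall i j, smooth_on U (fun p => f p i j : euclid R^o)) ->
  smooth_on U (f : M -> euclid 'M[R]_(m, n)).
Proof.
move=> oU sf; apply: smooth_on_euclidP => // x k.
apply: (Ck_mx (cimg_cdom_open _ oU)) => i j.
exact: (smooth_on_euclid_rep x (sf i j) k).
Qed.

Lemma smooth_on_scale m n (f : M -> R) (g : M -> 'M[R]_(m, n)) U : open U ->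
  smooth_on U (f : M -> euclid R^o) -> smooth_on U (g : M -> euclid 'M[R]_(m, n)) ->
  smooth_on U (fun p => f p *: g p : euclid 'M[R]_(m, n)).
Proof.
move=> oU sf sg; apply: smooth_on_mx => // i j.
have H : smooth_on U (fun p => f p * g p i j : euclid R^o).
  apply: smooth_on_euclidP => // x k.
  exact: (CkM (cimg_cdom_open _ oU) (smooth_on_euclid_rep x sf k)
    (smooth_on_euclid_rep x (smooth_on_entry i j oU sg) k)).
by apply: smooth_on_eq H => // p _; rewrite mxE.
Qed.

Lemma is_diff_euclid_rep (F : normedModType R) (f : M -> euclid F) U z y :
  smooth_on U f -> open U -> U y -> cdom (chart_at z) y ->
  differentiable (f \o cinv (chart_at z) : E -> F) (cmap (chart_at z) y).
Proof.
move=> sf oU Uy zy; apply: Cinf_diff (smooth_on_euclid_rep z sf) _.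
by split; [exact: cmap_img|rewrite /preimage /= cmapK].
Qed.

Lemma tmap_euclid (F : normedModType R) (f : M -> euclid F) z y (df : E -> F) v :
  cdom (chart_at z) y ->
  is_diff (cmap (chart_at z) y) (f \o cinv (chart_at z) : E -> F) df ->
  tmap f y v = df (tr y z y v).
Proof.
move=> zy D; have yy := chart_at_dom y.
have D2 : is_diff (cmap (chart_at z) y) (cmap (id_chart F) \o f \o cinv (chart_at z))
    df by [].
exact: diffE_val v (is_diff_rep_comp yy zy (@cvg_id _ (nbhs y)) (is_diff_tr yy zy) D2).
Qed.

End SmoothFunctions.

Section Connection.
Context {R : realType} (n k : nat) (M : mfd 'rV[R]_n) (V : vbundle M k).
Implicit Types (U : set M) (sigma : forall x, V x).

Definition smooth_near sigma x := near_pt (fun U => smooth_section U sigma) x.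

Lemma smooth_section_sub U U' sigma : U' `<=` U -> smooth_section U sigma ->
  smooth_section U' sigma.
Proof. by move=> UU' H c; apply: smooth_on_sub (H c) => x [/UU']. Qed.

Lemma smooth_sectionD U sigma sigma' : open U -> smooth_section U sigma ->
  smooth_section U sigma' -> smooth_section U (fun y => sigma y + sigma' y).
Proof.
move=> oU H H' c; have oUc : open (U `&` idfun @^-1` tdom V c).
  by apply: openI => //; exact: tdom_open.
apply: smooth_on_eq (smooth_onD oUc (H c) (H' c)) => // y _.
by rewrite linearD.
Qed.

Lemma smooth_section0 U : open U -> smooth_section U (fun y => 0 : V y).
Proof.
move=> oU c; have oUc : open (U `&` idfun @^-1` tdom V c).
  by apply: openI => //; exact: tdom_open.
by apply: smooth_on_eq (smooth_on_cst 0 oUc) => // y _; rewrite linear0.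
Qed.

Lemma smooth_section_scale U (f : M -> R) sigma : open U ->
  smooth_on U (f : M -> euclid R^o) -> smooth_section U sigma ->
  smooth_section U (fun y => f y *: sigma y).
Proof.
move=> oU sf H c; have oUc : open (U `&` idfun @^-1` tdom V c).
  by apply: openI => //; exact: tdom_open.
apply: smooth_on_eq (smooth_on_scale oUc (smooth_on_sub _ sf) (H c)) => //.
by move=> y _; rewrite linearZ.
Qed.

Lemma smooth_section_sum U (I : Type) (s : seq I) (f : I -> forall x, V x) : open U ->
  (forall i, smooth_section U (f i)) -> smooth_section U (fun y => \sum_(i <- s) f i y).
Proof.
move=> oU H; elim: s => [|i s IH].
  rewrite (_ : (fun y => _) = (fun y => 0 : V y)); first exact: smooth_section0.
  by apply: functional_extensionality_dep => y; rewrite big_nil.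
rewrite (_ : (fun y => _) = (fun y => f i y + \sum_(i <- s) f i y)).
  exact: smooth_sectionD.
by apply: functional_extensionality_dep => y; rewrite big_cons.
Qed.

Lemma smooth_section_eq U sigma sigma' : open U ->
  (forall y, U y -> sigma y = sigma' y) -> smooth_section U sigma ->
  smooth_section U sigma'.
Proof.
move=> oU e H c; apply: smooth_on_eq (H c); last by move=> y [Uy _]; rewrite e.
by apply: openI => //; exact: tdom_open.
Qed.

Lemma frame_smooth b i : smooth_section (tdom V b) (frame V b i).
Proof. by move=> c; exact: trans_smooth. Qed.

Lemma frame_smooth_near b i y : tdom V b y -> smooth_near (frame V b i) y.
Proof.
by move=> by_; exists (tdom V b); split; [exact: tdom_open|exact: by_|exact:
    frame_smooth].
Qed.

Lemma triv_inj b y : tdom V b y -> injective (triv V b y).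
Proof. by move=> /trivK /can_inj. Qed.

Lemma frame_expand b y (w : V y) : tdom V b y ->
  w = \sum_i triv V b y w 0 i *: frame V b i y.
Proof.
move=> yb; apply: (triv_inj yb); rewrite linear_sum [LHS]row_sum_delta.
by apply: eq_bigr => i _; rewrite linearZ /= /frame tinvK.
Qed.

Lemma tinv_expand b y w : tdom V b y ->
  tinv V b y w = \sum_i w 0 i *: frame V b i y.
Proof.
move=> yb; rewrite [LHS](frame_expand _ yb).
by apply: eq_bigr => i _; rewrite tinvK.
Qed.

Variable D : connection V.

Lemma nab_zero x v : D (fun y => 0 : V y) x v = 0.
Proof.
have H : smooth_near (fun y => 0 : V y) x.
  by exists setT; split=> //; [exact: openT|apply: smooth_section0; exact: openT].
have H1 : near_pt (fun U => smooth_on U ((fun _ => 0) : M -> euclid R^o)) x.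
  by exists setT; split=> //; [exact: openT|apply: smooth_on_cst; exact: openT].
have := nab_leibniz D v H1 H.
rewrite (_ : (fun y => _ *: _) = (fun y => 0 : V y)); last first.
  by apply: functional_extensionality_dep => y; rewrite scaler0.
by move=> ->; rewrite scaler0 scale0r addr0.
Qed.

(* Multiplying by the indicator function of U, which is smooth on U, replaces
   sigma and sigma' by the same global section. *)
Lemma nab_local sigma sigma' x v U : open U -> U x ->
  (forall y, U y -> sigma y = sigma' y) -> smooth_near sigma x ->
  D sigma x v = D sigma' x v.
Proof.
move=> oU Ux e [U1 [oU1 U1x s1]].
pose f (y : M) : R := if pselect (U y) then 1 else 0.
have fU y : U y -> f y = 1 by rewrite /f; case: pselect.
have f0 y : ~ U y -> f y = 0 by rewrite /f; case: pselect.
have sf : near_pt (fun U => smooth_on U (f : M -> euclid R^o)) x.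
  exists U; split=> //; apply: smooth_on_eq (smooth_on_cst (1 : R^o) oU) => // y Uy.
  by rewrite fU.
have s2 : smooth_near sigma' x.
  exists (U `&` U1); split=> //; first exact: openI.
  apply: (@smooth_section_eq _ sigma); first exact: openI.
    by move=> y [/e].
  by apply: smooth_section_sub s1 => y [].
have df : tmap (f : M -> euclid R^o) x v = 0.
  have Dz : is_diff (cmap (chart_at x) x) (f \o cinv (chart_at x) : 'rV[R]_n -> R^o)
      (fun _ => 0).
    apply: (@is_diff_near_eq _ _ _ (cst (1 : R^o))).
    have K := near_cinv (chart_at_dom x) (open_nbhs_nbhs (conj oU Ux)).
    by apply: filterS K => u /= /fU.
  exact: (tmap_euclid v (chart_at_dom x) Dz).
have s1' : smooth_near sigma x by exists U1.
have E1 := nab_leibniz D v sf s1'.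
have E2 := nab_leibniz D v sf s2.
move: E1 E2; rewrite df !scale0r !add0r !fU // !scale1r => <- <-.
congr (nab D _ x v); apply: functional_extensionality_dep => y.
have [Uy|/f0 ->] := pselect (U y); last by rewrite !scale0r.
by rewrite (e y Uy).
Qed.

Lemma nab_sum U (I : Type) (s : seq I) (f : I -> forall x, V x) x v : open U -> U x ->
  (forall i, smooth_section U (f i)) ->
  D (fun y => \sum_(i <- s) f i y) x v = \sum_(i <- s) D (f i) x v.
Proof.
move=> oU Ux H; elim: s => [|i s IH].
  rewrite big_nil (_ : (fun y => _) = (fun y => 0 : V y)); first exact: nab_zero.
  by apply: functional_extensionality_dep => y; rewrite big_nil.
rewrite big_cons -IH (_ : (fun y => _) = (fun y => f i y + \sum_(i <- s) f i y)).
  apply: nab_add; first by exists U.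
  by exists U; split=> //; exact: smooth_section_sum.
by apply: functional_extensionality_dep => y; rewrite big_cons.
Qed.

(** The expansion of sigma in the frame holds only over [tdom V b], so locality comes before the
    Leibniz rule. *)
Lemma nab_frame b sigma y v : tdom V b y -> smooth_near sigma y ->
  D sigma y v = \sum_i (tmap (fun q => triv V b q (sigma q) 0 i : euclid R^o) y v *:
      frame V b i y + triv V b y (sigma y) 0 i *: D (frame V b i) y v).
Proof.
move=> yb s1; have [U [oU Uy sU]] := s1.
pose W := U `&` tdom V b; have oW : open W by apply: openI => //; exact: tdom_open.
have Wy : W y by [].
have sf i : smooth_on W (fun q => triv V b q (sigma q) 0 i : euclid R^o).
  by apply: smooth_on_entry => //; exact: sU b.
have se i : smooth_section W (frame V b i).
  by apply: smooth_section_sub (frame_smooth b i) => q [].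
rewrite (@nab_local _ (fun q => \sum_i triv V b q (sigma q) 0 i *: frame V b i q) y v
    W) //.
  rewrite (@nab_sum W) //.
    apply: eq_bigr => i _.
    by apply: nab_leibniz; [exists W|exact: frame_smooth_near].
  by move=> i; exact: smooth_section_scale.
by move=> q [_ qb]; exact: frame_expand.
Qed.

End Connection.

Lemma is_diff_at (R : realType) (E F : normedModType R) (f df : E -> F) x x' :
  x = x' -> is_diff x f df -> is_diff x' f df.
Proof. by move=> ->. Qed.

(** * Coordinate vector fields and connection forms *)

Section ConnectionForm.
Context {R : realType} (n k : nat) (M : mfd 'rV[R]_n) (V : vbundle M k).
Implicit Types (U : set M) (sigma : forall x, V x) (y z b c : M).

(** The field with constant coordinates p in the chart at z. The change of chart is there because
    its value at y has to be read in the chart at y. *)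
Definition coord_field z (p : 'rV[R]_n) y : 'rV[R]_n := tr z y y p.

Lemma coord_vf_tr c (X : M -> 'rV[R]_n) u (y := cinv (chart_at c) u) :
  coord_vf (chart_at c) X u = tr y c y (X y).
Proof. by []. Qed.

Lemma coord_field_rep c z p u (y := cinv (chart_at c) u) :
  cimg (chart_at c) u -> cdom (chart_at z) y ->
  coord_vf (chart_at c) (coord_field z p) u = tr z c y p.
Proof.
move=> cu zy; rewrite coord_vf_tr.
exact: (tr_comp p zy (chart_at_dom y) (cinv_dom cu)).
Qed.

Lemma coord_field_smooth z p : smooth_vf (cdom (chart_at z)) (coord_field z p).
Proof.
move=> c; set W := _ `&` _.
have oW : open W by apply: cimg_cdom_open; exact: cdom_open.
pose W' := cimg (chart_at z) `&` cinv (chart_at z) @^-1` cdom (chart_at c).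
have oW' : open W' by apply: cimg_cdom_open; exact: cdom_open.
have H : Cinf W ((fun u' => 'd (cmap (chart_at c) \o cinv (chart_at z)) u' p) \o
                 (cmap (chart_at z) \o cinv (chart_at c))).
  apply: (Cinf_comp oW oW').
  - move=> u [cu zu]; split=> /=; first exact: cmap_img.
    by rewrite /preimage /= cmapK //; exact: cinv_dom.
  - exact: chart_at_compat.
  - apply: Cinf_d; exact: chart_at_compat.
apply: (Cinf_eq oW _ H) => u [cu zu].
exact: esym (coord_field_rep p cu zu).
Qed.

Lemma smooth_vf_sub U U' (X : M -> 'rV[R]_n) : U' `<=` U -> smooth_vf U X -> smooth_vf
    U' X.
Proof. by move=> UU' H c; apply: Cinf_sub (H c) => u [cu /UU']. Qed.

Lemma is_diff_coord_vf z y U (X : M -> 'rV[R]_n) : smooth_vf U X -> U y ->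
  cdom (chart_at z) y ->
  differentiable (coord_vf (chart_at z) X) (cmap (chart_at z) y).
Proof.
move=> sX Uy zy; apply: Cinf_diff (sX z) _.
by split; [exact: cmap_img|rewrite /preimage /= cmapK].
Qed.

(** In the chart at y the two terms of the bracket are the mixed second derivatives of the
    transition map from the chart at z. *)
Lemma lie_bracket_coord_field z p q y : cdom (chart_at z) y ->
  lie_bracket (coord_field z p) (coord_field z q) y = 0.
Proof.
move=> zy; have yy := chart_at_dom y.
pose S := cmap (chart_at y) \o cinv (chart_at z).
pose W' := cimg (chart_at z) `&` cinv (chart_at z) @^-1` cdom (chart_at y).
have oW' : open W' by apply: cimg_cdom_open; exact: cdom_open.
have CS : Cinf W' S by exact: chart_at_compat.
have W'y : W' (cmap (chart_at z) y) by split; [exact: cmap_img|rewrite /preimage /=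
    cmapK].
have key p' q' : 'd (coord_vf (chart_at y) (coord_field z q')) (cmap (chart_at y) y)
    (coord_field z p' y) = 'd (fun u => 'd S u q') (cmap (chart_at z) y) p'.
  have D1 := is_diff_tr yy zy.
  have D2 : is_diff ((cmap (chart_at z) \o idfun \o cinv (chart_at y)) (cmap (chart_at
      y) y))
     (fun u => 'd S u q') ('d (fun u => 'd S u q') (cmap (chart_at z) y)).
    have e : cmap (chart_at z) y = (cmap (chart_at z) \o idfun \o cinv (chart_at y))
        (cmap (chart_at y) y).
      by rewrite /= cmapK.
    exact: is_diff_at e (differentiableP (Cinf_diff (Cinf_d q' CS) W'y)).
  have D3 : is_diff (cmap (chart_at y) y) (coord_vf (chart_at y) (coord_field z q'))
      ('d (fun u => 'd S u q') (cmap (chart_at z) y) \o tr y z y).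
    apply: is_diff_near_eq (is_diff_comp D1 D2).
    have K := near_cinv yy (open_nbhs_nbhs (conj (cdom_open (chart_at z)) zy)).
    have K' := open_nbhs_nbhs (conj (cimg_open (chart_at y)) (cmap_img yy)).
    apply: filterS2 K K' => u zu yu; exact: esym (coord_field_rep q' yu zu).
  apply: etrans (diffE_val _ D3) _.
  exact: (congr1 ('d (fun u => 'd S u q') (cmap (chart_at z) y)) (trK zy yy p')).
apply/eqP; rewrite /lie_bracket subr_eq0; apply/eqP.
exact: etrans (key p q) (etrans (diff_diffC q p oW' CS W'y) (esym (key q p))).
Qed.

Definition strv b sigma : M -> 'rV[R]_k := fun q => triv V b q (sigma q).

Variable D : connection V.

Definition nab_row z b i (p : 'rV[R]_n) y : 'rV[R]_k :=
  triv V b y (D (frame V b i) y (tr z y y p)).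

(* Sections are row vectors, so that D s = ds + s *m conn_form. *)
Definition conn_form z b (u p : 'rV[R]_n) : 'M[R]_k :=
  \matrix_(i, j) nab_row z b i p (cinv (chart_at z) u) 0 j.

Definition gdom z b : set 'rV[R]_n :=
  cimg (chart_at z) `&` cinv (chart_at z) @^-1` tdom V b.

Lemma open_gdom z b : open (gdom z b).
Proof. by apply: cimg_cdom_open; exact: tdom_open. Qed.

Lemma gdom_cmap z b y : cdom (chart_at z) y -> tdom V b y -> gdom z b (cmap (chart_at
    z) y).
Proof. by move=> zy yb; split; [exact: cmap_img|rewrite /preimage /= cmapK]. Qed.

Lemma conn_form_linear z b u : gdom z b u -> linear_at (conn_form z b u).
Proof.
move=> [zu bu] a p q; apply/matrixP => i j; rewrite !mxE /nab_row.
set y := cinv _ u.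
have -> : tr z y y (a *: p + q) = a *: tr z y y p + tr z y y q by rewrite /tr linearP.
by rewrite nab_linear ?linearP ?mxE //; exact: frame_smooth_near.
Qed.

(** Along a coordinate field, the covariant derivative of a frame section is a smooth section by
    [nab_smooth]; the entries of the form are its coordinates. *)
Lemma conn_form_smooth z b p : Cinf (gdom z b) ((conn_form z b)^~ p).
Proof.
have og : open (gdom z b) by exact: open_gdom.
pose U := cdom (chart_at z) `&` tdom V b.
have oU : open U by apply: openI; [exact: cdom_open|exact: tdom_open].
have H i : smooth_section U (fun y => D (frame V b i) y (coord_field z p y)).
  apply: nab_smooth => //.
    by apply: smooth_vf_sub (coord_field_smooth z p) => y [].
  by apply: smooth_section_sub (frame_smooth V b i) => y [].
have H2 i : Cinf (gdom z b) (nab_row z b i p \o cinv (chart_at z)).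
  apply: Cinf_sub (smooth_on_euclid_rep z (H i b)) => u [zu bu].
  by do !split=> //; exact: cinv_dom.
move=> l; apply: Ck_mx => // i j.
apply: (@Ck_eq _ _ _ _ _ (fun u => (nab_row z b i p \o cinv (chart_at z)) u 0 j)) => //.
  by move=> u _; rewrite mxE.
by apply: Ck_entry => //; exact: H2.
Qed.

Lemma conn_form_row z b i p y : cdom (chart_at z) y ->
  row i (conn_form z b (cmap (chart_at z) y) p) = nab_row z b i p y.
Proof. by move=> zy; apply/rowP => j; rewrite !mxE cmapK. Qed.

(** The chart at z and the frame at b stay fixed while y varies, so this expression can be
    differentiated again in y. *)
Lemma nab_coord z b y sigma v (ds : 'rV[R]_n -> 'rV[R]_k) (w := tr y z y v) :
  cdom (chart_at z) y -> tdom V b y -> smooth_near sigma y ->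
  is_diff (cmap (chart_at z) y) (strv b sigma \o cinv (chart_at z)) ds ->
  triv V b y (D sigma y v) = ds w + strv b sigma y *m conn_form z b (cmap (chart_at z)
      y) w.
Proof.
move=> zy yb s1 Ds.
rewrite (nab_frame D v yb s1) linear_sum.
rewrite mulmx_sum_row (row_sum_delta (ds w)) -big_split.
apply: eq_bigr => i _; rewrite linearD !linearZ /=; congr (_ + _).
  rewrite /frame tinvK //; congr (_ *: _).
  have De : is_diff (cmap (chart_at z) y)
     ((fun q => triv V b q (sigma q) 0 i) \o cinv (chart_at z) : 'rV[R]_n -> R^o) (fun
         v => ds v 0 i).
    exact: is_diff_entry 0 i Ds.
  exact: (tmap_euclid (f := fun q => triv V b q (sigma q) 0 i) v zy De).
rewrite conn_form_row // /nab_row; congr (_ *: triv V b y (nab D _ y _)).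
exact: esym (trK (chart_at_dom y) zy v).
Qed.

End ConnectionForm.

(** * Pullback connections in arbitrary charts and frames *)

Section Pullback.
Context {R : realType} (n k : nat) (M : mfd 'rV[R]_n) (V : vbundle M k).
Implicit Types (U : set M) (sigma : forall x, V x) (y z b c : M).

Definition trans_mx c b y : 'M[R]_k :=
  \matrix_(i, j) triv V b y (tinv V c y (delta_mx 0 i)) 0 j.

Lemma triv_tinv c b y w : tdom V c y -> triv V b y (tinv V c y w) = w *m trans_mx c b y.
Proof.
move=> yc; rewrite (tinv_expand w yc) linear_sum mulmx_sum_row.
apply: eq_bigr => i _; rewrite linearZ /=; congr (_ *: _).
by apply/rowP => j; rewrite !mxE.
Qed.

Lemma triv_trans c b y (w : V y) : tdom V c y ->
  triv V b y w = triv V c y w *m trans_mx c b y.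
Proof. by move=> yc; rewrite -triv_tinv // trivK. Qed.

Lemma trans_mx_smooth c b :
  smooth_on (tdom V c `&` tdom V b) (trans_mx c b : M -> euclid 'M[R]_k).
Proof.
have oU : open (tdom V c `&` tdom V b) by apply: openI; exact: tdom_open.
apply: smooth_on_mx => // i j.
apply: smooth_on_eq (smooth_on_entry 0 j oU (@trans_smooth _ _ _ _ V c b (delta_mx 0
    i))) => //.
by move=> y _; rewrite mxE.
Qed.

Definition strv_along (N : Type) (f : N -> M) b (tau : forall q, V (f q)) : N ->
    'rV[R]_k :=
  fun q => triv V b (f q) (tau q).

Variable D : connection V.

(** [pullback_connection] at q uses the frame at f q. Passing to the frame b produces derivatives of
    the transition matrix from two sources, the coordinates of tau and the covariant derivatives of
    the frame sections, and these account for each other. *)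
Lemma pullback_coord d (N : mfd 'rV[R]_d) (f : N -> M) (U : set N)
    (tau : forall q, V (f q)) (q zN : N) z b v (dt : 'rV[R]_d -> 'rV[R]_k) :
  open U -> smooth_on U f -> U q -> cdom (chart_at zN) q ->
  cdom (chart_at z) (f q) -> tdom V b (f q) ->
  is_diff (cmap (chart_at zN) q) (strv_along b tau \o cinv (chart_at zN)) dt ->
  triv V b (f q) (pullback_connection D tau q v) =
  dt (tr q zN q v) + strv_along b tau q *m
     conn_form D z b (cmap (chart_at z) (f q)) (tr (f q) z (f q) (tmap f q v)).
Proof.
move=> oU sf Uq zNq zq bq Dt; set c := f q; set w := tr q zN q v.
have cq : tdom V c (f q) by exact: tdom_mem.
have DTr c1 c2 : tdom V c1 c -> tdom V c2 c -> exists2 dP : 'rV[R]_n -> 'M[R]_k,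
   is_diff (cmap (chart_at z) c) (trans_mx c1 c2 \o cinv (chart_at z)) dP &
   is_diff (cmap (chart_at zN) q) ((trans_mx c1 c2 \o f) \o cinv (chart_at zN))
     (dP \o drep zN z f q).
  move=> q1 q2.
  have D1 := differentiableP (is_diff_euclid_rep (trans_mx_smooth c1 c2)
     (openI (tdom_open V c1) (tdom_open V c2)) (conj q1 q2) zq).
  exists ('d (trans_mx c1 c2 \o cinv (chart_at z)) (cmap (chart_at z) c)) => //.
  have D2 := is_diff_rep sf Uq zNq zq.
  exact: (is_diff_rep_comp (c := id_chart 'M[R]_k) zNq zq (sf.1 q Uq) D2 D1).
have [dP' _ DP'] := DTr b c bq cq.
have [dP DPz DP] := DTr c b cq bq.
have near_f (W : set M) : open W -> W c ->
    \forall u \near cmap (chart_at zN) q, W (f (cinv (chart_at zN) u)).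
  move=> oW Wc; apply: (near_cinv (P := fun p => W (f p)) zNq).
  by apply: (sf.1 q Uq); exact: open_nbhs_nbhs.
pose dc v' := dt v' *m trans_mx b c c + strv_along b tau q *m (dP' \o drep zN z f q) v'.
have Dc : is_diff (cmap (chart_at zN) q) (strv_along c tau \o cinv (chart_at zN)) dc.
  have := is_diff_mulmx Dt DP'; rewrite /= (cmapK zNq); apply: is_diff_near_eq.
  apply: filterS (near_f _ (tdom_open V b) bq) => u bu /=.
  by rewrite /strv_along -triv_trans.
(* Changing back from the frame c to b rewrites dt in terms of dc and dP alone, so that dP and dP'
   never have to be related. *)
have E : is_diff (cmap (chart_at zN) q) (strv_along b tau \o cinv (chart_at zN))
    (fun v' => dc v' *m trans_mx c b c + strv_along c tau q *m (dP (drep zN z f q v'))).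
  have := is_diff_mulmx Dc DP; rewrite /= (cmapK zNq); apply: is_diff_near_eq.
  apply: filterS (near_f _ (tdom_open V c) cq) => u bu /=.
  by rewrite /strv_along -triv_trans.
rewrite (is_diff_unique w Dt E).
have tE : tmap (strv_along c tau : N -> euclid 'rV[R]_k) q v = dc w.
  exact: (tmap_euclid v zNq Dc).
have fE : drep zN z f q w = tr c z c (tmap f q v) := drep_tmap v sf Uq zNq zq.
have frE i : triv V b c (D (frame V c i) c (tmap f q v)) =
    row i (dP (drep zN z f q w)) + row i (trans_mx c b c) *m
     conn_form D z b (cmap (chart_at z) c) (drep zN z f q w).
  have Di : is_diff (cmap (chart_at z) c) (strv b (frame V c i) \o cinv (chart_at z))
     (fun v' => row i (dP v')).
    apply: is_diff_mx => i' j.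
    apply: (is_diff_ext (is_diff_entry i j DPz)) => u /=; rewrite !mxE //.
    by rewrite ord1 /strv /frame.
  have := nab_coord D (tmap f q v) zq bq (frame_smooth_near i cq) Di.
  rewrite -fE => ->; congr (_ + _ *m _).
  by apply/rowP => j; rewrite !mxE.
rewrite /pullback_connection -/c linearD linear_sum.
rewrite (_ : tmap _ q v = dc w); last exact: tE.
rewrite (triv_tinv b (dc w) cq) -addrA; congr (_ + _).
under eq_bigr do rewrite linearZ /= frE scalerDr.
rewrite big_split /= -fE -/w.
have -> : strv_along b tau q = strv_along c tau q *m trans_mx c b c.
  by rewrite /strv_along -triv_trans.
rewrite -mulmxA mulmx_sum_row [in RHS]mulmx_sum_row; congr (_ + _).
by apply: eq_bigr => i _; rewrite row_mul.
Qed.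

End Pullback.

(** * Curvature in charts and frames *)

Section Curvature.
Context {R : realType} (n k : nat) (M : mfd 'rV[R]_n) (V : vbundle M k).
Implicit Types (U : set M) (sigma : forall x, V x) (y z b c : M).
Variable D : connection V.

Lemma curvature_coord_algebra (H1 H2 dsp dsq s sb1 sb2 db : 'M[R]_(1, k))
    (G1 G2 Gp Gq : 'M[R]_k) : H1 = H2 -> sb1 - sb2 = db ->
  (H1 + (dsq *m Gp + s *m G1) + sb1 + (dsp + s *m Gp) *m Gq) -
  (H2 + (dsp *m Gq + s *m G2) + sb2 + (dsq + s *m Gq) *m Gp) - db =
  s *m (G1 - G2 + Gp *m Gq - Gq *m Gp).
Proof.
move=> -> <-; rewrite !(mulmxDl, mulmxDr, mulmxN, mulNmx, mulmxA).
by apply/matrixP => i j; rewrite !(mx_addE, mx_oppE); ring.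
Qed.

(** The fields and the section are arbitrary near y, so this also shows that the curvature is
    tensorial. The coordinate formula for the bracket is a hypothesis: it reduces to the definition
    when z = y, and for coordinate fields of z both sides vanish. *)
Lemma curvature_coord z b y (X Y : M -> 'rV[R]_n) sigma
    (Xh := coord_vf (chart_at z) X) (Yh := coord_vf (chart_at z) Y)
    (u := cmap (chart_at z) y) (dX dY : 'rV[R]_n -> 'rV[R]_n) :
  cdom (chart_at z) y -> tdom V b y ->
  near_pt (fun U => smooth_vf U X) y -> near_pt (fun U => smooth_vf U Y) y ->
  smooth_near sigma y ->
  is_diff u Xh dX -> is_diff u Yh dY ->
  tr y z y (lie_bracket X Y y) = dY (Xh u) - dX (Yh u) ->
  triv V b y (curvature D X Y sigma y) =
  strv b sigma y *m curv_form (conn_form D z b) u (Xh u) (Yh u).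
Proof.
move=> zy yb nX nY ns DX DY brE.
have [UX [oUX UXy sX]] := nX; have [UY [oUY UYy sY]] := nY; have [US [oUS USy sS]] :=
    ns.
pose W := UX `&` UY `&` US `&` (cdom (chart_at z) `&` tdom V b).
have oW : open W.
  by repeat apply: openI => //; [exact: cdom_open|exact: tdom_open].
have Wy : W y by [].
have oUb : open (US `&` idfun @^-1` tdom V b) by apply: openI => //; exact: tdom_open.
pose sh := strv b sigma \o cinv (chart_at z).
pose Ws := cimg (chart_at z) `&` cinv (chart_at z) @^-1` (US `&` idfun @^-1` tdom V b).
have oWs : open Ws by apply: cimg_cdom_open.
have Csh : Cinf Ws sh by exact: smooth_on_euclid_rep z (sS b).
have Wsu : Ws u by split; [exact: cmap_img|rewrite /preimage /= cmapK].
pose G := conn_form D z b.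
(* The covariant derivative of sigma along constant p in coordinates. Applying this once more, with
   the direction replaced by the coordinates of a field, gives the second covariant derivatives. *)
pose L (u' p : 'rV[R]_n) : 'rV[R]_k := 'd sh u' p + sh u' *m G u' p.
have gu : gdom V z b u by exact: gdom_cmap.
pose dG p q := 'd (G^~ p) u q.
have DG p : is_diff u (G^~ p) (dG p).
  exact: differentiableP (Cinf_diff (conn_form_smooth D z b p) gu).
pose H p q := 'd (fun u' => 'd sh u' p) u q.
have DH p : is_diff u (fun u' => 'd sh u' p) (H p).
  exact: differentiableP (Cinf_diff (Cinf_d p Csh) Wsu).
have Ds : is_diff u sh ('d sh u) := differentiableP (Cinf_diff Csh Wsu).
pose ds q := 'd sh u q.
pose dL p q := H p q + (ds q *m G u p + sh u *m dG p q).
have DL p : is_diff u (L^~ p) (dL p).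
  exact: (is_diff_ext (is_diffD (DH p) (is_diff_mulmx Ds (DG p)))).
have linL u' : gdom V z b u' -> linear_at (L u').
  move=> gu' a p q; rewrite /L /G linearP (conn_form_linear D gu') mulmxDr -scalemxAr.
  by rewrite scalerDr addrACA.
have nearL : \forall u' \near u, linear_at (L u').
  by apply: filterS (open_nbhs_nbhs (conj (@open_gdom _ _ _ _ V z b) gu)) => u' /linL.
have nab_L y' v : W y' -> triv V b y' (D sigma y' v) =
    L (cmap (chart_at z) y') (tr y' z y' v).
  move=> [[[Wx1 Wx2] Wx3] [zy' by']].
  have Ws' : Ws (cmap (chart_at z) y').
    by split; [exact: cmap_img|rewrite /preimage /= cmapK].
  have ns' : smooth_near sigma y' by exists US.
  have := nab_coord D v zy' by' ns' (differentiableP (Cinf_diff Csh Ws')).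
  by move=> ->; rewrite /L /sh /= cmapK.
have key (Z Y' : M -> 'rV[R]_n) dZ : (forall U, U `<=` W -> open U -> smooth_vf U Z) ->
    is_diff u (coord_vf (chart_at z) Z) dZ ->
    let Zu := coord_vf (chart_at z) Z u in let Yu := coord_vf (chart_at z) Y' u in
    triv V b y (D (fun y => D sigma y (Z y)) y (Y' y)) =
    dL Zu Yu + L u (dZ Yu) + L u Zu *m G u Yu.
  move=> sZ DZ Zu Yu.
  have nsZ : smooth_near (fun y => D sigma y (Z y)) y.
    exists W; split=> //; apply: nab_smooth => //; first exact: sZ.
    by apply: smooth_section_sub sS => y' [[[]]].
  have DLZ := is_diff_apply nearL DL DZ.
  have DsZ : is_diff u (strv b (fun y => D sigma y (Z y)) \o cinv (chart_at z))
      (fun q => dL Zu q + L u (dZ q)).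
    apply: is_diff_near_eq DLZ.
    have K := near_cinv zy (open_nbhs_nbhs (conj oW Wy)).
    have K' := open_nbhs_nbhs (conj (cimg_open (chart_at z)) (cmap_img zy)).
    apply: filterS2 K K' => u' Wu' zu'.
    exact: esym (etrans (nab_L _ (Z (cinv (chart_at z) u')) Wu')
      (congr1 (fun x => L x (coord_vf (chart_at z) Z u')) (cinvK zu'))).
  have vfE (X' : M -> 'rV[R]_n) : tr y z y (X' y) = coord_vf (chart_at z) X' u.
    by rewrite coord_vf_tr /u cmapK.
  have sE : strv b (fun y => D sigma y (Z y)) y = L u Zu.
    exact: etrans (nab_L y (Z y) Wy) (congr1 (L u) (vfE Z)).
  have := nab_coord D (Y' y) zy yb nsZ DsZ.
  by rewrite sE (vfE Y').
have sX' U : U `<=` W -> open U -> smooth_vf U X.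
  by move=> UW oU; apply: smooth_vf_sub sX => y' /UW [[[]]].
have sY' U : U `<=` W -> open U -> smooth_vf U Y.
  by move=> UW oU; apply: smooth_vf_sub sY => y' /UW [[[]]].
have EY := key Y X dY sY' DY; have EX := key X Y dX sX' DX.
rewrite /curvature 2!(linearB (triv V b y)) EY EX nab_L // brE -/Xh -/Yh.
have -> : strv b sigma y = sh u by rewrite /sh /u /= cmapK.
have Hsym : H (Yh u) (Xh u) = H (Xh u) (Yh u) := diff_diffC _ _ oWs Csh Wsu.
have Llin : L u (dY (Xh u)) - L u (dX (Yh u)) = L u (dY (Xh u) - dX (Yh u)).
  by have := linL u gu (-1) (dX (Yh u)) (dY (Xh u)); rewrite !scaleN1r ![- _ + _]addrC.
exact: (@curvature_coord_algebra _ _ (ds (Yh u)) (ds (Xh u)) (sh u) _ _ _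
  (dG (Yh u) (Xh u)) (dG (Xh u) (Yh u)) (G u (Yh u)) (G u (Xh u)) Hsym Llin).
Qed.

End Curvature.

(** * The action of the groupoid *)

Section Transport.
Context {R : realType} (n k : nat) (M : mfd 'rV[R]_n) (V : vbundle M k).

(** Coordinates do not see [transport], so passing to matrices removes the equality proofs from the
    axioms of an action. *)
Lemma triv_transport b x y (e : x = y) (v : V x) :
  triv V b y (transport e v) = triv V b x v.
Proof. by case: y / e. Qed.

Lemma transport_tinv b x y (e : x = y) w :
  transport e (tinv V b x w) = tinv V b y w.
Proof. by case: y / e. Qed.

End Transport.

Section Action.
Context {R : realType} (n d k : nat) (M : mfd 'rV[R]_n) (G : lie_groupoid M d).
Context (V : vbundle M k) (rep : representation G V) (D : connection V).
Implicit Types (g h : G) (x y z b c : M).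

(* These matrices act on row vectors from the right, which reverses products. *)
Definition act_mx b1 b2 g : 'M[R]_k :=
  \matrix_(i, j) triv V b2 (tgt g) (rep g (tinv V b1 (src g) (delta_mx 0 i))) 0 j.

Lemma act_coord b1 b2 g (w : V (src g)) : tdom V b1 (src g) ->
  triv V b2 (tgt g) (rep g w) = triv V b1 (src g) w *m act_mx b1 b2 g.
Proof.
move=> gb; rewrite {1}(frame_expand w gb) !linear_sum mulmx_sum_row.
apply: eq_bigr => i _; rewrite !linearZ /=; congr (_ *: _).
by apply/rowP => j; rewrite !mxE.
Qed.

Lemma act_mx_unit b x : tdom V b x -> act_mx b b (gunit G x) = 1%:M.
Proof.
move=> xb; apply/row_matrixP => i; rewrite row1.
transitivity (triv V b (tgt (gunit G x)) (rep (gunit G x) (tinv V b (src (gunit G x))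
    (delta_mx 0 i)))).
  by apply/rowP => j; rewrite !mxE.
rewrite -(transport_tinv V b (esym (src_unit G x))) act_unit triv_transport.
by rewrite tinvK.
Qed.

Lemma act_mx_mul b1 b2 b3 g h : src g = tgt h -> tdom V b1 (src h) ->
  tdom V b2 (src g) ->
  act_mx b1 b3 (gmul g h) = act_mx b1 b2 h *m act_mx b2 b3 g.
Proof.
move=> e hb gb; apply/row_matrixP => i; rewrite row_mul.
transitivity (triv V b3 (tgt (gmul g h)) (rep (gmul g h) (tinv V b1 (src (gmul g h))
    (delta_mx 0 i)))).
  by apply/rowP => j; rewrite !mxE.
rewrite -(transport_tinv V b1 (esym (src_mul e))) act_mul triv_transport.
rewrite (act_coord b3 _ gb) triv_transport; congr (_ *m _).
by apply/rowP => j; rewrite !mxE.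
Qed.

(** The inverse is the matrix of the inverse arrow. *)
Lemma act_mx_unitmx b1 b2 g : tdom V b1 (src g) -> tdom V b2 (tgt g) ->
  act_mx b1 b2 g \in unitmx.
Proof.
move=> sb tb; have e : src (ginv g) = tgt g := src_inv g.
have := @act_mx_mul b1 b2 b1 (ginv g) g e sb.
rewrite e mul_invl act_mx_unit // => /(_ tb) E.
by have [] := mulmx1_unit (esym E).
Qed.

Definition adom b1 b2 : set G := src @^-1` tdom V b1 `&` tgt @^-1` tdom V b2.

Lemma src_cont g : {for g, continuous (@src _ _ _ _ G)}.
Proof. by have [+ _] := src_smooth G; exact. Qed.

Lemma tgt_cont g : {for g, continuous (@tgt _ _ _ _ G)}.
Proof. by have [+ _] := tgt_smooth G; exact. Qed.

Lemma open_src (O : set M) : open O -> open (@src _ _ _ _ G @^-1` O).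
Proof. by move=> oO; apply: open_comp => // g _; exact: src_cont. Qed.

Lemma open_tgt (O : set M) : open O -> open (@tgt _ _ _ _ G @^-1` O).
Proof. by move=> oO; apply: open_comp => // g _; exact: tgt_cont. Qed.

Lemma open_adom b1 b2 : open (adom b1 b2).
Proof.
by apply: openI; [apply: open_src|apply: open_tgt]; exact: tdom_open.
Qed.

Lemma act_mx_smooth b1 b2 :
  smooth_on (adom b1 b2) (act_mx b1 b2 : G -> euclid 'M[R]_k).
Proof.
have oU := open_adom b1 b2.
apply: smooth_on_mx => // i j.
apply: smooth_on_eq (smooth_on_entry 0 j oU (act_smooth rep b1 b2 (delta_mx 0 i))) =>
    //.
by move=> y _; rewrite mxE.
Qed.

(* The data defining the action and the two pullback connections, read in the
   chart at g0 of G, the charts at z1, z2 of M and the frames b1, b2 of V. *)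
Section LocalData.
Variables (g0 : G) (z1 b1 z2 b2 : M).

Definition ldom : set G :=
  src @^-1` (cdom (chart_at z1) `&` tdom V b1) `&`
  tgt @^-1` (cdom (chart_at z2) `&` tdom V b2).

Definition lsrc : 'rV[R]_d -> 'rV[R]_n := cmap (chart_at z1) \o src \o cinv (chart_at
    g0).
Definition ltgt : 'rV[R]_d -> 'rV[R]_n := cmap (chart_at z2) \o tgt \o cinv (chart_at
    g0).
Definition lact : 'rV[R]_d -> 'M[R]_k := act_mx b1 b2 \o cinv (chart_at g0).
Definition lform1 u p := conn_form D z1 b1 (lsrc u) ('d lsrc u p).
Definition lform2 u p := conn_form D z2 b2 (ltgt u) ('d ltgt u p).
(** The form Om in these charts and frames. *)
Definition ldefect := cov_diff lact lform1 lform2.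
Definition lset : set 'rV[R]_d := cimg (chart_at g0) `&` cinv (chart_at g0) @^-1` ldom.

Lemma open_ldom : open ldom.
Proof.
by apply: openI; [apply: open_src|apply: open_tgt]; apply: openI;
  first [exact: tdom_open|exact: cdom_open].
Qed.

Lemma open_lset : open lset.
Proof. by apply: cimg_cdom_open; exact: open_ldom. Qed.

Lemma lsrc_smooth : Cinf lset lsrc.
Proof.
apply: Cinf_sub ((src_smooth G).2 g0 z1) => u [gu [[zs bs] [zt bt]]].
by split.
Qed.

Lemma ltgt_smooth : Cinf lset ltgt.
Proof.
apply: Cinf_sub ((tgt_smooth G).2 g0 z2) => u [gu [[zs bs] [zt bt]]].
by split.
Qed.

Lemma lact_smooth : Cinf lset lact.
Proof.
apply: Cinf_sub (smooth_on_euclid_rep g0 (act_mx_smooth b1 b2)) => u [gu [[zs bs] [zt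
    bt]]].
by split.
Qed.

Lemma lsrc_gdom u : lset u -> gdom V z1 b1 (lsrc u).
Proof. by move=> [gu [[zs bs] [zt bt]]]; exact: gdom_cmap. Qed.

Lemma ltgt_gdom u : lset u -> gdom V z2 b2 (ltgt u).
Proof. by move=> [gu [[zs bs] [zt bt]]]; exact: gdom_cmap. Qed.

Lemma lset_cmap g : cdom (chart_at g0) g -> ldom g -> lset (cmap (chart_at g0) g).
Proof. by move=> g0g lg; split; [exact: cmap_img|rewrite /preimage /= cmapK]. Qed.

Lemma lact_unitmx u : lset u -> lact u \in unitmx.
Proof. by move=> [gu [[zs bs] [zt bt]]]; exact: act_mx_unitmx. Qed.

End LocalData.

End Action.

(** * The defect of invariance *)

Section Invariance.
Context {R : realType} (n d k : nat) (M : mfd 'rV[R]_n) (G : lie_groupoid M d).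
Context (V : vbundle M k) (rep : representation G V) (D : connection V).
Implicit Types (g h : G) (x y z b c : M).
Local Notation src := (@src _ _ _ _ G).
Local Notation tgt := (@tgt _ _ _ _ G).

(** Invariance at one arrow and one tangent vector, so that it can be checked on the summands of a
    tangent space and carried from arrow to arrow. *)
Definition inv_at g (v : 'rV[R]_d) := forall tau : (forall q : G, V (src q)),
  near_pt (fun U => smooth_along (f := src) U tau) g ->
  pullback_connection D (f := tgt) (fun q => rep q (tau q)) g v =
  rep g (pullback_connection D (f := src) tau g v).

(** The derivatives of tau cancel: by the product rule both sides contain dtau times the matrix of
    g. What remains depends only on the value of tau at g. *)
Lemma defect_formula g0 z1 b1 z2 b2 g v (tau : forall q : G, V (src q))
    (dt : 'rV[R]_d -> 'rV[R]_k) (u := cmap (chart_at g0) g) :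
  cdom (chart_at g0) g -> ldom V z1 b1 z2 b2 g ->
  is_diff u (strv_along (f := src) b1 tau \o cinv (chart_at g0)) dt ->
  triv V b2 (tgt g) (pullback_connection D (f := tgt) (fun q => rep q (tau q)) g v) =
  triv V b2 (tgt g) (rep g (pullback_connection D (f := src) tau g v)) +
  strv_along (f := src) b1 tau g *m ldefect rep D g0 z1 b1 z2 b2 (tr g g0 g v) u.
Proof.
move=> g0g lg Dt; have [[zs bs] [zt bt]] := lg; set w := tr g g0 g v.
have iu : lset V g0 z1 b1 z2 b2 u by exact: lset_cmap.
have uK : cinv (chart_at g0) u = g by rewrite /u cmapK.
have DA := differentiableP (Cinf_diff (lact_smooth rep g0 z1 b1 z2 b2) iu).
have Dt' : is_diff u (strv_along (f := tgt) b2 (fun q => rep q (tau q)) \o cinv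
    (chart_at g0))
    (fun v' => dt v' *m lact rep g0 b1 b2 u + strv_along (f := src) b1 tau g *m 'd
        (lact rep g0 b1 b2) u v').
  have := is_diff_mulmx Dt DA; rewrite [(_ \o _) u]/= uK; apply: is_diff_near_eq.
  have K := near_cinv g0g (open_nbhs_nbhs (conj (open_src G (tdom_open V b1)) bs)).
  apply: filterS K => u' bu' /=.
  by rewrite /strv_along (act_coord rep b2 _ bu').
have E1 := pullback_coord D v openT (tgt_smooth G) I g0g zt bt Dt'.
have E2 := pullback_coord D v openT (src_smooth G) I g0g zs bs Dt.
have F1 : 'd (lsrc g0 z1) u w = tr (src g) z1 (src g) (tmap src g v) :=
  drep_tmap v (src_smooth G) I g0g zs.
have F2 : 'd (ltgt g0 z2) u w = tr (tgt g) z2 (tgt g) (tmap tgt g v) :=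
  drep_tmap v (tgt_smooth G) I g0g zt.
have lE : lact rep g0 b1 b2 u = act_mx rep b1 b2 g by rewrite /lact /= uK.
have sE : lsrc g0 z1 u = cmap (chart_at z1) (src g) by rewrite /lsrc /= uK.
have tE : ltgt g0 z2 u = cmap (chart_at z2) (tgt g) by rewrite /ltgt /= uK.
have tauE : strv_along (f := tgt) b2 (fun q => rep q (tau q)) g =
    strv_along (f := src) b1 tau g *m act_mx rep b1 b2 g.
  exact: act_coord.
have L1E : lform1 D g0 z1 b1 u w = conn_form D z1 b1 (cmap (chart_at z1) (src g)) (tr
    (src g) z1 (src g) (tmap src g v)).
  exact: (f_equal2 (conn_form D z1 b1) sE F1).
have L2E : lform2 D g0 z2 b2 u w = conn_form D z2 b2 (cmap (chart_at z2) (tgt g)) (tr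
    (tgt g) z2 (tgt g) (tmap tgt g v)).
  exact: (f_equal2 (conn_form D z2 b2) tE F2).
rewrite E1 (act_coord rep b2 _ bs) E2 -/w tauE /ldefect /cov_diff L1E L2E lE.
rewrite !(mulmxDl, mulmxDr, mulmxN, mulNmx, mulmxA).
by apply/matrixP => i j; rewrite !(mx_addE, mx_oppE); ring.
Qed.

Lemma frame_along_smooth b i :
  smooth_along (f := src) (src @^-1` tdom V b) (fun q => frame V b i (src q)).
Proof.
move=> c; set U := _ `&` _.
have oU : open U by apply: openI; apply: open_src; exact: tdom_open.
have oV : open (tdom V b `&` tdom V c) by apply: openI; exact: tdom_open.
apply: (smooth_on_comp (f := src) (g := fun y => triv V c y (tinv V b y (delta_mx 0 i))
    : euclid 'rV[R]_k) oU oV) => //.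
- exact: smooth_on_sub (src_smooth G).
- exact: trans_smooth.
Qed.

Lemma inv_atP g0 z1 b1 z2 b2 g v :
  cdom (chart_at g0) g -> ldom V z1 b1 z2 b2 g ->
  inv_at g v <-> ldefect rep D g0 z1 b1 z2 b2 (tr g g0 g v) (cmap (chart_at g0) g) = 0.
Proof.
move=> g0g lg; have [[zs bs] [zt bt]] := lg.
have osb : open (src @^-1` tdom V b1) by apply: open_src; exact: tdom_open.
split=> [inv|def0 tau [U [oU Ug st]]].
  apply/row_matrixP => i; rewrite row0.
  (* The pulled back frame sections have constant coordinates, the standard basis vectors, and so
     pick out the rows of the defect. *)
  pose tau q := frame V b1 i (src q).
  have st : near_pt (fun U => smooth_along (f := src) U tau) g.
    by exists (src @^-1` tdom V b1); split=> //; exact: frame_along_smooth.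
  have Dt : is_diff (cmap (chart_at g0) g) (strv_along (f := src) b1 tau \o cinv
      (chart_at g0)) (fun _ => 0).
    have Dc := is_diff_cst0 (delta_mx 0 i : 'rV[R]_k) (cmap (chart_at g0) g).
    apply: is_diff_near_eq Dc.
    have K := near_cinv g0g (open_nbhs_nbhs (conj osb bs)).
    by apply: filterS K => u bu /=; rewrite /strv_along /tau /frame tinvK.
  have := defect_formula v g0g lg Dt; rewrite (inv tau st).
  move=> /eqP; rewrite -[X in X == _]addr0 (inj_eq (addrI _)) => /eqP E.
  have e : strv_along (f := src) b1 tau g = delta_mx 0 i by rewrite /strv_along /tau
      /frame tinvK.
  by rewrite rowE -e; exact: esym E.
have ob : open (U `&` src @^-1` tdom V b1) by exact: openI.
have Dt := differentiableP (is_diff_euclid_rep (st b1) ob (conj Ug bs) g0g).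
have := defect_formula v g0g lg Dt; rewrite def0 mulmx0 addr0.
by move=> /(triv_inj bt).
Qed.

Lemma ldom_self g : ldom V (src g) (src g) (tgt g) (tgt g) g.
Proof. by do !split; first [exact: chart_at_dom|exact: tdom_mem]. Qed.

Lemma ldefectD g0 z1 b1 z2 b2 p q u : lset V g0 z1 b1 z2 b2 u ->
  ldefect rep D g0 z1 b1 z2 b2 (p + q) u =
  ldefect rep D g0 z1 b1 z2 b2 p u + ldefect rep D g0 z1 b1 z2 b2 q u.
Proof.
move=> iu.
have linD m m' (L : 'rV[R]_m -> 'M[R]_(m', k)) v w : linear_at L -> L (v + w) = L v + L
    w.
  by move=> HL; have := HL 1 v w; rewrite !scale1r.
have E1 : lform1 D g0 z1 b1 u (p + q) = lform1 D g0 z1 b1 u p + lform1 D g0 z1 b1 u q.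
  rewrite /lform1 (linearD ('d (lsrc g0 z1) u)).
  by apply: linD; apply: conn_form_linear; exact: lsrc_gdom iu.
have E2 : lform2 D g0 z2 b2 u (p + q) = lform2 D g0 z2 b2 u p + lform2 D g0 z2 b2 u q.
  rewrite /lform2 (linearD ('d (ltgt g0 z2) u)).
  by apply: linD; apply: conn_form_linear; exact: ltgt_gdom iu.
rewrite /ldefect /cov_diff E1 E2 (linearD ('d (lact rep g0 b1 b2) u)).
rewrite !(mulmxDl, mulmxDr, mulmxN, mulNmx, mulmxA).
by apply/matrixP => i j; rewrite !(mx_addE, mx_oppE); ring.
Qed.

Lemma inv_atD g v w : inv_at g v -> inv_at g w -> inv_at g (v + w).
Proof.
have gg := chart_at_dom g; have lg := ldom_self g.
move=> /(inv_atP v gg lg) H1 /(inv_atP w gg lg) H2; apply/(inv_atP _ gg lg).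
have -> : tr g g g (v + w) = tr g g g v + tr g g g w by rewrite /tr linearD.
by rewrite ldefectD ?H1 ?H2 ?addr0 //; exact: lset_cmap.
Qed.

Lemma ldom_unit x : ldom V x x x x (gunit G x).
Proof.
split; rewrite /preimage /= ?src_unit ?tgt_unit;
  by split; first [exact: chart_at_dom|exact: tdom_mem].
Qed.

(** Along the units A is constantly 1 while s and t are both the identity, so dA vanishes and the
    two connection forms coincide. *)
Lemma inv_at_unit_tangent x w : inv_at (gunit G x) (tmap (gunit G) x w).
Proof.
set e := gunit G x; have gg := chart_at_dom e; have lg := ldom_unit x.
have xx := chart_at_dom x; have bx := tdom_mem V x.
apply/(inv_atP _ gg lg); set u := cmap _ e; set p := tmap _ x w.
rewrite (tr_id p gg).
have iu : lset V e x x x x u by exact: lset_cmap.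
have su := unit_smooth G.
have Du := is_diff_rep su I xx gg.
have sx : cdom (chart_at x) (src e) by rewrite src_unit.
have tx : cdom (chart_at x) (tgt e) by rewrite tgt_unit.
have Ds := is_diff_rep_comp (f := gunit G) (g := src) xx gg (su.1 x I) Du (is_diff_rep
    (src_smooth G) I gg sx).
have Dt := is_diff_rep_comp (f := gunit G) (g := tgt) xx gg (su.1 x I) Du (is_diff_rep
    (tgt_smooth G) I gg tx).
have DA := differentiableP (Cinf_diff (lact_smooth rep e x x x x) iu).
have Da := is_diff_rep_comp (f := gunit G) (g := act_mx rep x x) (c := id_chart
    'M[R]_k) xx gg (su.1 x I) Du DA.
have sE : src \o gunit G = idfun by apply/funext => y; rewrite /= src_unit.
have tE : tgt \o gunit G = idfun by apply/funext => y; rewrite /= tgt_unit.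
rewrite sE in Ds; rewrite tE in Dt.
have F1 : 'd (lsrc e x) u p = w.
  by rewrite -[RHS](tr_id w xx); exact: is_diff_unique w Ds (is_diff_tr xx xx).
have F2 : 'd (ltgt e x) u p = w.
  by rewrite -[RHS](tr_id w xx); exact: is_diff_unique w Dt (is_diff_tr xx xx).
have F3 : 'd (lact rep e x x) u p = 0.
  have D1 := is_diff_cst0 (1%:M : 'M[R]_k) (cmap (chart_at x) x).
  have D2 : is_diff (cmap (chart_at x) x) (cmap (id_chart 'M[R]_k) \o (act_mx rep x x
      \o gunit G) \o cinv (chart_at x)) (fun _ => 0).
    apply: is_diff_near_eq D1.
    have K := near_cinv xx (open_nbhs_nbhs (conj (tdom_open V x) bx)).
    by apply: filterS K => u' bu' /=; rewrite act_mx_unit.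
  exact: is_diff_unique w Da D2.
have uK : cinv (chart_at e) u = e by rewrite /u cmapK.
have lE : lact rep e x x u = 1%:M by rewrite /lact /= uK act_mx_unit.
have lsE : lsrc e x u = cmap (chart_at x) x by rewrite /lsrc /= uK src_unit.
have ltE : ltgt e x u = cmap (chart_at x) x by rewrite /ltgt /= uK tgt_unit.
have L1E : lform1 D e x x u p = _ := f_equal2 (conn_form D x x) lsE F1.
have L2E : lform2 D e x x u p = _ := f_equal2 (conn_form D x x) ltE F2.
have aux (a A l1 l2 c : 'M[R]_k) : a = 0 -> A = 1%:M -> l1 = c -> l2 = c ->
    a + A *m l2 - l1 *m A = 0.
  by move=> -> -> -> ->; rewrite mul1mx mulmx1 add0r subrr.
exact: aux F3 lE L1E L2E.
Qed.

End Invariance.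

(** * Curves in the target fibres *)

Lemma cinv_smooth (R : realType) (E : normedModType R) (M : mfd E) (z : M) :
  smooth_on (M := euclid E) (N := M) (cimg (chart_at z)) (cinv (chart_at z)).
Proof.
split=> [u zu|x y]; first exact: cinv_continuous.
by apply: Cinf_sub (chart_at_compat z y) => u [_ [zu yu]].
Qed.

Lemma diff_right_inverse (R : realType) (E F : normedModType R) (f : E -> F) (g : F ->
    E) w v :
  (\forall w' \near w, f (g w') = w') -> differentiable g w -> differentiable f (g w) ->
  'd f (g w) ('d g w v) = v.
Proof.
move=> fg /differentiableP Dg /differentiableP Df.
have D := is_diff_comp Dg Df.
have D2 : is_diff w (f \o g) id.
  by apply: is_diff_near_eq (is_diff_id w); apply: filterS fg => w' /= ->.
exact: is_diff_unique D D2.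
Qed.

(** Phi F = id is available only on B, where F lands in W; this is a neighbourhood of Phi w, which
    is enough. *)
Lemma diff_left_inverse (R : realType) d (F Phi : 'rV[R]_d -> 'rV[R]_d) (B W O : set
    'rV[R]_d) w v :
  open B -> open W -> open O -> B `<=` O -> Cinf O F -> Cinf W Phi -> W w -> B (Phi w)
      -> F (Phi w) = w ->
  (forall u, B u -> W (F u) -> Phi (F u) = u) ->
  'd Phi w ('d F (Phi w) v) = v.
Proof.
move=> oB oW oO BO CF CPhi Ww BP FP PF.
have DF := Cinf_diff CF (BO _ BP).
have DP : differentiable Phi (F (Phi w)) by rewrite FP; exact: Cinf_diff CPhi Ww.
have := @diff_right_inverse _ _ _ Phi F (Phi w) v _ DF DP; rewrite FP; apply.
have WFP : W (F (Phi w)) by rewrite FP.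
have nF := differentiable_continuous DF (open_nbhs_nbhs (conj oW WFP)).
by apply: filterS2 (open_nbhs_nbhs (conj oB BP)) nF => u Bu Wu; exact: PF.
Qed.

Lemma Cinf_affine (R : realType) d (U : set R) (w0 w : 'rV[R]_d) : open U ->
  Cinf U (fun e : R => w0 + e *: w).
Proof.
move=> oU l; apply: (CkD oU); first exact: Ck_cst.
apply: (Ck_mx oU) => i j.
apply: (@Ck_eq _ _ _ _ _ (fun e : R => e * w i j)) => //.
  by move=> e _; rewrite mxE.
by apply: (CkM oU); [exact: Cinf_id|exact: (@Ck_cst R l R R U)].
Qed.

Lemma is_diff_affine (R : realType) d (w0 w : 'rV[R]_d) (x : R) :
  is_diff x (fun e : R => w0 + e *: w) (fun h => h *: w).
Proof.
have K := is_diff_scalel x w.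
apply: (is_diff_ext (is_diffD (is_diff_cst w0 x) K)) => // h.
by rewrite fctE add0r.
Qed.

Section FibreCurve.
Context {R : realType} (n d : nat) (M : mfd 'rV[R]_n) (G : lie_groupoid M d).
Implicit Types (g h : G).
Local Notation src := (@src _ _ _ _ G).
Local Notation tgt := (@tgt _ _ _ _ G).

(** In the normal form the target is linear, so a straight line with direction in its kernel stays
    in the fibre. *)
Lemma fibre_curve g w : tmap tgt g w = 0 ->
  exists gamma : euclid R^o -> G,
    [/\ near_pt (fun U => smooth_on U gamma /\ (forall e, U e -> tgt (gamma e) = tgt
        g)) (0 : R),
        gamma 0 = g & tmap gamma 0 1 = w].
Proof.
move=> tw0.
pose tau := ltgt (G := G) g (tgt g); pose u0 := cmap (chart_at g) g.
have gg := chart_at_dom g; have zz := chart_at_dom (tgt g).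
pose O := rdom g (tgt g) setT tgt.
have oO : open O by apply: open_rdom; [exact: openT|exact: tgt_smooth].
have Ou0 : O u0 by exact: rdom_cmap.
have Ctau : Cinf O tau := (tgt_smooth G).2 g (tgt g).
have surj : forall v', exists v, 'd tau u0 v = v' := tgt_submersion g.
have [r [F [Phi [B [T [r0 [oB Bu0 BO] [CF dF] CPhi [H1 H2 HT HP]]]]]]] :=
  submersion_normal_form oO Ou0 Ctau surj.
set w0 := F u0 in CPhi H1 H2 HP.
have oW : open (ball w0 r) by exact: ball_open.
have Ww0 : ball w0 r w0 by exact: ballxx.
have Pw0 : Phi w0 = u0 by exact: H2.
have wT : w *m T = 0 by rewrite -HT; exact: tw0.
pose aff (e : R) := w0 + e *: w.
have caff e : {for e, continuous aff}.
  by apply: differentiable_continuous; exact: (is_diff_ex (is_diff_affine w0 w e)).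
pose U : set R := aff @^-1` ball w0 r.
have oU : open U by apply: open_comp => // e _; exact: caff.
have aff0 : aff 0 = w0 by rewrite /aff scale0r addr0.
have U0 : U 0 by rewrite /U /preimage /= aff0.
have POe e : U e -> O (Phi (aff e)) by move=> /H1[/BO].
pose gamma : euclid R^o -> G := cinv (chart_at g) \o (Phi \o aff).
have gamma0 : gamma 0 = g by rewrite /gamma /= aff0 Pw0 /u0 cmapK.
exists gamma; split=> //.
- exists U; split=> //; split.
    apply: (smooth_on_comp (M := euclid R^o) (N := euclid 'rV[R]_d) (P := G)
      (f := Phi \o aff) (g := cinv (chart_at g)) oU (cimg_open (chart_at g))).
    + by move=> e /POe [].
    + apply: smooth_on_euclidP => // x.
      apply: (@Cinf_sub _ _ _ _ U); first by move=> e [].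
      by apply: (Cinf_comp oU oW) => //; exact: Cinf_affine.
    + exact: cinv_smooth.
  move=> e Ue; have [gu [_ zu]] := POe e Ue.
  have E : cmap (chart_at (tgt g)) (tgt (gamma e)) = cmap (chart_at (tgt g)) (tgt g).
    transitivity (tau (Phi (aff e))); first by [].
    have W0 := HP w0 Ww0; have WE := HP _ Ue.
    rewrite WE /aff mulmxDl -scalemxAl wT scaler0 addr0 -W0 Pw0.
    by rewrite /tau /ltgt /= cmapK.
  by rewrite -[LHS](cmapK zu) E cmapK.
(* F has differential id at u0, hence so has Phi at w0, and the line with direction w gives a curve
   with velocity w. *)
- have dP v : 'd Phi w0 v = v.
    have [BP FP] := H1 w0 Ww0.
    have H := @diff_left_inverse _ _ F Phi B (ball w0 r) O w0 v oB oW oO BO CF CPhi Ww0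
        BP FP H2.
    have dF' : 'd F (Phi w0) v = v := eq_ind_r (fun x => 'd F x v = v) (dF v) Pw0.
    exact: etrans (congr1 ('d Phi w0) (esym dF')) H.
  have Dg : is_diff (0 : R) (fun e : R => cmap (chart_at g) (gamma e)) (fun t => 'd Phi
      w0 (t *: w)).
    have DP := is_diff_at (esym aff0) (differentiableP (Cinf_diff CPhi Ww0)).
    apply: is_diff_near_eq (is_diff_comp (is_diff_affine w0 w 0) DP).
    apply: filterS (open_nbhs_nbhs (conj oU U0)) => e /POe [gu _] /=.
    by rewrite cinvK.
  have Dg' : is_diff (0 : R^o) (fun e : R^o => cmap (chart_at g) (gamma e))
    (fun t : R^o => 'd Phi w0 ((t : R) *: w)) := Dg.
  rewrite /tmap gamma0; apply: (etrans (diffE_val (1 : R^o) Dg')).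
  by rewrite dP scale1r.
Qed.

End FibreCurve.

Lemma nbhs_imply (T : topologicalType) (x : T) (P Q : set T) :
  nbhs x P -> (forall y, P y -> Q y) -> \forall y \near x, Q y.
Proof. by move=> + PQ; apply: filterS. Qed.

Lemma is_diff_is_derive (R : realType) (F : normedModType R) (f df : R -> F) (x : R) :
  is_diff x f df -> is_derive x 1 f (df 1).
Proof.
move=> D; have Df := is_diff_ex D.
apply: DeriveDef; first exact: diff_derivable.
by rewrite deriveE // (diffE_val (1 : R) D).
Qed.

Section Curves.
Context {R : realType} (n d k : nat) (M : mfd 'rV[R]_n) (G : lie_groupoid M d).
Context (V : vbundle M k) (rep : representation G V) (D : connection V).
Implicit Types (g : G) (x y z b c : M).
Local Notation src := (@src _ _ _ _ G).
Local Notation tgt := (@tgt _ _ _ _ G).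

Lemma curve_diff (E : normedModType R) (N : mfd E) (gamma : euclid R^o -> N) U p w :
  smooth_on U gamma -> U (0 : R) -> gamma 0 = p -> tmap gamma 0 1 = w ->
  {for (0 : R^o), continuous gamma} /\
  exists2 dg : R^o -> E, is_diff (0 : R^o) (cmap (chart_at p) \o gamma \o cinv
      (id_chart R^o)) dg & dg 1 = w.
Proof.
move=> sg U0 <- <-; split; first exact: sg.1.
exists (drep (M := euclid R^o) 0 (gamma 0) gamma 0) => //.
exact: (is_diff_rep (M := euclid R^o) (x := 0) sg U0 I (chart_at_dom (gamma 0))).
Qed.

(** The derivative depends on the curve only through its velocity a, so it does not matter which
    curve a proof of [nablaA] provides. *)
Lemma nablaA_curve x (a : 'rV[R]_d) (gamma : euclid R^o -> G) U
    (sigma : forall y, V y) (ds : 'rV[R]_n -> 'rV[R]_k) (e := gunit G x) :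
  smooth_on U gamma -> U (0 : R) -> gamma 0 = e -> tmap gamma 0 1 = a ->
  is_diff (cmap (chart_at x) x) (strv x sigma \o cinv (chart_at x)) ds ->
  is_derive (0 : R) 1
    (fun t : R => triv V x (tgt (gamma t)) (rep (gamma t) (sigma (src (gamma t)))))
    (ds (anchor G x a) + strv x sigma x *m 'd (lact rep e x x) (cmap (chart_at e) e) a).
Proof.
move=> sg U0 g0 ga Ds.
have [cg [dg Dg dg1]] := curve_diff sg U0 g0 ga.
have ee := chart_at_dom e; have xx := chart_at_dom x; have bx := tdom_mem V x.
have lg := ldom_unit G V x; set u := cmap (chart_at e) e.
have iu : lset V e x x x x u by exact: lset_cmap.
have a0 : cdom (id_chart R^o) (0 : R^o) by [].
have e0 : cdom (chart_at e) (gamma 0) by rewrite g0.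
have s0 : src (gamma 0) = x by rewrite g0 src_unit.
have sx : cdom (chart_at x) (src (gamma 0)) by rewrite s0.
have u0 : u = cmap (chart_at e) (gamma 0) by rewrite g0.
have DA := is_diff_at u0 (differentiableP (Cinf_diff (lact_smooth rep e x x x x) iu)).
have DAg := is_diff_rep_comp (f := gamma) (g := act_mx rep x x) (c := id_chart 'M[R]_k)
  a0 e0 cg Dg DA.
have DS := is_diff_at u0 (differentiableP (Cinf_diff (lsrc_smooth V e x x x x) iu)).
have DSg := is_diff_rep_comp (f := gamma) (g := src) (c := chart_at x) a0 e0 cg Dg DS.
have csg : {for (0 : R^o), continuous (src \o gamma)}.
  by apply: continuous_comp; [exact: cg|exact: src_cont].
have Ds' : is_diff (cmap (chart_at x) ((src \o gamma) 0))
   (cmap (id_chart 'rV[R]_k) \o strv x sigma \o cinv (chart_at x)) ds.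
  by apply: is_diff_at Ds; rewrite /= s0.
have DSS := is_diff_rep_comp (f := src \o gamma) (g := strv x sigma) a0 sx csg DSg Ds'.
have Dp := is_diff_mulmx DSS DAg.
have lE : act_mx rep x x (gamma 0) = 1%:M by rewrite g0 act_mx_unit.
have sE : strv x sigma (src (gamma 0)) = strv x sigma x by rewrite s0.
have aE : 'd (lsrc e x) u a = anchor G x a.
  by rewrite /anchor /tmap src_unit.
have Df : is_diff (0 : R^o)
    (fun t : R^o => triv V x (tgt (gamma t)) (rep (gamma t) (sigma (src (gamma t)))))
    (fun t : R^o => ds ('d (lsrc e x) u (dg t)) *m act_mx rep x x (gamma 0) +
        strv x sigma (src (gamma 0)) *m 'd (lact rep e x x) u (dg t)).
  have Dp' : is_diff (0 : R^o)
    (fun t : R^o => strv x sigma (src (gamma t)) *m act_mx rep x x (gamma t))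
    (fun t : R^o => ds ('d (lsrc e x) u (dg t)) *m act_mx rep x x (gamma 0) +
        strv x sigma (src (gamma 0)) *m 'd (lact rep e x x) u (dg t)) := Dp.
  apply: is_diff_near_eq Dp'.
  have K := csg _ (open_nbhs_nbhs (conj (tdom_open V x) (eq_ind_r (tdom V x) bx s0))).
  apply: (@nbhs_imply R^o 0 ((src \o gamma) @^-1` tdom V x) _ K) => t bt /=.
  exact: esym (act_coord rep x _ bt).
have Df' : is_diff (0 : R)
    (fun t : R => triv V x (tgt (gamma t)) (rep (gamma t) (sigma (src (gamma t)))))
    (fun t : R => ds ('d (lsrc e x) u (dg t)) *m act_mx rep x x (gamma 0) +
        strv x sigma (src (gamma 0)) *m 'd (lact rep e x x) u (dg t)) := Df.
have := is_diff_is_derive Df'.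
by rewrite lE sE mulmx1 dg1 aE.
Qed.

Lemma ldefect_unit x a (e := gunit G x) (u := cmap (chart_at e) e) :
  algebroid G x a ->
  ldefect rep D e x x x x a u =
  'd (lact rep e x x) u a - conn_form D x x (cmap (chart_at x) x) (anchor G x a).
Proof.
move=> ta.
have ee := chart_at_dom e; have lg := ldom_unit G V x.
have iu : lset V e x x x x u by exact: lset_cmap.
have uK : cinv (chart_at e) u = e by rewrite /u cmapK.
have lE : lact rep e x x u = 1%:M.
  by rewrite /lact /= uK act_mx_unit //; exact: tdom_mem.
have lsE : lsrc e x u = cmap (chart_at x) x by rewrite /lsrc /= uK src_unit.
have F1 : 'd (lsrc e x) u a = anchor G x a.
  by rewrite /anchor /tmap src_unit.
have F2 : 'd (ltgt e x) u a = 0.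
  by move: ta; rewrite /algebroid /tmap /= tgt_unit.
have L1E : lform1 D e x x u a = _ := f_equal2 (conn_form D x x) lsE F1.
have L2E : lform2 D e x x u a = 0.
  apply: etrans (congr1 (conn_form D x x (ltgt e x u)) F2) _.
  by apply: linear_at0; apply: conn_form_linear; exact: ltgt_gdom iu.
have aux (m A l1 l2 c : 'M[R]_k) : A = 1%:M -> l1 = c -> l2 = 0 ->
    m + A *m l2 - l1 *m A = m - c.
  by move=> -> -> ->; rewrite mulmx0 mulmx1 addr0.
exact: aux lE L1E L2E.
Qed.

(** The derivative of the action along a is the connection form of nabla^A, so the equation compares
    it with that of nabla along the anchor. *)
Lemma inv_at_unitP x a (e := gunit G x) : algebroid G x a ->
  inv_at rep D e a <->
  'd (lact rep e x x) (cmap (chart_at e) e) a =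
  conn_form D x x (cmap (chart_at x) x) (anchor G x a).
Proof.
move=> ta; have ee := chart_at_dom e; have lg := ldom_unit G V x.
apply: iff_trans (inv_atP rep D a ee lg) _.
rewrite (tr_id a ee) (ldefect_unit ta).
by split=> [/eqP|->]; [rewrite subr_eq0 => /eqP|rewrite subrr].
Qed.

Lemma strv_diff x sigma : smooth_near (V := V) sigma x ->
  differentiable (strv x sigma \o cinv (chart_at x)) (cmap (chart_at x) x).
Proof.
move=> [U [oU Ux sU]].
have oUx : open (U `&` idfun @^-1` tdom V x) by apply: openI => //; exact: tdom_open.
exact: is_diff_euclid_rep (sU x) oUx (conj Ux (tdom_mem V x)) (chart_at_dom x).
Qed.

Lemma nablaA_of_inv_at x a sigma : algebroid G x a -> inv_at rep D (gunit G x) a ->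
  smooth_near (V := V) sigma x -> nablaA rep a sigma (D sigma x (anchor G x a)).
Proof.
move=> ta inv ss.
have [gamma [[U [oU U0 [sU tU]]] g0 ga]] := fibre_curve ta.
exists gamma; split=> //.
  by exists U; split=> //; split=> // t /tU ->; rewrite tgt_unit.
have Ds := differentiableP (strv_diff ss).
have xx := chart_at_dom x.
have := nablaA_curve sU U0 g0 ga Ds.
rewrite ((inv_at_unitP ta).1 inv).
have := nab_coord D (anchor G x a) xx (tdom_mem V x) ss Ds.
by rewrite (tr_id _ xx) => <-.
Qed.

(** Frame sections suffice: with constant coordinates, the two derivatives along the given curve are
    the rows of the two connection forms. *)
Lemma inv_at_of_nablaA x a : algebroid G x a ->
  (forall sigma, smooth_near (V := V) sigma x ->
    nablaA rep a sigma (D sigma x (anchor G x a))) ->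
  inv_at rep D (gunit G x) a.
Proof.
move=> ta H; apply/(inv_at_unitP ta); apply/row_matrixP => i.
have xx := chart_at_dom x; have bx := tdom_mem V x.
have fs := frame_smooth_near i bx.
have [gamma [[U [oU U0 [sU tU]]] g0 ga Dg]] := H _ fs.
have Ds : is_diff (cmap (chart_at x) x) (strv x (frame V x i) \o cinv (chart_at x))
    (fun _ => 0).
  apply: is_diff_near_eq (is_diff_cst0 (delta_mx 0 i : 'rV[R]_k) _).
  have K := near_cinv xx (open_nbhs_nbhs (conj (tdom_open V x) bx)).
  by apply: filterS K => u bu /=; rewrite /strv /frame tinvK.
have D1 := nablaA_curve sU U0 g0 ga Ds.
have sE : strv x (frame V x i) x = delta_mx 0 i by rewrite /strv /frame tinvK.
have := nab_coord D (anchor G x a) xx bx fs Ds.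
rewrite sE add0r -rowE (tr_id _ xx) => <-.
have := @derive_val _ _ _ _ _ _ _ D1; rewrite (@derive_val _ _ _ _ _ _ _ Dg).
by rewrite sE add0r -rowE.
Qed.

End Curves.

Lemma nbhs_and (T : topologicalType) (x : T) (P Q : set T) :
  nbhs x P -> nbhs x Q -> nbhs x (P `&` Q).
Proof. exact: filterI. Qed.

(** * Left translation of target fibres to the units *)

Section Division.
Context {R : realType} (n d k : nat) (M : mfd 'rV[R]_n) (G : lie_groupoid M d).
Context (V : vbundle M k) (rep : representation G V) (D : connection V).
Implicit Types (g : G) (x y z b c : M).
Local Notation src := (@src _ _ _ _ G).
Local Notation tgt := (@tgt _ _ _ _ G).

(* Dividing a curve gamma of the target fibre of g by g, i.e. passing to
   g^-1 gamma, moves it to the target fibre of a unit. *)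
Lemma divide_curve g (gamma : euclid R^o -> G) (U : set R) w :
  open (U : set R^o) -> U 0 ->
  smooth_on (M := euclid R^o) U gamma -> (forall t, U t -> tgt (gamma t) = tgt g) ->
  gamma 0 = g -> tmap gamma 0 1 = w ->
  exists (kappa : R^o -> G) (dk : R^o -> 'rV[R]_d),
  [/\ {for (0 : R^o), continuous kappa}, kappa 0 = gunit G (src g),
      is_diff (0 : R^o) (cmap (chart_at (gunit G (src g))) \o kappa \o cinv (id_chart
          R^o)) dk &
      \forall t \near (0 : R^o),
        [/\ tgt (kappa t) = src g, src (kappa t) = src (gamma t) & gmul g (kappa t) =
            gamma t]].
Proof.
move=> oU U0 sU tU g0 gw; set e := gunit G (src g).
have [cg [dg Dg dg1]] := curve_diff sU U0 g0 gw.
pose N := prod_mfd G G; pose p0 : N := (ginv g, g).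
have Ap0 : src p0.1 = tgt p0.2 by rewrite /= src_inv.
(* Smoothness of the product means a smooth local extension m beyond the composable pairs. The pairs
   (g^-1, gamma t) are composable, so m agrees with the product along them. *)
have [U2 [m [oU2 U2p sm mE]]] := @mul_smooth _ _ _ _ G p0 Ap0.
have mp0 : m p0 = e by rewrite mE // /= mul_invl.
pose pr : R^o -> N := fun t => (ginv g, gamma t).
have pr0 : pr 0 = p0 by rewrite /pr g0.
have cpr : {for (0 : R^o), continuous pr}.
  by apply: cvg_pair; [exact: cvg_cst|exact: cg].
have Dpr : is_diff (0 : R^o) (cmap (chart_at p0) \o pr \o cinv (id_chart R^o))
    (fun t => (0 : 'rV[R]_d, dg t)).
  exact: (is_diff_pair (is_diff_cst0 (cmap (chart_at (ginv g)) (ginv g)) (0 : R^o)) Dg).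
have em : cdom (chart_at e) (m p0) by rewrite mp0; exact: chart_at_dom.
have Dm := is_diff_rep (M := N) (N := G) sm U2p (chart_at_dom p0) em.
have p0pr : cmap (chart_at p0) p0 = cmap (chart_at p0) (pr 0) by rewrite pr0.
have a0 : cdom (id_chart R^o) (0 : R^o) by [].
have b0 : cdom (chart_at p0) (pr 0) by rewrite pr0; exact: chart_at_dom.
have Dk := is_diff_rep_comp (f := pr) (g := m) (c := chart_at e) a0 b0 cpr Dpr
    (is_diff_at p0pr Dm).
exists (m \o pr), (drep (M := N) (N := G) p0 e m p0 \o (fun t => (0 : 'rV[R]_d, dg t))).
split.
- apply: continuous_comp; first exact: cpr.
  by rewrite pr0; exact: sm.1.
- by rewrite /= pr0.
- exact: Dk.
- have U2pr : U2 (pr 0) by rewrite pr0.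
  have K1 : nbhs (0 : R^o) U := open_nbhs_nbhs (conj oU U0).
  have K2 : nbhs (0 : R^o) (pr @^-1` U2) := cpr _ (open_nbhs_nbhs (conj oU2 U2pr)).
  have K := @nbhs_and R^o 0 _ _ K1 K2.
  apply: (@nbhs_imply R^o 0 _ _ K) => t [Ut U2t].
  have st : src (ginv g) = tgt (gamma t) by rewrite src_inv tU.
  rewrite /= mE //=.
  split; [by rewrite tgt_mul // tgt_inv|by rewrite src_mul|].
  by rewrite gmulA ?tgt_inv // mul_invr -(tU t Ut) mul_unitl.
Qed.

(** Here a is the velocity at the unit of kappa = g^-1 gamma. As kappa has constant target and the
    same source as gamma, the first two clauses follow; the third differentiates the action of g
    kappa = gamma. *)
Lemma fibre_tangent g w (e := gunit G (src g)) : tmap tgt g w = 0 ->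
  exists a, [/\ algebroid G (src g) a, anchor G (src g) a = tmap src g w &
    'd (lact rep g (src g) (tgt g)) (cmap (chart_at g) g) w =
    'd (lact rep e (src g) (src g)) (cmap (chart_at e) e) a *m act_mx rep (src g) (tgt
        g) g].
Proof.
move=> tw0; have [gamma [[U [oU U0 [sU tU]]] g0 gw]] := fibre_curve tw0.
have [cg [dg Dg dg1]] := curve_diff sU U0 g0 gw.
have [kappa [dk [ck k0 Dk nk]]] := divide_curve oU U0 sU tU g0 gw.
have gg := chart_at_dom g; have ee := chart_at_dom e.
have a0 : cdom (id_chart R^o) (0 : R^o) by [].
have e0 : cdom (chart_at e) (kappa 0) by rewrite k0.
have gg0 : cdom (chart_at g) (gamma 0) by rewrite g0.
have ke : cmap (chart_at e) e = cmap (chart_at e) (kappa 0) by rewrite k0.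
have ge : cmap (chart_at g) g = cmap (chart_at g) (gamma 0) by rewrite g0.
exists (dk 1); split.
- have Dt := is_diff_rep (tgt_smooth G) I ee (chart_at_dom (tgt e)).
  have Dtk := is_diff_rep_comp (f := kappa) (g := tgt) a0 e0 ck Dk (is_diff_at ke Dt).
  have D0 : is_diff (0 : R^o) (cmap (chart_at (tgt e)) \o (tgt \o kappa) \o cinv
      (id_chart R^o)) (fun _ => 0).
    apply: is_diff_near_eq (is_diff_cst0 (cmap (chart_at (tgt e)) (src g)) (0 : R^o)).
    by apply: (@nbhs_imply R^o 0 _ _ nk) => t [tk _ _] /=; rewrite tk.
  exact: is_diff_unique (1 : R^o) Dtk D0.
- have se : cdom (chart_at (src g)) (src e) by rewrite src_unit; exact: chart_at_dom.
  have Ds := is_diff_rep (src_smooth G) I ee se.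
  have Dsk := is_diff_rep_comp (f := kappa) (g := src) a0 e0 ck Dk (is_diff_at ke Ds).
  have Dsg := is_diff_rep (src_smooth G) I gg (chart_at_dom (src g)).
  have Dsg' := is_diff_rep_comp (f := gamma) (g := src) a0 gg0 cg Dg (is_diff_at ge
      Dsg).
  have Dsk' : is_diff (0 : R^o) (cmap (chart_at (src g)) \o (src \o gamma) \o cinv
      (id_chart R^o))
      (drep e (src g) src e \o dk).
    apply: is_diff_near_eq Dsk.
    by apply: (@nbhs_imply R^o 0 _ _ nk) => t [_ sk _] /=; rewrite sk.
  have E : drep e (src g) src e (dk 1) = drep g (src g) src g (dg 1) :=
    is_diff_unique (1 : R^o) Dsk' Dsg'.
  rewrite dg1 in E; apply: etrans E.
  by rewrite /anchor /tmap src_unit.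
- have sg := tdom_mem V (src g).
  have ieu : lset V e (src g) (src g) (src g) (src g) (cmap (chart_at e) e).
    by apply: lset_cmap => //; exact: ldom_unit.
  have igu : lset V g (src g) (src g) (tgt g) (tgt g) (cmap (chart_at g) g).
    by apply: lset_cmap => //; exact: ldom_self.
  have De := differentiableP (Cinf_diff (lact_smooth rep e (src g) (src g) (src g) (src
      g)) ieu).
  have Dgg := differentiableP (Cinf_diff (lact_smooth rep g (src g) (src g) (tgt g)
      (tgt g)) igu).
  have Dek := is_diff_rep_comp (f := kappa) (g := act_mx rep (src g) (src g))
    (c := id_chart 'M[R]_k) a0 e0 ck Dk (is_diff_at ke De).
  have Dgk := is_diff_rep_comp (f := gamma) (g := act_mx rep (src g) (tgt g))
    (c := id_chart 'M[R]_k) a0 gg0 cg Dg (is_diff_at ge Dgg).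
  have Dm := is_diff_mulmx Dek (is_diff_cst (act_mx rep (src g) (tgt g) g) (0 : R^o)).
  have csk : {for (0 : R^o), continuous (src \o kappa)}.
    by apply: continuous_comp; [exact: ck|exact: src_cont].
  have s0 : tdom V (src g) ((src \o kappa) 0) by rewrite /= k0 src_unit.
  have K : nbhs (0 : R^o) ((src \o kappa) @^-1` tdom V (src g)) :=
    csk _ (open_nbhs_nbhs (conj (tdom_open V (src g)) s0)).
  have Dgk' : is_diff (0 : R^o) (cmap (id_chart 'M[R]_k) \o (act_mx rep (src g) (tgt g)
      \o gamma) \o cinv (id_chart R^o))
     (fun t => 'd (lact rep e (src g) (src g)) (cmap (chart_at e) e) (dk t) *m act_mx
         rep (src g) (tgt g) g).
    have Dm' : is_diff (0 : R^o) (fun t => act_mx rep (src g) (src g) (kappa t) *m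
        act_mx rep (src g) (tgt g) g)
     (fun t => 'd (lact rep e (src g) (src g)) (cmap (chart_at e) e) (dk t) *m act_mx
         rep (src g) (tgt g) g).
      by apply: (is_diff_ext Dm) => // t; rewrite mulmx0 addr0.
    apply: is_diff_near_eq Dm'.
    have KK := @nbhs_and R^o 0 _ _ nk K.
    apply: (@nbhs_imply R^o 0 _ _ KK) => t [[tk sk gk] bt] /=.
    by rewrite -(act_mx_mul rep (tgt g) (esym tk) bt sg) gk.
  have E := is_diff_unique (1 : R^o) Dgk Dgk'.
  by move: E; rewrite /= dg1.
Qed.

(** On ker dt the term with th2 vanishes, and by [fibre_tangent] what is left of the defect is the
    defect at the unit along a, multiplied by the matrix of g. *)
Lemma inv_at_fibre g w :
  (forall x a, algebroid G x a -> inv_at rep D (gunit G x) a) ->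
  tmap tgt g w = 0 ->
  inv_at rep D g w /\
  exists2 a, algebroid G (src g) a & anchor G (src g) a = tmap src g w.
Proof.
move=> H tw; have [a [ta aE dE]] := fibre_tangent tw.
split; last by exists a.
have gg := chart_at_dom g; have lg := ldom_self V g; set u := cmap (chart_at g) g.
have iu : lset V g (src g) (src g) (tgt g) (tgt g) u by exact: lset_cmap.
apply/(inv_atP rep D w gg lg); rewrite (tr_id w gg).
have uK : cinv (chart_at g) u = g by rewrite /u cmapK.
have lE : lact rep g (src g) (tgt g) u = act_mx rep (src g) (tgt g) g by rewrite /lact
    /= uK.
have sE : lsrc g (src g) u = cmap (chart_at (src g)) (src g) by rewrite /lsrc /= uK.
have F1 : 'd (lsrc g (src g)) u w = anchor G (src g) a := esym aE.
have F2 : 'd (ltgt g (tgt g)) u w = 0 := tw.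
have L1E : lform1 D g (src g) (src g) u w = _ := f_equal2 (conn_form D (src g) (src g))
    sE F1.
have L2E : lform2 D g (tgt g) (tgt g) u w = 0.
  apply: etrans (congr1 (conn_form D (tgt g) (tgt g) (ltgt g (tgt g) u)) F2) _.
  by apply: linear_at0; apply: conn_form_linear; exact: ltgt_gdom iu.
have IE := (inv_at_unitP rep D ta).1 (H _ _ ta).
have aux (m A A' l1 l2 c c' : 'M[R]_k) : A = A' -> l1 = c -> l2 = 0 -> m = c' *m A' ->
    c' = c ->
    m + A *m l2 - l1 *m A = 0.
  by move=> -> -> -> -> ->; rewrite mulmx0 addr0 subrr.
exact: aux lE L1E L2E dE IE.
Qed.

End Division.

Section Forms.
Context {R : realType}.

Lemma Cinf_apply (E : normedModType R) n m p (W : set E)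
    (L : E -> 'rV[R]_n -> 'M[R]_(m, p)) (y : E -> 'rV[R]_n) :
  open W -> (forall w, W w -> linear_at (L w)) -> (forall v, Cinf W (L^~ v)) ->
  Cinf W y -> Cinf W (fun w => L w (y w)).
Proof.
move=> oW linL CL Cy l.
apply: (@Ck_eq _ _ _ _ _ (fun w => \sum_j y w 0 j *: L w (delta_mx 0 j))) => //.
  by move=> w Ww; rewrite -(linear_at_sum (linL w Ww)).
apply: Ck_sum => // j; apply: (Ck_mx oW) => i i'.
have H : Ck l W (fun w => y w 0 j * L w (delta_mx 0 j) i i').
  by apply: (CkM oW); [exact: (Ck_entry 0 j oW (Cy l))|exact: (Ck_entry i i' oW (CL _
      l))].
by apply: Ck_eq H => // w _; rewrite mxE.
Qed.

Lemma pullback_form_smooth (E : normedModType R) n k (W : set E) (O : set 'rV[R]_n)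
    (s : E -> 'rV[R]_n) (G : 'rV[R]_n -> 'rV[R]_n -> 'M[R]_k) p :
  open W -> open O -> (forall w, W w -> O (s w)) -> Cinf W s ->
  (forall u, O u -> linear_at (G u)) -> (forall v, Cinf O (G^~ v)) ->
  Cinf W (fun w => G (s w) ('d s w p)).
Proof.
move=> oW oO sWO Cs linG CG.
apply: (@Cinf_apply _ _ _ _ W (fun w => G (s w))) => //.
- by move=> w /sWO /linG.
- by move=> v; apply: (Cinf_comp oW oO sWO Cs (CG v)).
- exact: Cinf_d.
Qed.

Lemma curv_form0l n k (O : set 'rV[R]_n) (G : 'rV[R]_n -> 'rV[R]_n -> 'M[R]_k) u p :
  open O -> O u -> (forall u, O u -> linear_at (G u)) -> curv_form G u 0 p = 0.
Proof.
move=> oO Ou linG.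
have D0 : is_diff u (G^~ 0) (fun _ => 0).
  apply: is_diff_near_eq (is_diff_cst0 (0 : 'M[R]_k) u).
  have K := open_nbhs_nbhs (conj oO Ou).
  by apply: (nbhs_imply K) => u' Ou'; rewrite (linear_at0 (linG u' Ou')).
have aux (a b c e : 'M[R]_k) : a = 0 -> b = 0 -> e = 0 -> a - b + c *m e - e *m c = 0.
  by move=> -> -> ->; rewrite mulmx0 mul0mx !subr0 addr0.
exact: aux (linear0 ('d (G^~ p) u)) (diffE_val p D0) (linear_at0 (linG u Ou)).
Qed.

End Forms.

(** * Curvature and its matrix form; necessity of the curvature condition *)

Section Final.
Context {R : realType} (n d k : nat) (M : mfd 'rV[R]_n) (G : lie_groupoid M d).
Context (V : vbundle M k) (rep : representation G V) (D : connection V).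
Implicit Types (g : G) (x y z b c : M).
Local Notation src := (@src _ _ _ _ G).
Local Notation tgt := (@tgt _ _ _ _ G).

Lemma tr0 (E : normedModType R) (N : mfd E) (z1 z2 y : N) : tr z1 z2 y 0 = 0.
Proof. by rewrite /tr linear0. Qed.

(** Tested on frame sections and on coordinate fields extending u and v, whose bracket and
    coordinate derivatives vanish. *)
Lemma curv_form_of_vanishing y u v z b : cdom (chart_at z) y -> tdom V b y ->
  curvature_vanishes D y u v ->
  curv_form (conn_form D z b) (cmap (chart_at z) y) (tr y z y u) (tr y z y v) = 0.
Proof.
move=> zy yb cv; apply/row_matrixP => i; rewrite row0.
have yy := chart_at_dom y.
pose F p := coord_field z (tr y z y p).
have nF p : near_pt (fun U => smooth_vf U (F p)) y.
  exists (cdom (chart_at z)); split; [exact: cdom_open|exact: zy|exact: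
      coord_field_smooth].
have Fy p : F p y = p by exact: trK.
have FE p u' : cimg (chart_at z) u' -> coord_vf (chart_at z) (F p) u' = tr y z y p.
  move=> zu; rewrite coord_field_rep //; last exact: cinv_dom.
  by rewrite tr_id //; exact: cinv_dom.
have zu := cmap_img zy.
have DF p : is_diff (cmap (chart_at z) y) (coord_vf (chart_at z) (F p)) (fun _ => 0).
  apply: is_diff_near_eq (is_diff_cst0 (tr y z y p) _).
  have K := open_nbhs_nbhs (conj (cimg_open (chart_at z)) zu).
  by apply: (nbhs_imply K) => u' /FE ->.
have fs := frame_smooth_near i yb.
have br : tr y z y (lie_bracket (F u) (F v) y) = 0 - 0.
  by rewrite lie_bracket_coord_field // tr0 subr0.
have := curvature_coord D zy yb (nF u) (nF v) fs (DF u) (DF v) br.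
rewrite (cv _ _ _ (nF u) (nF v) fs (Fy u) (Fy v)) linear0 !FE //.
have -> : strv b (frame V b i) y = delta_mx 0 i by rewrite /strv /frame tinvK.
by rewrite -rowE => <-.
Qed.

Lemma curvature_vanishes_of_form x u v :
  curv_form (conn_form D x x) (cmap (chart_at x) x) u v = 0 ->
  curvature_vanishes D x u v.
Proof.
move=> cf X Y sigma nX nY ns Xx Yx.
have xx := chart_at_dom x; have bx := tdom_mem V x.
have [UX [oUX UXx sX]] := nX; have [UY [oUY UYx sY]] := nY.
have DX := differentiableP (is_diff_coord_vf sX UXx xx).
have DY := differentiableP (is_diff_coord_vf sY UYx xx).
have vE (Z : M -> 'rV[R]_n) : coord_vf (chart_at x) Z (cmap (chart_at x) x) = Z x.
  by rewrite coord_vf_tr cmapK // tr_id.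
have br : tr x x x (lie_bracket X Y x) =
    'd (coord_vf (chart_at x) Y) (cmap (chart_at x) x) (coord_vf (chart_at x) X (cmap
        (chart_at x) x)) -
    'd (coord_vf (chart_at x) X) (cmap (chart_at x) x) (coord_vf (chart_at x) Y (cmap
        (chart_at x) x)).
  by rewrite !vE tr_id.
have E := curvature_coord D xx bx nX nY ns DX DY br.
apply: (triv_inj bx); rewrite E linear0 !vE Xx Yx cf mulmx0.
by [].
Qed.

Lemma ldefect0 g0 z1 b1 z2 b2 u p : (forall g v, inv_at rep D g v) ->
  lset V g0 z1 b1 z2 b2 u -> ldefect rep D g0 z1 b1 z2 b2 p u = 0.
Proof.
move=> H iu; have [gu lu] := iu; set g := cinv (chart_at g0) u.
have g0g : cdom (chart_at g0) g by exact: cinv_dom.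
have := (inv_atP rep D (tr g0 g g p) g0g lu).1 (H _ _).
by rewrite (trK g0g (chart_at_dom g)) cinvK.
Qed.

(** The Ricci identity at the unit along a and a vector p with ds p = v; since dt a = 0, the
    curvature pulled back along t drops out. *)
Lemma curvature_of_inv x a v : (forall g v, inv_at rep D g v) ->
  algebroid G x a -> curvature_vanishes D x (anchor G x a) v.
Proof.
move=> H ta; apply: curvature_vanishes_of_form.
set e := gunit G x; have ee := chart_at_dom e; have lg := ldom_unit G V x.
set u := cmap (chart_at e) e.
have xx := chart_at_dom x; have bx := tdom_mem V x.
have iu : lset V e x x x x u by exact: lset_cmap.
have oS : open (lset V e x x x x) by exact: open_lset.
have [p pv] := src_submersion e v.
have srcE q : 'd (lsrc e x) u q = tmap src e q by rewrite /tmap src_unit.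
have tgtE : 'd (ltgt e x) u a = 0 by move: ta; rewrite /algebroid /tmap /= tgt_unit.
have C1 q : Cinf (lset V e x x x x) ((lform1 D e x x)^~ q).
  apply: (pullback_form_smooth q oS (@open_gdom _ _ _ _ V x x)) => //.
  - by move=> w; exact: lsrc_gdom.
  - exact: lsrc_smooth.
  - by move=> w gw; exact: conn_form_linear.
  - by move=> w; exact: conn_form_smooth.
have C2 q : Cinf (lset V e x x x x) ((lform2 D e x x)^~ q).
  apply: (pullback_form_smooth q oS (@open_gdom _ _ _ _ V x x)) => //.
  - by move=> w; exact: ltgt_gdom.
  - exact: ltgt_smooth.
  - by move=> w gw; exact: conn_form_linear.
  - by move=> w; exact: conn_form_smooth.
have E := cov_diff_curvature p a oS iu (lact_smooth rep e x x x x) C1 C2.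
have d0 q r : 'd (ldefect rep D e x x x x q) u r = 0.
  have D0 : is_diff u (ldefect rep D e x x x x q) (fun _ => 0).
    apply: is_diff_near_eq (is_diff_cst0 (0 : 'M[R]_k) u).
    have K := open_nbhs_nbhs (conj oS iu).
    by apply: (nbhs_imply K) => u' iu'; rewrite (ldefect0 q H iu').
  exact: diffE_val D0.
have uK : cinv (chart_at e) u = e by rewrite /u cmapK.
have lE : lact rep e x x u = 1%:M by rewrite /lact /= uK act_mx_unit.
have P1 := curv_form_pullback a p oS iu (lsrc_smooth V e x x x x)
  (@lsrc_gdom _ _ _ _ _ _ V e x x x x) (@conn_form_linear _ _ _ _ _ D x x)
      (conn_form_smooth D x x).
have P2 := curv_form_pullback a p oS iu (ltgt_smooth V e x x x x)
  (@ltgt_gdom _ _ _ _ _ _ V e x x x x) (@conn_form_linear _ _ _ _ _ D x x)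
      (conn_form_smooth D x x).
have P20 : curv_form (lform2 D e x x) u a p = 0.
  apply: etrans P2 _.
  apply: etrans (congr1 (fun q => curv_form (conn_form D x x) _ q _) tgtE) _.
  exact: (curv_form0l _ (@open_gdom _ _ _ _ V x x) (ltgt_gdom iu) (@conn_form_linear _
      _ _ _ _ D x x)).
have sE : lsrc e x u = cmap (chart_at x) x by rewrite /lsrc /= uK src_unit.
have aux (D1 D2 Oa Op t1p t1q t2p t2q A K1 K2 : 'M[R]_k) :
    D1 - D2 = Oa *m t2p - Op *m t2q - t1p *m Oa + t1q *m Op + A *m K2 - K1 *m A ->
    D1 = 0 -> D2 = 0 -> Oa = 0 -> Op = 0 -> K2 = 0 -> A = 1%:M -> K1 = 0.
  move=> e1 D10 D20 Oa0 Op0 K20 A1; move: e1.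
  rewrite D10 D20 Oa0 Op0 K20 A1 !(mul0mx, mulmx0, mulmx1) !subr0 !addr0 sub0r.
  by move=> /eqP; rewrite eq_sym oppr_eq0 => /eqP.
have K0 := aux _ _ _ _ _ _ _ _ _ _ _ E (d0 _ _) (d0 _ _) (ldefect0 a H iu) (ldefect0 p
    H iu) P20 lE.
have := etrans (esym P1) K0.
have vE : 'd (lsrc e x) u p = v := etrans (srcE p) pv.
have aE : 'd (lsrc e x) u a = anchor G x a := srcE a.
exact: etrans (f_equal3 (curv_form (conn_form D x x)) (esym sE) (esym aE) (esym vE)).
Qed.

End Final.

(** * Propagation along the target fibres *)

Lemma diff_compE (R : realType) (E F H : normedModType R) (f : F -> H) (g : E -> F) w v
    :
  differentiable g w -> differentiable f (g w) -> 'd (f \o g) w v = 'd f (g w) ('d g w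
      v).
Proof.
move=> /differentiableP Dg /differentiableP Df.
exact: diffE_val v (is_diff_comp Dg Df).
Qed.

Lemma ball_segment (R : realType) (E : normedModType R) (c w q : E) (r t : R) :
  ball c r w -> ball c r (w + q) -> 0 <= t <= 1 -> ball c r (w + t *: q).
Proof.
rewrite -!ball_normE /ball_ /= => Bw Bq /andP[t0 t1].
have -> : c - (w + t *: q) = (1 - t) *: (c - w) + t *: (c - (w + q)).
  by rewrite !opprD !addrA scalerBl scale1r (scalerBr t (c - w) q) addrA subrK.
apply: le_lt_trans (ler_normD _ _) _; rewrite !normrZ (ger0_norm t0) ger0_norm
    ?subr_ge0 //.
(* Strictness comes from the term with factor t, so t = 0 is treated apart. *)
have [->|tn0] := eqVneq t 0; first by rewrite subr0 mul1r mul0r addr0.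
have tp : 0 < t by rewrite lt_neqAle eq_sym tn0.
rewrite [ltRHS](_ : r = (1 - t) * r + t * r); last by ring.
apply: ler_ltD; first by rewrite ler_wpM2l ?subr_ge0 // ltW.
by rewrite ltr_pM2l.
Qed.

Section LocalConstancy.
Context {R : realType} (n d k : nat) (M : mfd 'rV[R]_n) (G : lie_groupoid M d).
Context (V : vbundle M k) (rep : representation G V) (D : connection V).
Implicit Types (g : G) (x y z b c : M).
Local Notation src := (@src _ _ _ _ G).
Local Notation tgt := (@tgt _ _ _ _ G).

Hypothesis inv_unit : forall x a, algebroid G x a -> inv_at rep D (gunit G x) a.
Hypothesis curv_anchor : forall x a, algebroid G x a ->
  forall v, curvature_vanishes D x (anchor G x a) v.

Section AtPoint.
Variable g0 : G.
Let x1 := src g0.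
Let x2 := tgt g0.
Let S := lset V g0 x1 x1 x2 x2.
Let Om := ldefect rep D g0 x1 x1 x2 x2.

(** The two hypotheses on units, carried to every arrow near g0 and written in the fixed charts at
    g0: by left translation, ds q is in the image of the anchor. *)
Lemma ldefect_fibre_direction u q : S u -> 'd (ltgt g0 x2) u q = 0 ->
  Om q u = 0 /\ forall p, curv_form (conn_form D x1 x1) (lsrc g0 x1 u) ('d (lsrc g0 x1)
      u q) p = 0.
Proof.
move=> Su tq; have [gu lu] := Su; set g := cinv (chart_at g0) u in lu.
have g0g : cdom (chart_at g0) g by exact: cinv_dom.
have gg := chart_at_dom g; have [[zs bs] [zt bt]] := lu.
have gK : cmap (chart_at g0) g = u by exact: cinvK.
set w := tr g0 g g q.
have wK : tr g g0 g w = q by exact: trK.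
have tw : tmap tgt g w = 0.
  have E : 'd (ltgt g0 x2) (cmap (chart_at g0) g) (tr g g0 g w) = tr (tgt g) x2 (tgt g)
      (tmap tgt g w) :=
    drep_tmap w (tgt_smooth G) I g0g zt.
  have E' : tr (tgt g) x2 (tgt g) (tmap tgt g w) = 0.
    by apply: etrans (esym E) _; rewrite wK gK; exact: tq.
  by rewrite -[LHS](trK (chart_at_dom (tgt g)) zt) E' tr0.
have [inv [a ta aE]] := inv_at_fibre inv_unit tw.
split.
  have := (inv_atP rep D w g0g lu).1 inv.
  by rewrite wK gK.
move=> p.
have E : 'd (lsrc g0 x1) (cmap (chart_at g0) g) (tr g g0 g w) = tr (src g) x1 (src g)
    (tmap src g w) :=
  drep_tmap w (src_smooth G) I g0g zs.
have {}E : 'd (lsrc g0 x1) u q = tr (src g) x1 (src g) (anchor G (src g) a).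
  apply: etrans (etrans E (congr1 (tr (src g) x1 (src g)) (esym aE))).
  by rewrite wK gK.
have C0 := curv_form_of_vanishing zs bs (@curv_anchor _ _ ta (tr x1 (src g) (src g) p)).
rewrite (trK zs (chart_at_dom (src g))) in C0.
exact: etrans (f_equal (fun q' => curv_form (conn_form D x1 x1) (lsrc g0 x1 u) q' p) E)
    C0.
Qed.

Lemma inv_at_ldefect g : cdom (chart_at g0) g -> ldom V x1 x1 x2 x2 g ->
  (forall v, inv_at rep D g v) <-> (forall q, Om q (cmap (chart_at g0) g) = 0).
Proof.
move=> g0g lg; split=> H v.
  have := (inv_atP rep D (tr g0 g g v) g0g lg).1 (H _).
  by rewrite (trK g0g (chart_at_dom g)).
by apply/(inv_atP rep D v g0g lg).
Qed.

(** The neighbourhood is a ball in the normal form of the target, where two arrows with equal target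
    are joined by a segment in their fibre, along which [cov_diff_const_along] applies. *)
Lemma inv_at_locally_const : exists O : set G, [/\ open O, O g0 &
  forall g g', O g -> O g' -> tgt g = tgt g' ->
    (forall v, inv_at rep D g v) -> forall v, inv_at rep D g' v].
Proof.
have g0g0 := chart_at_dom g0; have lg0 := ldom_self V g0.
set u0 := cmap (chart_at g0) g0.
have oS : open S by exact: open_lset.
have Su0 : S u0 by exact: lset_cmap.
pose tau := ltgt (G := G) g0 x2.
have Ctau : Cinf S tau by exact: ltgt_smooth.
have surj : forall v', exists v, 'd tau u0 v = v' := tgt_submersion g0.
have [r [F [Phi [B [T [r0 [oB Bu0 BS] [CF dF] CPhi [H1 H2 HT HP]]]]]]] :=
  submersion_normal_form oS Su0 Ctau surj.
set w0 := F u0 in CPhi H1 H2 HP; set W := ball w0 r in CPhi H1 H2 HP.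
have oW : open W by exact: ball_open.
have PS w : W w -> S (Phi w) by move=> /H1[/BS].
have dPhi w : W w -> differentiable Phi w by move=> Ww; exact: Cinf_diff CPhi Ww.
have dPhi_surj w q : W w -> exists p, 'd Phi w p = q.
  move=> Ww; have [BP FP] := H1 w Ww; exists ('d F (Phi w) q).
  exact: (diff_left_inverse q oB oW oS BS CF CPhi Ww BP FP H2).
(* All data are pulled back by Phi, so that the fibre directions become the fixed kernel of T and
   the segments straight. *)
pose A := lact rep g0 x1 x2 \o Phi.
pose s := lsrc (G := G) g0 x1 \o Phi.
pose t := tau \o Phi.
pose th1 w p := conn_form D x1 x1 (s w) ('d s w p).
pose th2 w p := conn_form D x2 x2 (t w) ('d t w p).
have Cs : Cinf W s by apply: (Cinf_comp oW oS PS CPhi); exact: lsrc_smooth.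
have Ct : Cinf W t by apply: (Cinf_comp oW oS PS CPhi); exact: ltgt_smooth.
have CA : Cinf W A by apply: (Cinf_comp oW oS PS CPhi); exact: lact_smooth.
have sO w : W w -> gdom V x1 x1 (s w) by move=> /PS; exact: lsrc_gdom.
have tO w : W w -> gdom V x2 x2 (t w) by move=> /PS; exact: ltgt_gdom.
have lin1 := @conn_form_linear _ _ _ _ _ D x1 x1.
have lin2 := @conn_form_linear _ _ _ _ _ D x2 x2.
have og1 : open (gdom V x1 x1) by exact: open_gdom.
have og2 : open (gdom V x2 x2) by exact: open_gdom.
have C1 p : Cinf W (th1^~ p).
  exact: (pullback_form_smooth p oW og1 sO Cs lin1 (conn_form_smooth D x1 x1)).
have C2 p : Cinf W (th2^~ p).
  exact: (pullback_form_smooth p oW og2 tO Ct lin2 (conn_form_smooth D x2 x2)).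
have ds w p : W w -> 'd s w p = 'd (lsrc g0 x1) (Phi w) ('d Phi w p).
  move=> Ww; apply: diff_compE (dPhi w Ww) _.
  exact: Cinf_diff (lsrc_smooth V g0 x1 x1 x2 x2) (PS w Ww).
have dt w p : W w -> 'd t w p = 'd (ltgt g0 x2) (Phi w) ('d Phi w p).
  move=> Ww; apply: diff_compE (dPhi w Ww) _.
  exact: Cinf_diff Ctau (PS w Ww).
have dA w p : W w -> 'd A w p = 'd (lact rep g0 x1 x2) (Phi w) ('d Phi w p).
  move=> Ww; apply: diff_compE (dPhi w Ww) _.
  exact: Cinf_diff (lact_smooth rep g0 x1 x1 x2 x2) (PS w Ww).
have OmE w p : W w -> cov_diff A th1 th2 p w = Om ('d Phi w p) (Phi w).
  move=> Ww.
  have e1 : th1 w p = lform1 D g0 x1 x1 (Phi w) ('d Phi w p) :=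
    congr1 (conn_form D x1 x1 (s w)) (ds w p Ww).
  have e2 : th2 w p = lform2 D g0 x2 x2 (Phi w) ('d Phi w p) :=
    congr1 (conn_form D x2 x2 (t w)) (dt w p Ww).
  have aux (a a' m l1 l2 l1' l2' : 'M[R]_k) : a = a' -> l1 = l1' -> l2 = l2' ->
      a + m *m l2 - l1 *m m = a' + m *m l2' - l1' *m m by move=> -> -> ->.
  exact: aux (dA w p Ww) e1 e2.
have dtT w p : W w -> 'd t w p = p *m T.
  move=> Ww; have DT := is_diff_mulmxr T w.
  have Dt : is_diff w t (mulmx^~ T).
    apply: is_diff_near_eq DT.
    have K := open_nbhs_nbhs (conj oW Ww).
    by apply: (nbhs_imply K) => w' Ww'; exact: esym (HP w' Ww').
  exact: diffE_val Dt.
exists (cdom (chart_at g0) `&` cmap (chart_at g0) @^-1` (B `&` F @^-1` W)); split.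
- rewrite openE => g [g0g [Bg Wg]].
  have K1 := open_nbhs_nbhs (conj (cdom_open (chart_at g0)) g0g).
  have cm := cmap_continuous g0g.
  have K2 : nbhs (cmap (chart_at g0) g) (B `&` F @^-1` W).
    apply: nbhs_and; first exact: (open_nbhs_nbhs (conj oB Bg)).
    have cF := differentiable_continuous (Cinf_diff CF (BS _ Bg)).
    exact: cF _ (open_nbhs_nbhs (conj oW Wg)).
  by apply: filterI; [exact: K1|exact: cm _ K2].
- by split=> //; split=> //; exact: ballxx.
move=> g g' [g0g [Bg Wg]] [g0g' [Bg' Wg']] tE inv.
have gS : S (cmap (chart_at g0) g) := BS _ Bg.
have gS' : S (cmap (chart_at g0) g') := BS _ Bg'.
have lg : ldom V x1 x1 x2 x2 g by have [_] := gS; rewrite /preimage /= cmapK.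
have lg' : ldom V x1 x1 x2 x2 g' by have [_] := gS'; rewrite /preimage /= cmapK.
pose w := F (cmap (chart_at g0) g); pose w' := F (cmap (chart_at g0) g').
have Pw : Phi w = cmap (chart_at g0) g by exact: H2.
have Pw' : Phi w' = cmap (chart_at g0) g' by exact: H2.
have inv0 := (inv_at_ldefect g0g lg).1 inv.
apply/(inv_at_ldefect g0g' lg') => q.
(* Every direction at the endpoint is the image of a constant p, because the differential of Phi is
   onto there; p can then be kept fixed along the segment. *)
rewrite -Pw'; have [p <-] := dPhi_surj w' q Wg'; rewrite -OmE //.
have tw : w *m T = cmap (chart_at x2) (tgt g).
  by rewrite -(HP w Wg) Pw /tau /ltgt /= cmapK.
have tw' : w' *m T = cmap (chart_at x2) (tgt g').
  by rewrite -(HP w' Wg') Pw' /tau /ltgt /= cmapK.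
have qT : (w' - w) *m T = 0 by rewrite mulmxBl tw tw' tE subrr.
have e : w + (w' - w) = w' by rewrite addrC subrK.
suff H0 : cov_diff A th1 th2 p (w + (w' - w)) = 0.
  exact: etrans (congr1 (cov_diff A th1 th2 p) (esym e)) H0.
have Wseg t' : 0 <= t' <= 1 -> W (w + t' *: (w' - w)).
  move=> t01; apply: ball_segment t01; first exact: Wg.
  by rewrite e; exact: Wg'.
have uA (y : 'rV[R]_d) : W y -> A y \in unitmx by move=> Wy; apply: lact_unitmx; exact:
    PS.
have Hq (y : 'rV[R]_d) : W y -> [/\ cov_diff A th1 th2 (w' - w) y = 0, th2 y (w' - w) =
    0,
    curv_form th1 y (w' - w) p = 0 & curv_form th2 y (w' - w) p = 0].
  move=> Wy.
  have t0 : 'd t y (w' - w) = 0 := etrans (dtT y _ Wy) qT.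
  have ty : 'd (ltgt g0 x2) (Phi y) ('d Phi y (w' - w)) = 0 := etrans (esym (dt y _
      Wy)) t0.
  have [om0 cv0] := ldefect_fibre_direction (PS y Wy) ty.
  split.
  + exact: etrans (OmE y (w' - w) Wy) om0.
  + apply: etrans (congr1 (conn_form D x2 x2 (t y)) t0) _.
    by apply: linear_at0; apply: lin2; exact: tO.
  + apply: etrans (curv_form_pullback (w' - w) p oW Wy Cs sO lin1 (conn_form_smooth D
      x1 x1)) _.
    apply: etrans (congr1 (fun q' => curv_form (conn_form D x1 x1) (s y) q' ('d s y p))
        (ds y (w' - w) Wy)) _.
    exact: cv0.
  + apply: etrans (curv_form_pullback (w' - w) p oW Wy Ct tO lin2 (conn_form_smooth D
      x2 x2)) _.
    apply: etrans (congr1 (fun q' => curv_form (conn_form D x2 x2) (t y) q' ('d t y p))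
        t0) _.
    exact: (curv_form0l _ og2 (tO y Wy) lin2).
have Ow : cov_diff A th1 th2 p w = 0.
  apply: etrans (OmE w p Wg) _.
  exact: etrans (congr1 (Om ('d Phi w p)) Pw) (inv0 ('d Phi w p)).
exact: (@cov_diff_const_along R _ k W A th1 th2 p w (w' - w) oW Wseg CA C1 C2 uA Hq Ow).
Qed.

End AtPoint.

(** The component tangent to the units is d1 (dt v); subtracting it leaves a vector of ker dt
    because t composed with the unit map is the identity. *)
Lemma inv_at_unit x v : inv_at rep D (gunit G x) v.
Proof.
set e := gunit G x; set w0 : 'rV[R]_n := tmap tgt e v.
have te : tmap tgt e (tmap (gunit G) x w0) = w0.
  rewrite -(tmap_comp w0 (unit_smooth G) I (tgt_smooth G) I).
  have -> : tgt \o gunit G = idfun by apply/funext => y; rewrite /= tgt_unit.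
  exact: tr_id (chart_at_dom x).
rewrite -[v](subrK (tmap (gunit G) x w0)); apply: inv_atD; last exact:
    inv_at_unit_tangent.
apply: inv_unit; rewrite /algebroid /=.
by rewrite /tmap linearB /= -/(tmap tgt e v) -/(tmap tgt e (tmap (gunit G) x w0)) te
    subrr.
Qed.

Lemma inv_at_all : (forall x : M, connected [set g : G | tgt g = x]) ->
  forall g v, inv_at rep D g v.
Proof.
move=> conn g; set x := tgt g.
pose inv (h : G) := forall v, inv_at rep D h v.
pose P := [set h : G | tgt h = x]; pose B := P `&` inv.
have PB : B = P.
  (* The points around which Q holds throughout the fibre form an open set of G. For Q the condition
     of being good, its trace on the fibre is the good part; for the negation, the bad part. This
     exhibits the good part as relatively open and closed. *)
  have openloc (Q : G -> Prop) :
      open [set h | exists O : set G, [/\ open O, O h & forall h', O h' -> P h' -> Q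
          h']].
    set Z := [set h | _]; rewrite openE => h [W [oW Wh HW]].
    by apply: (@nbhs_imply G h W _ (open_nbhs_nbhs (conj oW Wh))) => h' Wh'; exists W.
  apply: (conn x).
  - by exists (gunit G x); split; [exact: tgt_unit|exact: inv_at_unit].
  - exists [set h | exists O : set G, [/\ open O, O h & forall h', O h' -> P h' -> inv
      h']].
      exact: openloc.
    apply/seteqP; split=> h [Ph].
      have [W [oW Wh HW]] := inv_at_locally_const h.
      move=> ih; split=> //; exists W; split=> // h' Wh' Ph' v.
      by apply: (HW h h' Wh Wh' _ ih); rewrite Ph Ph'.
    by move=> [W [oW Wh HW]]; split=> //; exact: HW.
  - exists (~` [set h | exists O : set G, [/\ open O, O h & forall h', O h' -> P h' ->
      ~ inv h']]).
      exact: open_closedC (openloc _).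
    apply/seteqP; split=> h [Ph].
      by move=> ih; split=> // -[W [oW Wh HW]]; exact: HW h Wh Ph ih.
    move=> nh; split=> //; apply: contrapT => nih; apply: nh.
    have [W [oW Wh HW]] := inv_at_locally_const h.
    exists W; split=> // h' Wh' Ph' ih'; apply: nih.
    by apply: (HW h' h Wh' Wh _ ih'); rewrite Ph Ph'.
have : B g by rewrite PB.
by case.
Qed.

End LocalConstancy.

Theorem propositionA8 (R : realType) (n d k : nat) (M : mfd 'rV[R]_n)
    (M_hausdorff : hausdorff_space M) (M_second_countable : @second_countable M)
    (G : lie_groupoid M d)
    (G_tconn : forall x : M, connected [set g : G | tgt g = x])
    (V : vbundle M k) (rep : representation G V) (D : connection V) :
  invariant_connection rep D <->
  (forall (x : M) (a : 'rV[R]_d), algebroid G x a ->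
     (forall sigma : forall y, V y,
        near_pt (fun U => smooth_section U sigma) x ->
        nablaA rep a sigma (D sigma x (anchor G x a))) /\
     (forall v : 'rV[R]_n, curvature_vanishes D x (anchor G x a) v)).
Proof.
split=> [inv x a xa|H].
  have inv' g v : inv_at rep D g v by exact: inv.
  split=> [sigma ns|v]; first exact: nablaA_of_inv_at.
  exact: curvature_of_inv inv' xa.
apply: inv_at_all => // x a xa; last by have [] := H x a xa.
by apply: inv_at_of_nablaA => //; have [] := H x a xa.
Qed.
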